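(* Suppose $q\in I$, $p\notin I$ and $p$ is not a root of unity. Let $\nu\in{}^\theta\mathbb{N}I$ have multiplicity one, with $|\nu|=2m$, with $q$ a summand of $\nu$, and with connected support. Let $A$ be the path algebra of the quiver with two vertices $e_1,e_2$ and two arrows $u_1:e_1\to e_2$, $u_2:e_2\to e_1$, and $\tilde A$ the (isomorphic) path algebra of the quiver with two vertices $a_1,a_2$ and two arrows $v_1:a_1\to a_2$, $v_2:a_2\to a_1$. Then the algebras $\mathfrak{W}_\nu$ and $A^{\otimes(m-1)}\otimes_{\mathbf{k}}\tilde A$ are Morita equivalent.
   Context: **Setting.** $\mathbf{k}$ is a field with $\operatorname{char}\mathbf{k}\neq 2$; $p,q\in\mathbf{k}^\times$ are fixed with $p\neq\pm1$, $p$ not a power of $q$ and $q$ not a power of $p$. $\mathbb{Z}\rtimes\mathbb{Z}_2$ acts on $\mathbf{k}^\times$ by $(n,\varepsilon)\cdot\lambda=p^{2n}\lambda^{\varepsilon}$, $\varepsilon\in\{\pm1\}$. $I=I_q=\{p^{2n}q^{\pm1}\mid n\in\mathbb{Z}\}$, with $\pm1\notin I$; $I^\pm=\{p^{2n}q^{\pm1}\mid n\in\mathbb{Z}\}$, and it is assumed that $I=I^+\sqcup I^-$ is a disjoint union. $\Gamma_I$ is the quiver with vertex set $I$ and one arrow $p^2i\to i$ for every $i\in I$. ${}^\theta\mathbb{N}I$ is the set of formal sums $\nu=\sum_{i\in I}\nu_i i$ with finite support, $\nu_i\in\mathbb{Z}_{\ge0}$ and $\nu_i=\nu_{i^{-1}}$;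 $|\nu|=\sum_i\nu_i=2m$. $\nu$ has multiplicity one if $\nu_i\le1$ for all $i$. That $q$ is a summand of $\nu$ means $\nu_q\ge1$. Connected support means that $\{i\in I^+\mid\nu_i\ne0\}$ spans a connected subquiver of $\Gamma_I$, i.e. equals $\{p^{2n}q\mid a\le n\le b\}$ for some integers $a\le b$. ${}^\theta I^\nu=\{\mathbf{i}\in I^m\mid\sum_k i_k+\sum_k i_k^{-1}=\nu\}$ (formal sums). **Arrow notation.** $i\to j$ (equivalently $j\leftarrow i$): there is an arrow from $i$ to $j$ and none from $j$ to $i$; $i\leftrightarrow j$: arrows in both directions; $i\nleftrightarrow j$: $i\ne j$ and no arrows between them. **VV algebra.** $\mathfrak{W}_\nu$ is the $\mathbf{k}$-algebra generated by $x_1,\dots,x_m$, $\sigma_1,\dots,\sigma_{m-1}$, $\pi$, and $\mathbf{e}(\mathbf{i})$ for $\mathbf{i}\in{}^\theta I^\nu$ with relations ($s_k$ swaps entries $k,k+1$): (1) $\mathbf{e}(\mathbf{i})\mathbf{e}(\mathbf{j})=\delta_{\mathbf{ij}}\mathbf{e}(\mathbf{i})$, $\sigma_k\mathbf{e}(\mathbf{i})=\mathbf{e}(s_k\mathbf{i})\sigma_k$, $x_l\mathbf{e}(\mathbf{i})=\mathbf{e}(\mathbf{i})x_l$, $\sum_{\mathbf{i}}\mathbf{e}(\mathbf{i})=1$. (2) The $x_l$ commute. (3) $\sigma_k^2\mathbf{e}(\mathbf{i})$ equals $\mathbf{e}(\mathbf{i})$ if $i_k\nleftrightarrow i_{k+1}$;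 $(x_{k+1}-x_k)\mathbf{e}(\mathbf{i})$ if $i_k\leftarrow i_{k+1}$; $(x_k-x_{k+1})\mathbf{e}(\mathbf{i})$ if $i_k\to i_{k+1}$; $(x_{k+1}-x_k)(x_k-x_{k+1})\mathbf{e}(\mathbf{i})$ if $i_k\leftrightarrow i_{k+1}$; $0$ if $i_k=i_{k+1}$. $\sigma_j\sigma_k=\sigma_k\sigma_j$ for $|j-k|>1$. $(\sigma_{k+1}\sigma_k\sigma_{k+1}-\sigma_k\sigma_{k+1}\sigma_k)\mathbf{e}(\mathbf{i})$ equals, when $i_k=i_{k+2}$: $\mathbf{e}(\mathbf{i})$ if $i_k\to i_{k+1}$; $-\mathbf{e}(\mathbf{i})$ if $i_k\leftarrow i_{k+1}$; $(2x_{k+1}-x_{k+2}-x_k)\mathbf{e}(\mathbf{i})$ if $i_k\leftrightarrow i_{k+1}$; and $0$ in all other cases. (4) $(\sigma_kx_l-x_{s_k(l)}\sigma_k)\mathbf{e}(\mathbf{i})$ equals $-\mathbf{e}(\mathbf{i})$ if $l=k$, $i_k=i_{k+1}$; $\mathbf{e}(\mathbf{i})$ if $l=k+1$, $i_k=i_{k+1}$; $0$ otherwise. (5) $\pi\mathbf{e}(i_1,\dots,i_m)=\mathbf{e}(i_1^{-1},i_2,\dots,i_m)\pi$. (6) $\pi^2\mathbf{e}(\mathbf{i})$ equals $x_1\mathbf{e}(\mathbf{i})$ if $i_1=q$; $-x_1\mathbf{e}(\mathbf{i})$ if $i_1=q^{-1}$; $\mathbf{e}(\mathbf{i})$ otherwise.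 (7) $\pi x_1=-x_1\pi$; $\pi x_l=x_l\pi$ for $l>1$. (8) $(\sigma_1\pi)^2\mathbf{e}(\mathbf{i})-(\pi\sigma_1)^2\mathbf{e}(\mathbf{i})$ equals $\sigma_1\mathbf{e}(\mathbf{i})$ if $i_1^{-1}=i_2=q^{-1}$; $-\sigma_1\mathbf{e}(\mathbf{i})$ if $i_1^{-1}=i_2=q$; $0$ otherwise. $\pi\sigma_k=\sigma_k\pi$ for $k\ne1$. Path algebras are over $\mathbf{k}$, with no relations (infinite-dimensional); $u_1=e_2u_1e_1$, $u_2=e_1u_2e_2$, and likewise for $v_1,v_2$. *)

(* Defs.v *)
From HB Require Import structures.
From mathcomp Require Import all_boot all_order all_algebra all_fingroup.
From mathcomp Require Import generic_quotient ring_quotient.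
From mathcomp Require Import finmap multiset boolp.
From mathcomp Require Import monalg.

Set Implicit Arguments.
Unset Strict Implicit.
Unset Printing Implicit Defensive.

Import GRing.Theory.
Local Open Scope mset_scope.
Local Open Scope ring_scope.

(* MathComp's [algType k] requires 1 != 0. Whether a presented algebra is      *)
(* nonzero is a theorem, not part of its definition, so a k-algebra is here a  *)
(* possibly trivial unital ring with a central ring morphism from k.           *)
Record kalg (k : fieldType) := KAlg {
  kalg_ring :> pzRingType;
  kscal : {rmorphism k -> kalg_ring};
  kscalC : forall (c : k) (a : kalg_ring), kscal c * a = a * kscal c
}.

Section BaseField.
Variable k : fieldType.

Definition base_kalg : kalg k :=
  @KAlg k k (idfun : {rmorphism k -> k}) (fun c a => mulrC c a).

End BaseField.

(* Quotient of a k-algebra by the two-sided ideal generated by the elements    *)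
(* x - y with [rel x y].                                                       *)
Section Quotient.
Variables (k : fieldType) (F : kalg k) (rel : F -> F -> Prop).

Inductive gen_ideal : F -> Prop :=
| GenIdealRel a x y b : rel x y -> gen_ideal (a * (x - y) * b)
| GenIdeal0 : gen_ideal 0
| GenIdealD u v : gen_ideal u -> gen_ideal v -> gen_ideal (u + v).

Definition gen_pred : {pred F} := fun u => `[< gen_ideal u >].

Lemma gen_predP u : reflect (gen_ideal u) (u \in gen_pred).
Proof. exact: asboolP. Qed.

Lemma gen_idealN u : gen_ideal u -> gen_ideal (- u).
Proof.
elim=> [a x y b rxy||v w _ Iv _ Iw]; last by rewrite opprD; apply: GenIdealD.
- by rewrite -2!mulNr; apply: GenIdealRel.
- by rewrite oppr0; apply: GenIdeal0.
Qed.

Lemma gen_idealMl a u : gen_ideal u -> gen_ideal (a * u).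
Proof.
elim=> [b x y c rxy||v w _ Iv _ Iw]; last by rewrite mulrDr; apply: GenIdealD.
- by rewrite !mulrA; apply: GenIdealRel.
- by rewrite mulr0; apply: GenIdeal0.
Qed.

Lemma gen_idealMr a u : gen_ideal u -> gen_ideal (u * a).
Proof.
elim=> [b x y c rxy||v w _ Iv _ Iw]; last by rewrite mulrDl; apply: GenIdealD.
- by rewrite -mulrA; apply: GenIdealRel.
- by rewrite mul0r; apply: GenIdeal0.
Qed.

Fact gen_pred_zmod : zmod_closed gen_pred.
Proof.
split=> [|u v /gen_predP Iu /gen_predP Iv]; apply/gen_predP.
  exact: GenIdeal0.
by apply: GenIdealD => //; apply: gen_idealN.
Qed.
HB.instance Definition _ := GRing.isZmodClosed.Build F gen_pred gen_pred_zmod.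

Definition quo : Type := Quotient.quot (gen_pred : zmodClosed F).
HB.instance Definition _ := GRing.Zmodule.on quo.
HB.instance Definition _ := EqQuotient.on quo.

Local Open Scope quotient_scope.
Let pi (u : F) : quo := \pi u.

Let quo_piP u v : pi u = pi v <-> gen_ideal (u - v).
Proof.
split=> [/eqP|/gen_predP]; last by move=> I; apply/eqP; rewrite -Quotient.idealrBE.
by rewrite -Quotient.idealrBE => /gen_predP.
Qed.

Let piD u v : pi (u + v) = pi u + pi v.
Proof. exact: Quotient.pi_add. Qed.

Let quo_mul (a b : quo) : quo := pi (repr a * repr b).

Let pi_repr a : pi (repr a) = a.
Proof. exact: reprK. Qed.

Let piM u v : pi (u * v) = quo_mul (pi u) (pi v).
Proof.
apply/quo_piP; set u' := repr _; set v' := repr _.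
have Iu : gen_ideal (u - u') by apply/quo_piP; rewrite pi_repr.
have Iv : gen_ideal (v - v') by apply/quo_piP; rewrite pi_repr.
have -> : u * v - u' * v' = (u - u') * v + u' * (v - v').
  by rewrite mulrBl mulrBr addrA subrK.
by apply: GenIdealD; [apply: gen_idealMr | apply: gen_idealMl].
Qed.

Fact quo_mulA : associative quo_mul.
Proof.
move=> a b c; rewrite -[a]pi_repr -[b]pi_repr -[c]pi_repr.
by rewrite -!piM mulrA.
Qed.
Fact quo_mul1r : left_id (pi 1) quo_mul.
Proof. by move=> a; rewrite -[a]pi_repr -piM mul1r. Qed.
Fact quo_mulr1 : right_id (pi 1) quo_mul.
Proof. by move=> a; rewrite -[a]pi_repr -piM mulr1. Qed.
Fact quo_mulDl : left_distributive quo_mul +%R.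
Proof.
move=> a b c; rewrite -[a]pi_repr -[b]pi_repr -[c]pi_repr.
by rewrite -piD -!piM -piD mulrDl.
Qed.
Fact quo_mulDr : right_distributive quo_mul +%R.
Proof.
move=> a b c; rewrite -[a]pi_repr -[b]pi_repr -[c]pi_repr.
by rewrite -piD -!piM -piD mulrDr.
Qed.
HB.instance Definition _ := GRing.Zmodule_isPzRing.Build quo
  quo_mulA quo_mul1r quo_mulr1 quo_mulDl quo_mulDr.

Definition quo_pi (u : F) : quo := pi u.

Fact quo_pi_zmod : zmod_morphism quo_pi.
Proof. by move=> u v; exact: raddfB. Qed.
HB.instance Definition _ := GRing.isZmodMorphism.Build F quo quo_pi quo_pi_zmod.

Fact quo_pi_monoid : monoid_morphism quo_pi.
Proof. by split=> // u v; exact: piM. Qed.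
HB.instance Definition _ := GRing.isMonoidMorphism.Build F quo quo_pi quo_pi_monoid.

Lemma quo_pi_eqP u v : quo_pi u = quo_pi v <-> gen_ideal (u - v).
Proof. exact: quo_piP. Qed.

Lemma quo_pi_rel u v : rel u v -> quo_pi u = quo_pi v.
Proof.
by move=> ruv; apply/quo_pi_eqP; rewrite -[_ - _]mul1r -[_ * _]mulr1; apply: GenIdealRel.
Qed.

Lemma quo_pi_repr (a : quo) : quo_pi (repr a) = a.
Proof. exact: pi_repr. Qed.

Lemma quo_scalC (c : k) (a : quo) :
  (quo_pi \o @kscal k F) c * a = a * (quo_pi \o @kscal k F) c.
Proof. by rewrite -[a]quo_pi_repr /= -!rmorphM /= kscalC. Qed.

Definition quo_kalg : kalg k :=
  @KAlg k quo (quo_pi \o @kscal k F : {rmorphism k -> quo}) quo_scalC.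

End Quotient.

Section FreeAlgebra.
Variables (k : fieldType) (G : choiceType).

Lemma free_scalC (c : k) (a : {malg k[{fmonom G}]}) : c%:MP * a = a * c%:MP.
Proof.
rewrite (monalgE a) mulr_sumr mulr_suml; apply: eq_bigr => m _.
by rewrite !malgM_def !fgmulUU mul1m mulm1 mulrC.
Qed.

(* The free associative k-algebra on G: the algebra of the free monoid. *)
Definition free_kalg : kalg k :=
  @KAlg k {malg k[{fmonom G}]} (@malgC _ k : {rmorphism k -> {malg k[{fmonom G}]}})
    free_scalC.

Definition free_gen (g : G) : free_kalg := << fmu g >> : {malg k[{fmonom G}]}.

End FreeAlgebra.

(* A (x)_k B, presented by the pure tensors: bilinearity, and componentwise    *)
(* multiplication with unit 1 (x) 1. The latter two relations rewrite every    *)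
(* word in the generators as a pure tensor, so the underlying module is the    *)
(* usual tensor product over k.                                                *)
Section Tensor.
Variables (k : fieldType) (A B : kalg k).

Local Notation F := (free_kalg k (A * B)%type).
Local Notation "a ⊗ b" := (@free_gen k (A * B)%type (a, b) : F) (at level 35).

Inductive tens_rel : F -> F -> Prop :=
| TensDl a a' b : tens_rel ((a + a') ⊗ b) (a ⊗ b + a' ⊗ b)
| TensDr a b b' : tens_rel (a ⊗ (b + b')) (a ⊗ b + a ⊗ b')
| TensZl c a b : tens_rel ((kscal A c * a) ⊗ b) (kscal F c * (a ⊗ b))
| TensZr c a b : tens_rel (a ⊗ (kscal B c * b)) (kscal F c * (a ⊗ b))
| TensM a a' b b' : tens_rel ((a ⊗ b) * (a' ⊗ b')) ((a * a') ⊗ (b * b'))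
| Tens1 : tens_rel (1 ⊗ 1) 1.

Definition tens : kalg k := quo_kalg tens_rel.

End Tensor.

Fixpoint tens_pow (k : fieldType) (A : kalg k) (n : nat) : kalg k :=
  match n with
  | 0 => base_kalg k
  | 1 => A
  | n'.+1 => tens A (tens_pow A n')
  end.

Record quiver := Quiver {
  vertex : finType;
  arrow : choiceType;
  qsrc : arrow -> vertex;
  qtgt : arrow -> vertex
}.

Section Paths.
Variable Q : quiver.

(* A path is a starting vertex followed by its arrows in the order in which    *)
(* they are travelled.                                                         *)
Fixpoint is_walk (v : vertex Q) (w : seq (arrow Q)) : bool :=
  if w is a :: w' then (qsrc a == v) && is_walk (qtgt a) w' else true.

Record qpath := QPath {
  qpath_val :> vertex Q * seq (arrow Q);
  _ : is_walk qpath_val.1 qpath_val.2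
}.
HB.instance Definition _ := [isSub for qpath_val].
HB.instance Definition _ := [Choice of qpath by <:].

Definition walk_end (v : vertex Q) (w : seq (arrow Q)) : vertex Q :=
  last v [seq qtgt a | a <- w].

Definition psrc (x : qpath) : vertex Q := (val x).1.
Definition ptgt (x : qpath) : vertex Q := walk_end (val x).1 (val x).2.

Definition ptriv (v : vertex Q) : qpath := @QPath (v, [::]) isT.

Lemma is_walk_cat v w w' :
  is_walk v (w ++ w') = is_walk v w && is_walk (walk_end v w) w'.
Proof. by elim: w v => //= a w IHw v; rewrite IHw andbA. Qed.

Lemma walk_end_cat v w w' :
  walk_end v (w ++ w') = walk_end (walk_end v w) w'.
Proof. by rewrite /walk_end map_cat last_cat. Qed.

(* Composition is written from right to left: [pcomp x y] travels y, then x,   *)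
(* so that an arrow a satisfies a = e_(qtgt a) a e_(qsrc a).                   *)
Definition pcomp (x y : qpath) : option qpath :=
  if ptgt y == psrc x then insub ((val y).1, (val y).2 ++ (val x).2) else None.

Lemma pcompP (x y : qpath) (e : ptgt y = psrc x) :
  {z : qpath | pcomp x y = Some z & val z = ((val y).1, (val y).2 ++ (val x).2)}.
Proof.
rewrite /pcomp e eqxx; case: insubP => [z _ ez|/=]; first by exists z.
rewrite is_walk_cat (valP y) /= -[walk_end _ _]/(ptgt y) e.
by rewrite (valP x).
Qed.

Lemma pcompA (x y z : qpath) :
  obind (pcomp x) (pcomp y z) = obind (pcomp^~ z) (pcomp x y).
Proof.
have [ezy|nzy] := eqVneq (ptgt z) (psrc y); last first.
  rewrite {2}/pcomp (negPf nzy) /=.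
  have [eyx|nyx] := eqVneq (ptgt y) (psrc x); last by rewrite /pcomp (negPf nyx).
  have [u -> eu] := pcompP eyx.
  by rewrite /= /pcomp [psrc u]/psrc eu /= (negPf nzy).
have [t -> et] := pcompP ezy => /=.
have tt : ptgt t = ptgt y.
  by rewrite /ptgt et /= walk_end_cat -/(ptgt z) ezy.
have [eyx|nyx] := eqVneq (ptgt y) (psrc x); last first.
  by rewrite /pcomp tt (negPf nyx).
have [u -> eu] := pcompP eyx => /=.
have [r -> er] := pcompP (etrans tt eyx).
have su : psrc u = psrc y by rewrite /psrc eu.
have [s -> es] := pcompP (etrans ezy (esym su)).
by congr Some; apply: val_inj; rewrite er es et eu /= catA.
Qed.

Lemma pcomp_trivl v (x : qpath) :
  pcomp (ptriv v) x = if ptgt x == v then Some x else None.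
Proof.
rewrite /pcomp [psrc _]/=; case: eqP => // _; rewrite cats0.
by rewrite -surjective_pairing valK.
Qed.

Lemma pcomp_trivr v (x : qpath) :
  pcomp x (ptriv v) = if psrc x == v then Some x else None.
Proof.
rewrite /pcomp eq_sym; case: eqP => // e.
by rewrite /= -[v]/(ptgt (ptriv v)) -e -surjective_pairing valK.
Qed.

End Paths.

Section BilinearAssoc.
Variables (k : fieldType) (P : Type) (V : lmodType k) (b : P -> V).
Variable mul : V -> V -> V.
Hypothesis V_ind : forall S : V -> Prop,
  (forall c x, S (c *: b x)) -> S 0 -> (forall f g, S f -> S g -> S (f + g)) ->
  forall f, S f.
Hypothesis mulDl : left_distributive mul +%R.
Hypothesis mulDr : right_distributive mul +%R.
Hypothesis mulZl : forall c f g, mul (c *: f) g = c *: mul f g.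
Hypothesis mulZr : forall c f g, mul f (c *: g) = c *: mul f g.
Hypothesis mul0l : forall g, mul 0 g = 0.
Hypothesis mul0r : forall f, mul f 0 = 0.

Variable comp : P -> P -> option P.
Hypothesis compA : forall x y z,
  obind (comp x) (comp y z) = obind (comp^~ z) (comp x y).
Hypothesis mulb : forall x y, mul (b x) (b y) = if comp x y is Some z then b z else 0.

Lemma bilin_assoc : associative mul.
Proof.
have mulbA x y z : mul (b x) (mul (b y) (b z)) = mul (mul (b x) (b y)) (b z).
  rewrite !mulb; have := compA x y z.
  case: (comp y z) (comp x y) => [t|] [u|] /=; rewrite ?(mul0l, mul0r, mulb) //.
  - by move->.
  - by move->.
  - by move<-.
move=> f g h; move: f; apply: V_ind => [c1 x||f1 f2 IH1 IH2]; last 2 first.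
- by rewrite !mul0l.
- by rewrite !mulDl IH1 IH2.
move: g; apply: V_ind => [c2 y||g1 g2 IH1 IH2]; last 2 first.
- by rewrite !(mul0l, mul0r).
- by rewrite !(mulDl, mulDr) IH1 IH2.
move: h; apply: V_ind => [c3 z||h1 h2 IH1 IH2]; last 2 first.
- by rewrite !mul0r.
- by rewrite !mulDr IH1 IH2.
by rewrite !(mulZl, mulZr) mulbA !scalerA -[in RHS]mulrA [in RHS]mulrC.
Qed.

End BilinearAssoc.

Section PathAlgebra.
Variables (k : fieldType) (Q : quiver).

Local Notation M := {malg k[qpath Q]}.

Definition pbasis (x : qpath Q) : M := << x >>.

Definition pmul (x y : qpath Q) : M :=
  if pcomp x y is Some z then pbasis z else 0.

Definition path_mul (f g : M) : M :=
  \sum_(x <- msupp f) \sum_(y <- msupp g) (f@_x * g@_y) *: pmul x y.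

Definition path_one : M := \sum_(v : vertex Q) pbasis (ptriv v).

Lemma path_mulw (d1 d2 : {fset qpath Q}) (f g : M) :
    (msupp f `<=` d1)%fset -> (msupp g `<=` d2)%fset ->
  path_mul f g = \sum_(x <- d1) \sum_(y <- d2) (f@_x * g@_y) *: pmul x y.
Proof.
move=> le1 le2; rewrite /path_mul (big_fset_incl _ le1) /=.
  apply/eq_bigr=> x _; apply/big_fset_incl => // y _ /mcoeff_outdom ->.
  by rewrite mulr0 scale0r.
move=> x _ /mcoeff_outdom fx.
by rewrite big1 // => y _; rewrite fx mul0r scale0r.
Qed.

Fact path_mulDl : left_distributive path_mul +%R.
Proof.
move=> f1 f2 g.
rewrite (path_mulw (msuppD_le f1 f2) (fsubset_refl _)).
rewrite (path_mulw (fsubsetUl (msupp f1) (msupp f2)) (fsubset_refl (msupp g))).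
rewrite (path_mulw (fsubsetUr (msupp f1) (msupp f2)) (fsubset_refl (msupp g))).
rewrite -big_split /=; apply/eq_bigr=> x _.
rewrite -big_split /=; apply/eq_bigr=> y _.
by rewrite mcoeffD mulrDl scalerDl.
Qed.

Fact path_mulDr : right_distributive path_mul +%R.
Proof.
move=> f g1 g2.
rewrite (path_mulw (fsubset_refl _) (msuppD_le g1 g2)).
rewrite (path_mulw (fsubset_refl (msupp f)) (fsubsetUl (msupp g1) (msupp g2))).
rewrite (path_mulw (fsubset_refl (msupp f)) (fsubsetUr (msupp g1) (msupp g2))).
rewrite -big_split /=; apply/eq_bigr=> x _.
rewrite -big_split /=; apply/eq_bigr=> y _.
by rewrite mcoeffD mulrDr scalerDl.
Qed.

Lemma path_mulZl c (f g : M) : path_mul (c *: f) g = c *: path_mul f g.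
Proof.
rewrite (path_mulw (msuppZ_le c f) (fsubset_refl _)) /path_mul scaler_sumr.
apply: eq_bigr => x _; rewrite scaler_sumr; apply: eq_bigr => y _.
by rewrite mcoeffZ scalerA mulrA.
Qed.

Lemma path_mulZr c (f g : M) : path_mul f (c *: g) = c *: path_mul f g.
Proof.
rewrite (path_mulw (fsubset_refl _) (msuppZ_le c g)) /path_mul scaler_sumr.
apply: eq_bigr => x _; rewrite scaler_sumr; apply: eq_bigr => y _.
by rewrite mcoeffZ scalerA mulrCA.
Qed.

Lemma path_mul0l g : path_mul 0 g = 0.
Proof. by rewrite -(scale0r (0 : M)) path_mulZl !scale0r. Qed.

Lemma path_mul0r f : path_mul f 0 = 0.
Proof. by rewrite -(scale0r (0 : M)) path_mulZr !scale0r. Qed.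

Lemma path_mulU x y : path_mul (pbasis x) (pbasis y) = pmul x y.
Proof.
rewrite (path_mulw (@msuppU_le _ _ x 1) (@msuppU_le _ _ y 1)).
by rewrite !big_seq_fset1 !mcoeffUU mul1r scale1r.
Qed.

Lemma malgUZ (c : k) x : << c *g x >> = c *: pbasis x.
Proof.
apply/malgP => y. rewrite mcoeffZ. rewrite /pbasis. rewrite [LHS]mcoeffU.
rewrite [X in _ * X]mcoeffU. by rewrite mulrnAr mulr1.
Qed.

Lemma path_malg_ind (P : M -> Prop) :
    (forall c x, P (c *: pbasis x)) -> P 0 ->
    (forall f g, P f -> P g -> P (f + g)) -> forall f, P f.
Proof.
move=> PU P0 PD f; rewrite [f](monalgE f).
apply: (big_ind P) => // x _.
by rewrite malgUZ.
Qed.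

Fact path_mulA : associative path_mul.
Proof.
exact: (bilin_assoc path_malg_ind path_mulDl path_mulDr path_mulZl path_mulZr
  path_mul0l path_mul0r (@pcompA Q) path_mulU).
Qed.

Fact path_mul1r : left_id path_one path_mul.
Proof.
apply: path_malg_ind => [c x||f g IHf IHg]; rewrite ?path_mul0r //; last first.
  by rewrite path_mulDr IHf IHg.
rewrite path_mulZr; congr (_ *: _).
rewrite /path_one (big_morph (path_mul^~ _) (fun f g => path_mulDl f g _) (path_mul0l _)).
rewrite (bigD1 (ptgt x)) //= path_mulU /pmul pcomp_trivl eqxx.
rewrite big1 ?addr0 // => v nv; rewrite path_mulU /pmul pcomp_trivl.
by rewrite eq_sym (negPf nv).
Qed.

Fact path_mulr1 : right_id path_one path_mul.
Proof.
apply: path_malg_ind => [c x||f g IHf IHg]; rewrite ?path_mul0l //; last first.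
  by rewrite path_mulDl IHf IHg.
rewrite path_mulZl; congr (_ *: _).
rewrite /path_one (big_morph (path_mul _) (fun f g => path_mulDr _ f g) (path_mul0r _)).
rewrite (bigD1 (psrc x)) //= path_mulU /pmul pcomp_trivr eqxx.
rewrite big1 ?addr0 // => v nv; rewrite path_mulU /pmul pcomp_trivr.
by rewrite eq_sym (negPf nv).
Qed.

Lemma path_scalM c d :
  (c * d) *: path_one = path_mul (c *: path_one) (d *: path_one).
Proof. by rewrite path_mulZl path_mul1r scalerA. Qed.

Lemma path_scal_comm c f : path_mul (c *: path_one) f = path_mul f (c *: path_one).
Proof. by rewrite path_mulZl path_mulZr path_mul1r path_mulr1. Qed.

Definition pathalg : Type := M.
HB.instance Definition _ := GRing.Lmodule.on pathalg.
HB.instance Definition _ := GRing.Zmodule_isPzRing.Build pathalg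
  path_mulA path_mul1r path_mulr1 path_mulDl path_mulDr.

Definition path_scal (c : k) : pathalg := (c *: path_one : M).

Fact path_scal_zmod : zmod_morphism path_scal.
Proof. by move=> c d; rewrite /path_scal scalerBl. Qed.
HB.instance Definition _ :=
  GRing.isZmodMorphism.Build k pathalg path_scal path_scal_zmod.

Fact path_scal_monoid : monoid_morphism path_scal.
Proof. by split=> [|c d]; [exact: (scale1r path_one) | exact: path_scalM]. Qed.
HB.instance Definition _ :=
  GRing.isMonoidMorphism.Build k pathalg path_scal path_scal_monoid.

Lemma path_scalC (c : k) (f : pathalg) : path_scal c * f = f * path_scal c.
Proof. exact: path_scal_comm. Qed.

Definition path_kalg : kalg k :=
  @KAlg k pathalg (path_scal : {rmorphism k -> pathalg}) path_scalC.

End PathAlgebra.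

(* Vertices e_1 = false, e_2 = true; arrows u_1 = false : e_1 -> e_2 and       *)
(* u_2 = true : e_2 -> e_1.                                                    *)
Definition two_cycle : quiver := @Quiver bool bool id negb.

(* Left modules; the scalar action of c : k on an A-module is that of kscal c. *)
Section Morita.
Variable k : fieldType.

Record lin_functor (A B : kalg k) := LinFunctor {
  fobj :> lmodType A -> lmodType B;
  fmap : forall M N : lmodType A, {linear M -> N} -> {linear fobj M -> fobj N};
  fmap_id : forall M (v : fobj M), fmap (idfun : {linear M -> M}) v = v;
  fmap_comp : forall (M N P : lmodType A) (g : {linear N -> P}) (f : {linear M -> N}) v,
    fmap (g \o f : {linear M -> P}) v = fmap g (fmap f v);
  fmap_lin : forall (M N : lmodType A) (c : k) (f g h : {linear M -> N}),
    (forall v, h v = kscal A c *: f v + g v) ->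
    forall v, fmap h v = kscal B c *: fmap f v + fmap g v
}.

(* Natural isomorphism from the identity functor to G \o F. *)
Definition id_iso_comp (A B : kalg k) (F : lin_functor A B) (G : lin_functor B A) : Prop :=
  exists eta : forall M : lmodType A, {linear M -> G (F M)},
    (forall M, bijective (eta M)) /\
    (forall (M N : lmodType A) (f : {linear M -> N}) v,
        eta N (f v) = fmap G (fmap F f) (eta M v)).

Definition morita_equivalent (A B : kalg k) : Prop :=
  exists (F : lin_functor A B) (G : lin_functor B A),
    id_iso_comp F G /\ id_iso_comp G F.

End Morita.

Section Orbit.
Variables (k : fieldType) (p q : k).

Definition in_Iplus (a : k) : Prop := exists n : int, a = p ^ (2 * n) * q.
Definition in_Iminus (a : k) : Prop := exists n : int, a = p ^ (2 * n) * q^-1.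
Definition in_I (a : k) : Prop := in_Iplus a \/ in_Iminus a.

(* The arrows p^2 j -> j of Gamma_I. *)
Definition arrowI (i j : k) : bool := i == p ^+ 2 * j.
Definition arr_only (i j : k) : bool := arrowI i j && ~~ arrowI j i.
Definition arr_both (i j : k) : bool := arrowI i j && arrowI j i.
Definition arr_none (i j : k) : bool := [&& i != j, ~~ arrowI i j & ~~ arrowI j i].

(* A multiset nu : {mset k} is a finitely supported function k -> nat. *)
Definition is_thetaNI (nu : {mset k}) : Prop :=
  (forall a, nu a <> 0%N -> in_I a) /\ (forall a, nu a = nu a^-1).

Definition multiplicity_one (nu : {mset k}) : Prop := forall a, (nu a <= 1)%N.

Definition connected_support (nu : {mset k}) : Prop :=
  exists a b : int, (a <= b)%R /\
    forall i : k, (in_Iplus i /\ nu i <> 0%N) <->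
      (exists n : int, (a <= n <= b)%R /\ i = p ^ (2 * n) * q).

End Orbit.

Definition mset_height (k : fieldType) (nu : {mset k}) : nat :=
  \sum_(a <- finsupp nu) nu a.

Section Positions.
Variable m : nat.

(* sigma_k is indexed by k : 'I_m.-1 (counting from 0); [pos0 k] and [pos1 k]  *)
(* are the two neighbouring positions it exchanges.                            *)
Lemma pos1_subproof (k : 'I_m.-1) : (k.+1 < m)%N.
Proof. by case: m k => [|n] []. Qed.

Definition pos0 (k : 'I_m.-1) : 'I_m := Ordinal (ltnW (pos1_subproof k)).
Definition pos1 (k : 'I_m.-1) : 'I_m := Ordinal (pos1_subproof k).
Definition spos (k : 'I_m.-1) (l : 'I_m) : 'I_m := tperm (pos0 k) (pos1 k) l.

End Positions.

Section ThetaSequences.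
Variables (k : fieldType) (nu : {mset k}) (m : nat).

Definition theta_seq (i : seq k) : bool :=
  (seq_mset i `+` seq_mset [seq a^-1 | a <- i])%mset == nu.

Record thetaI := ThetaI { theta_val :> m.-tuple k; _ : theta_seq theta_val }.
HB.instance Definition _ := [isSub for theta_val].
HB.instance Definition _ := [Choice of thetaI by <:].

Lemma theta_supp (i : thetaI) l : tnth i l \in finsupp nu.
Proof.
rewrite mem_finsupp -(eqP (valP i)) msetE2 mset_seqE addn_eq0 negb_and.
by rewrite -lt0n -has_count has_pred1 mem_tnth.
Qed.

Definition theta_code (i : thetaI) : m.-tuple (finsupp nu) :=
  [tuple [` theta_supp i l]%fset | l < m].
Definition theta_decode (t : m.-tuple (finsupp nu)) : option thetaI :=
  insub [tuple val (tnth t l) | l < m].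

Lemma theta_codeK : pcancel theta_code theta_decode.
Proof.
move=> i; rewrite /theta_decode.
have -> : [tuple val (tnth (theta_code i) l) | l < m] = val i.
  by apply: eq_from_tnth => l; rewrite !tnth_mktuple.
by rewrite valK.
Qed.
HB.instance Definition _ := PCanIsCountable theta_codeK.
HB.instance Definition _ : isFinite thetaI := PCanIsFinite theta_codeK.

Lemma theta_seq_swap (i : thetaI) (j : 'I_m.-1) :
  theta_seq [tuple tnth i (spos j l) | l < m].
Proof.
apply/eqP; apply: etrans (eqP (valP i)).
have pe : perm_eq [tuple tnth i (spos j l) | l < m] i.
  apply/tuple_permP; exists (tperm (pos0 j) (pos1 j)).
  by congr val; apply: eq_from_tnth => l; rewrite !tnth_mktuple.
congr (_ `+` _)%mset; apply/eq_seq_msetP => //.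
exact: perm_map.
Qed.
Definition theta_swap (j : 'I_m.-1) (i : thetaI) : thetaI := ThetaI (theta_seq_swap i j).

Lemma theta_seq_inv (i : thetaI) :
  theta_seq [tuple if l == 0 :> nat then (tnth i l)^-1 else tnth i l | l < m].
Proof.
apply/eqP; apply: etrans (eqP (valP i)).
have cnt (t : m.-tuple k) a :
    (seq_mset t `+` seq_mset [seq b^-1 | b <- t])%mset a =
    (\sum_(l < m) ((tnth t l == a) + ((tnth t l)^-1 == a)))%N.
  rewrite msetE2 !mset_seqE count_map -!sum1_count !big_mkcond !big_tuple big_split /=.
  rewrite [X in (_ + X = _)%N]big_mkcond.
  by congr (_ + _)%N; apply: eq_bigr => l _; case: (_ == a).
apply/msetP => a; rewrite !cnt; apply: eq_bigr => l _.
by rewrite tnth_mktuple; case: (_ == 0)%N; rewrite // invrK addnC.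
Qed.
Definition theta_inv (i : thetaI) : thetaI := ThetaI (theta_seq_inv i).

End ThetaSequences.

Inductive vvgen (m : nat) (T : Type) : Type :=
| GenX of 'I_m
| GenSigma of 'I_m.-1
| GenPi
| GenE of T.
Arguments GenX {m T}.
Arguments GenSigma {m T}.
Arguments GenPi {m T}.
Arguments GenE {m T}.

Section VVGenChoice.
Variables (m : nat) (T : choiceType).

Definition vvgen_code (g : vvgen m T) : 'I_m + 'I_m.-1 + option T :=
  match g with
  | GenX l => inl (inl l)
  | GenSigma j => inl (inr j)
  | GenPi => inr None
  | GenE i => inr (Some i)
  end.
Definition vvgen_decode (s : 'I_m + 'I_m.-1 + option T) : vvgen m T :=
  match s with
  | inl (inl l) => GenX l
  | inl (inr j) => GenSigma j
  | inr None => GenPi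
  | inr (Some i) => GenE i
  end.
Lemma vvgen_codeK : cancel vvgen_code vvgen_decode.
Proof. by case. Qed.
HB.instance Definition _ := Equality.copy (vvgen m T) (can_type vvgen_codeK).
HB.instance Definition _ := Choice.copy (vvgen m T) (can_type vvgen_codeK).

End VVGenChoice.

Section VV.
Variables (k : fieldType) (p q : k) (nu : {mset k}) (m : nat).

Local Notation TI := (thetaI nu m).
Local Notation F := (free_kalg k (vvgen m TI)).
Local Notation x l := (free_gen k (GenX l : vvgen m TI)).
Local Notation σ j := (free_gen k (GenSigma j : vvgen m TI)).
Local Notation π := (free_gen k (GenPi : vvgen m TI)).
Local Notation e i := (free_gen k (GenE i : vvgen m TI)).

Definition sigma_sq (j : 'I_m.-1) (i : TI) : F :=
  let a := tnth i (pos0 j) in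
  let b := tnth i (pos1 j) in
  if a == b then 0
  else if arr_none p a b then 1
  else if arr_only p b a then x (pos1 j) - x (pos0 j)
  else if arr_only p a b then x (pos0 j) - x (pos1 j)
  else (x (pos1 j) - x (pos0 j)) * (x (pos0 j) - x (pos1 j)).

Definition braid_defect (j j' : 'I_m.-1) (i : TI) : F :=
  let a := tnth i (pos0 j) in
  let b := tnth i (pos1 j) in
  if a != tnth i (pos1 j') then 0
  else if arr_only p a b then 1
  else if arr_only p b a then - 1
  else if arr_both p a b then x (pos1 j) *+ 2 - x (pos1 j') - x (pos0 j)
  else 0.

Definition sigma_x_defect (j : 'I_m.-1) (l : 'I_m) (i : TI) : F :=
  if tnth i (pos0 j) != tnth i (pos1 j) then 0
  else if l == pos0 j then - 1
  else if l == pos1 j then 1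
  else 0.

Definition pi_sq (l : 'I_m) (i : TI) : F :=
  if tnth i l == q then x l else if tnth i l == q^-1 then - x l else 1.

Definition pi_braid_defect (j : 'I_m.-1) (i : TI) : F :=
  let a := tnth i (pos0 j) in
  let b := tnth i (pos1 j) in
  if (a^-1 == b) && (b == q^-1) then σ j
  else if (a^-1 == b) && (b == q) then - σ j
  else 0.

Inductive vv_rel : F -> F -> Prop :=
| VVee (i i' : TI) : vv_rel (e i * e i') (if i == i' then e i else 0)
| VVse (j : 'I_m.-1) (i : TI) : vv_rel (σ j * e i) (e (theta_swap j i) * σ j)
| VVxe (l : 'I_m) (i : TI) : vv_rel (x l * e i) (e i * x l)
| VVe1 : vv_rel (\sum_(i : TI) e i) 1
| VVxx (l l' : 'I_m) : vv_rel (x l * x l') (x l' * x l)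
| VVsq (j : 'I_m.-1) (i : TI) : vv_rel (σ j ^+ 2 * e i) (sigma_sq j i * e i)
| VVfar (j j' : 'I_m.-1) : (j.+1 < j')%N || (j'.+1 < j)%N ->
    vv_rel (σ j * σ j') (σ j' * σ j)
| VVbraid (j j' : 'I_m.-1) (i : TI) : j' = j.+1 :> nat ->
    vv_rel ((σ j' * σ j * σ j' - σ j * σ j' * σ j) * e i) (braid_defect j j' i * e i)
| VVsx (j : 'I_m.-1) (l : 'I_m) (i : TI) :
    vv_rel ((σ j * x l - x (spos j l) * σ j) * e i) (sigma_x_defect j l i * e i)
(* [l = 0] and [j = 0] select x_1 and sigma_1 *)
| VVpe (i : TI) : vv_rel (π * e i) (e (theta_inv i) * π)
| VVpp (l : 'I_m) (i : TI) : l = 0 :> nat -> vv_rel (π ^+ 2 * e i) (pi_sq l i * e i)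
| VVpx0 (l : 'I_m) : l = 0 :> nat -> vv_rel (π * x l) (- (x l * π))
| VVpx (l : 'I_m) : l <> 0 :> nat -> vv_rel (π * x l) (x l * π)
| VVpbraid (j : 'I_m.-1) (i : TI) : j = 0 :> nat ->
    vv_rel ((σ j * π) ^+ 2 * e i - (π * σ j) ^+ 2 * e i) (pi_braid_defect j i * e i)
| VVps (j : 'I_m.-1) : j <> 0 :> nat -> vv_rel (π * σ j) (σ j * π).

Definition vv_kalg : kalg k := quo_kalg vv_rel.

End VV.

(* Main.v *)
From HB Require Import structures.
Require Import Defs.
From mathcomp Require Import all_boot all_order all_algebra all_fingroup.
From mathcomp Require Import generic_quotient.
From mathcomp Require Import finmap multiset boolp monalg.
From mathcomp Require Import zify.

Set Implicit Arguments.
Unset Strict Implicit.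
Unset Printing Implicit Defensive.

Import Order.TTheory GRing.Theory Num.Theory.
Local Open Scope mset_scope.
Local Open Scope ring_scope.

(** In multiplicity one, the sequences in the idempotents of the VV algebra W are the
    signed orderings of the m vertices of the support, that is, the chambers of the
    hyperplane arrangement of type B_m: a sequence assigns to each vertex v its signed
    position t_v.  The generators sigma_k and pi cross the walls of a chamber, and all
    correction terms in the relations vanish.  Crossing a wall back and forth is the
    identity, except at the m hyperplanes t_q = 0 and t_v = t_w for v, w joined by an
    arrow, where it is multiplication by y_q or by y_v - y_w up to sign.  Here y_v is a
    central element: the generator x at the place of v, with the sign of v.  Since the
    support is a segment that contains q, it is a tree rooted at q, and the m hyperplanes
    and their m factors are independent.  So, up to isomorphic objects, W is the category
    with 2^m objects, the regions cut out by these hyperplanes, which is the product over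
    the hyperplanes of the category with two objects, one arrow each way and nothing else
    but their composites.  The path algebra of the latter is A.

    For every two chambers the products of generators along shortest galleries from one
    to the other agree ([gallery_uniq], the argument of Matsumoto), and such elements
    compose up to the factors of the hyperplanes crossed twice ([gal_comp]).  Chambers of
    one region are therefore isomorphic ([gl_inv]).  Each region has a representative in
    which the vertices are listed in a fixed order, parents first, with arbitrary signs
    ([reg_rep]).  The sum e of the idempotents of the representatives is full, and it
    remains to identify e W e with the tensor product T ([morita_corner]).

    Both are described through the cube: commuting elements U_h and idempotents f_h, one
    pair for each hyperplane, with U_h f_h = (1 - f_h) U_h.  T is presented by these
    relations ([two_cycle_tens_cube]); in e W e the element U_h crosses the hyperplane h
    from each representative ([corner_cube]).  This defines a morphism phi from T to
    e W e.  It is surjective because its image spans W e together with the paths that leave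
    the representatives ([phi_span]).  It is injective because W acts on T-valued functions
    on the chambers, a generator multiplying by the U_h of the hyperplanes it crosses
    ([matrix_model]), and phi is recovered from this action ([phiK_theta]). *)

(** * Morita equivalence from a full corner *)

(** A multiplicative map from A to the matrices over B indexed by X, which need
    not preserve 1.  It turns a B-module N into the A-module psi(1) N^X; both
    functors of the equivalence have this form, with X a point for one of them. *)
Record mxhom (k : fieldType) (A B : kalg k) (X : finType) := MxHom {
  mxhom_fun :> X -> X -> A -> B;
  mxhomD : forall i j a a', mxhom_fun i j (a + a') = mxhom_fun i j a + mxhom_fun i j a';
  mxhomM : forall i j a a',
    mxhom_fun i j (a * a') = \sum_l mxhom_fun i l a * mxhom_fun l j a';
  mxhomZ : forall i j c a, mxhom_fun i j (kscal A c * a) = kscal B c * mxhom_fun i j a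
}.

Section MxAct.
Variables (k : fieldType) (A B : kalg k) (X : finType) (psi : mxhom A B X).
Variable N : lmodType B.

Definition mxact (a : A) (v : {ffun X -> N}) : {ffun X -> N} :=
  [ffun i => \sum_j psi i j a *: v j].

Lemma mxactD a v w : mxact a (v + w) = mxact a v + mxact a w.
Proof.
apply/ffunP => i; rewrite !ffunE -big_split /=.
by apply: eq_bigr => j _; rewrite !ffunE scalerDr.
Qed.

Lemma mxactN a v : mxact a (- v) = - mxact a v.
Proof.
apply/ffunP => i; rewrite !ffunE -sumrN.
by apply: eq_bigr => j _; rewrite !ffunE scalerN.
Qed.

Lemma mxactDl a b v : mxact (a + b) v = mxact a v + mxact b v.
Proof.
apply/ffunP => i; rewrite !ffunE -big_split /=.
by apply: eq_bigr => j _; rewrite mxhomD scalerDl.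
Qed.

Lemma mxactM a b v : mxact (a * b) v = mxact a (mxact b v).
Proof.
apply/ffunP => i; rewrite !ffunE.
under eq_bigr do rewrite mxhomM scaler_suml.
rewrite exchange_big /=; apply: eq_bigr => l _.
by rewrite ffunE scaler_sumr; apply: eq_bigr => j _; rewrite scalerA.
Qed.

(** As psi(1) is idempotent, the image psi(1) N^X is the set of its fixed points. *)
Definition mxfix_pred : {pred {ffun X -> N}} := fun v => mxact 1 v == v.

Fact mxfix_zmod : zmod_closed mxfix_pred.
Proof.
split=> [|v w /eqP Pv /eqP Pw]; apply/eqP.
  by apply/ffunP => i; rewrite !ffunE big1 // => j _; rewrite ffunE scaler0.
by rewrite mxactD mxactN Pv Pw.
Qed.
HB.instance Definition _ := GRing.isZmodClosed.Build _ mxfix_pred mxfix_zmod.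

Record mxmod := MxMod { mxmod_val : {ffun X -> N}; _ : mxmod_val \in mxfix_pred }.
HB.instance Definition _ := [isSub for mxmod_val].
HB.instance Definition _ := [Choice of mxmod by <:].
HB.instance Definition _ := [SubChoice_isSubZmodule of mxmod by <:].

Lemma mxmod_fix (v : mxmod) : mxact 1 (mxmod_val v) = mxmod_val v.
Proof. exact: eqP (valP v). Qed.

Lemma mxscale_subproof a (v : mxmod) : mxact a (mxmod_val v) \in mxfix_pred.
Proof. by apply/eqP; rewrite -mxactM mul1r. Qed.

Definition mxscale a (v : mxmod) : mxmod := MxMod (mxscale_subproof a v).

Fact mxscaleA a b v : mxscale a (mxscale b v) = mxscale (a * b) v.
Proof. by apply: val_inj; rewrite /= mxactM. Qed.
Fact mxscale1 : left_id 1 mxscale.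
Proof. by move=> v; apply: val_inj; rewrite /= mxmod_fix. Qed.
Fact mxscaleDr : right_distributive mxscale +%R.
Proof. by move=> a v w; apply: val_inj; rewrite /= mxactD. Qed.
Fact mxscaleDl v : {morph mxscale^~ v : a b / a + b}.
Proof. by move=> a b; apply: val_inj; rewrite /= mxactDl. Qed.
HB.instance Definition _ := GRing.Zmodule_isLmodule.Build A mxmod
  mxscaleA mxscale1 mxscaleDr mxscaleDl.

Lemma mxmod_scaleE a (v : mxmod) : mxmod_val (a *: v) = mxact a (mxmod_val v).
Proof. by []. Qed.

Lemma mxmod_val_sum (I : Type) (r : seq I) (P : pred I) (F : I -> mxmod) :
  mxmod_val (\sum_(i <- r | P i) F i) = \sum_(i <- r | P i) mxmod_val (F i).
Proof. exact: (raddf_sum (val : mxmod -> _)). Qed.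

End MxAct.
Arguments mxfix_pred {k A B X} psi N _ : simpl never.

Section MxFunctor.
Variables (k : fieldType) (A B : kalg k) (X : finType) (psi : mxhom A B X).

Section Map.
Variables (M N : lmodType B) (f : {linear M -> N}).

Definition ffmap (v : {ffun X -> M}) : {ffun X -> N} := [ffun i => f (v i)].

Lemma mxact_map a v : mxact psi a (ffmap v) = ffmap (mxact psi a v).
Proof.
apply/ffunP => i; rewrite !ffunE linear_sum.
by apply: eq_bigr => j _; rewrite ffunE linearZ.
Qed.

Lemma mxmap_subproof (v : mxmod psi M) : ffmap (mxmod_val v) \in mxfix_pred psi N.
Proof. by apply/eqP; rewrite mxact_map mxmod_fix. Qed.

Definition mxmap (v : mxmod psi M) : mxmod psi N := MxMod (mxmap_subproof v).

Fact mxmap_linear : linear mxmap.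
Proof.
move=> a v w; apply: val_inj; rewrite /= mxact_map.
by apply/ffunP => i; rewrite !ffunE linearD.
Qed.
HB.instance Definition _ :=
  GRing.isLinear.Build A (mxmod psi M) (mxmod psi N) _ mxmap mxmap_linear.

End Map.

Lemma mxmod_kscal (M : lmodType B) c (v : mxmod psi M) i :
  mxmod_val (kscal A c *: v) i = kscal B c *: mxmod_val v i.
Proof.
rewrite mxmod_scaleE -[in RHS](mxmod_fix v) !ffunE scaler_sumr.
by apply: eq_bigr => j _; rewrite scalerA -mxhomZ mulr1.
Qed.

Fact mxmap_id (M : lmodType B) (v : mxmod psi M) :
  mxmap (idfun : {linear M -> M}) v = v.
Proof. by apply: val_inj; apply/ffunP => i; rewrite ffunE. Qed.

Fact mxmap_comp (M N P : lmodType B) (g : {linear N -> P}) (f : {linear M -> N})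
  (v : mxmod psi M) : mxmap (g \o f : {linear M -> P}) v = mxmap g (mxmap f v).
Proof. by apply: val_inj; apply/ffunP => i; rewrite !ffunE. Qed.

Fact mxmap_lin (M N : lmodType B) (c : k) (f g h : {linear M -> N}) :
    (forall v, h v = kscal B c *: f v + g v) ->
  forall v : mxmod psi M, mxmap h v = kscal A c *: mxmap f v + mxmap g v.
Proof.
move=> hE v; apply: val_inj; apply/ffunP => i.
by rewrite ffunE hE [RHS]ffunE mxmod_kscal !ffunE.
Qed.

Definition mx_functor : lin_functor B A :=
  @LinFunctor k B A (fun M => mxmod psi M : lmodType A)
    (fun M N f => mxmap f : {linear mxmod psi M -> mxmod psi N})
    mxmap_id mxmap_comp mxmap_lin.

End MxFunctor.

(** One half of a Morita equivalence; the other half is the same statement with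
    the two algebras exchanged.  The families [a] and [b] are dual bases: v |->
    (b x y v) and (v x y) |-> sum of the a x y (v x y) are mutually inverse. *)
Section MoritaHalf.
Variables (k : fieldType) (A B : kalg k) (X Y : finType).
Variables (psi : mxhom A B X) (chi : mxhom B A Y).
Variables (a b : X -> Y -> A).
Hypothesis ab1 : \sum_x \sum_y a x y * b x y = 1.
Hypothesis bca : forall x x' y y' c, b x y * c * a x' y' = chi y y' (psi x x' c).
Hypothesis chi1b : forall x y, \sum_y' chi y y' 1 * b x y' = b x y.

Let chi_psi_b x y c : \sum_x' \sum_y' chi y y' (psi x x' c) * b x' y' = b x y * c.
Proof.
rewrite -[RHS]mulr1 -ab1 mulr_sumr; apply: eq_bigr => x' _.
by rewrite mulr_sumr; apply: eq_bigr => y' _; rewrite mulrA bca.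
Qed.

Section Unit.
Variable M : lmodType A.

Lemma eta_inner (v : M) x : [ffun y => b x y *: v] \in mxfix_pred chi M.
Proof.
apply/eqP/ffunP => y; rewrite !ffunE -[in RHS]chi1b scaler_suml.
by apply: eq_bigr => y' _; rewrite ffunE scalerA.
Qed.

Definition eta0 (v : M) : {ffun X -> mxmod chi M} :=
  [ffun x => MxMod (eta_inner v x)].

Lemma mxact_eta c v : mxact psi c (eta0 v) = eta0 (c *: v).
Proof.
apply/ffunP => x; apply: val_inj; apply/ffunP => y; rewrite !ffunE /=.
rewrite scalerA -chi_psi_b scaler_suml mxmod_val_sum sum_ffunE.
apply: eq_bigr => x' _; rewrite mxmod_scaleE !ffunE scaler_suml.
by apply: eq_bigr => y' _; rewrite !ffunE scalerA.
Qed.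

Lemma eta_outer (v : M) : eta0 v \in mxfix_pred psi (mxmod chi M).
Proof. by apply/eqP; rewrite mxact_eta scale1r. Qed.

Definition eta (v : M) : mxmod psi (mxmod chi M) := MxMod (eta_outer v).

Fact eta_linear : linear eta.
Proof.
move=> c v w; apply: val_inj; rewrite /= mxact_eta.
apply/ffunP => x; apply: val_inj; apply/ffunP => y.
by rewrite !ffunE /= ?ffunE scalerDr.
Qed.
HB.instance Definition _ :=
  GRing.isLinear.Build A M (mxmod psi (mxmod chi M)) _ eta eta_linear.

Definition eta_inv (v : mxmod psi (mxmod chi M)) : M :=
  \sum_x \sum_y a x y *: mxmod_val (mxmod_val v x) y.

Lemma eta_bij : bijective eta.
Proof.
exists eta_inv => v.
  rewrite /eta_inv -[RHS]scale1r -ab1 scaler_suml; apply: eq_bigr => x _.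
  by rewrite scaler_suml; apply: eq_bigr => y _; rewrite /= !ffunE /= ?ffunE scalerA.
apply: val_inj; apply: etrans (mxmod_fix v).
apply/ffunP => x; apply: val_inj; apply/ffunP => y.
rewrite !ffunE /= ?ffunE mxmod_val_sum sum_ffunE scaler_sumr.
apply: eq_bigr => x' _; rewrite mxmod_scaleE !ffunE scaler_sumr.
by apply: eq_bigr => y' _; rewrite scalerA -bca mulr1.
Qed.

End Unit.

Lemma morita_half : id_iso_comp (mx_functor chi) (mx_functor psi).
Proof.
exists (fun M : lmodType A => @eta M : {linear M -> mxmod psi (mxmod chi M)}); split=> [M|M N f v].
  exact: eta_bij.
apply: val_inj; apply/ffunP => x; apply: val_inj; apply/ffunP => y.
by rewrite /= !ffunE /= linearZ.
Qed.

End MoritaHalf.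

(** [phi] identifies T with the corner e W e, e = [phi 1], and [theta] is its
    inverse composed with w |-> e w e.  The corner is full because the a_x b_x,
    which lie in W e W, add up to 1.  Hence W acts on N^X through the matrices
    theta (b_x w a_y), and M |-> e M has an inverse. *)
Section Corner.
Variables (k : fieldType) (W T : kalg k) (X : finType).
Variables (phi : T -> W) (theta : W -> T) (a b : X -> W).
Hypothesis phiD : forall t t', phi (t + t') = phi t + phi t'.
Hypothesis phiM : forall t t', phi (t * t') = phi t * phi t'.
Hypothesis phiZ : forall c t, phi (kscal T c * t) = kscal W c * phi t.
Hypothesis thetaD : forall w w', theta (w + w') = theta w + theta w'.
Hypothesis phiK : cancel phi theta.
Hypothesis thetaK : forall w, phi (theta w) = phi 1 * w * phi 1.
Hypothesis ae : forall x, a x * phi 1 = a x.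
Hypothesis eb : forall x, phi 1 * b x = b x.
Hypothesis ab1 : \sum_x a x * b x = 1.

Let e := phi 1.
Let phi_inj : injective phi := can_inj phiK.
Let phi_sum (F : X -> T) : phi (\sum_x F x) = \sum_x phi (F x).
Proof.
apply: (big_morph phi phiD).
by apply: (addrI (phi 0)); rewrite -phiD !addr0.
Qed.
Let phie t : phi t * e = phi t.
Proof. by rewrite -phiM mulr1. Qed.
Let ephi t : e * phi t = phi t.
Proof. by rewrite -phiM mul1r. Qed.
Let ee : e * e = e.
Proof. exact: ephi. Qed.

Let psi0 x y w := theta (b x * w * a y).

Let phi_psi0 x y w : phi (psi0 x y w) = b x * w * a y.
Proof. by rewrite /psi0 thetaK -!mulrA ae !mulrA eb. Qed.

Let psi0D x y w w' : psi0 x y (w + w') = psi0 x y w + psi0 x y w'.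
Proof. by rewrite /psi0 mulrDr mulrDl thetaD. Qed.

Let psi0M x y w w' : psi0 x y (w * w') = \sum_z psi0 x z w * psi0 z y w'.
Proof.
apply: phi_inj; rewrite phi_sum phi_psi0.
under eq_bigr do rewrite phiM !phi_psi0.
under eq_bigr do rewrite -[_ * w' * _]mulrA mulrA -[_ * a _ * _]mulrA.
by rewrite -mulr_suml -mulr_sumr ab1 mulr1 !mulrA.
Qed.

Let psi0Z x y c w : psi0 x y (kscal W c * w) = kscal T c * psi0 x y w.
Proof.
by apply: phi_inj; rewrite phiZ !phi_psi0 !mulrA kscalC.
Qed.

Let psi : mxhom W T X := MxHom psi0D psi0M psi0Z.

Let chi0 (_ _ : unit) := phi.
Let chi0M i j t t' : chi0 i j (t * t') = \sum_l chi0 i l t * chi0 l j t'.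
Proof. by rewrite (big_pred1 tt) ?phiM // => -[]. Qed.
Let chi : mxhom T W unit := MxHom (fun _ _ => phiD) chi0M (fun _ _ => phiZ).

Lemma morita_corner : morita_equivalent W T.
Proof.
exists (mx_functor chi), (mx_functor psi); split.
  apply: (@morita_half _ _ _ _ _ psi chi (fun x _ => a x) (fun x _ => b x)).
  - by rewrite -ab1; apply: eq_bigr => x _; rewrite (big_pred1 tt) // => -[].
  - by move=> x x' y y' c; rewrite /= /chi0 phi_psi0.
  - by move=> x y; rewrite (big_pred1 tt) /= ?eb // => -[].
have phi_a x : phi (theta (a x)) = e * a x by rewrite thetaK -mulrA ae.
have phi_b x : phi (theta (b x)) = b x * e by rewrite thetaK eb.
apply: (@morita_half _ _ _ _ _ chi psi (fun _ x => theta (a x)) (fun _ x => theta (b x))).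
- rewrite (big_pred1 tt); last by case.
  apply: phi_inj; rewrite phi_sum.
  under eq_bigr do rewrite phiM phi_a phi_b mulrA -(mulrA e).
  by rewrite -mulr_suml -mulr_sumr ab1 mulr1 ee.
- move=> u u1 x y t; apply: phi_inj.
  by rewrite /= phi_psi0 !phiM phi_a phi_b -(mulrA (b x)) ephi mulrA -(mulrA (b x)) phie.
- move=> u x; apply: phi_inj; rewrite phi_sum phi_b.
  under eq_bigr do rewrite phiM phi_psi0 phi_b mulr1 mulrA -(mulrA (b x)).
  by rewrite -mulr_suml -mulr_sumr ab1 mulr1.
Qed.

End Corner.

(** * Presented algebras, corners and matrix algebras *)

Record khom (k : fieldType) (A B : kalg k) := KHom {
  khom_fun :> {rmorphism A -> B};
  khomK : forall c, khom_fun (kscal A c) = kscal B c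
}.

(** Generation as an algebra, in the form of an induction on words read from the
    left. *)
Definition generates (k : fieldType) (A : kalg k) (I : Type) (g : I -> A) : Prop :=
  forall P : A -> Prop,
    P 1 -> (forall c a, P a -> P (kscal A c * a)) ->
    (forall a b, P a -> P b -> P (a + b)) ->
    (forall i a, P a -> P (g i * a)) -> forall a, P a.

Section LinearExtension.
Variables (k : fieldType) (K : choiceType) (S : kalg k) (h : K -> S).

Definition lext (g : {malg k[K]}) : S := \sum_(x <- msupp g) kscal S g@_x * h x.

Lemma lextEw (d : {fset K}) g :
  (msupp g `<=` d)%fset -> lext g = \sum_(x <- d) kscal S g@_x * h x.
Proof.
move=> le; rewrite /lext (big_fset_incl _ le) //= => x _ /mcoeff_outdom ->.
by rewrite rmorph0 mul0r.
Qed.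

Lemma lextD f g : lext (f + g) = lext f + lext g.
Proof.
rewrite (lextEw (msuppD_le f g)) (lextEw (fsubsetUl (msupp f) (msupp g))).
rewrite (lextEw (fsubsetUr (msupp f) (msupp g))) -big_split /=.
by apply: eq_bigr => x _; rewrite mcoeffD rmorphD mulrDl.
Qed.

Lemma lextU c x : lext << c *g x >> = kscal S c * h x.
Proof. by rewrite (lextEw (@msuppU_le _ _ x c)) big_seq_fset1 mcoeffUU. Qed.

Lemma lextB f g : lext (f - g) = lext f - lext g.
Proof. by apply: (addIr (lext g)); rewrite -lextD !subrK. Qed.

End LinearExtension.

Lemma malg_ind (k : fieldType) (K : choiceType) (P : {malg k[K]} -> Prop) :
  (forall c x, P << c *g x >>) -> P 0 -> (forall f g, P f -> P g -> P (f + g)) ->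
  forall f, P f.
Proof. by move=> PU P0 PD f; rewrite (monalgE f); apply: (big_ind P). Qed.

Section AdditiveMul.
Variables (A S : pzRingType) (f : A -> S).
Hypothesis fD : forall a b, f (a + b) = f a + f b.

Lemma additive_mulDr a b b' :
  f (a * b) = f a * f b -> f (a * b') = f a * f b' ->
  f (a * (b + b')) = f a * f (b + b').
Proof. by move=> fab fab'; rewrite mulrDr !fD fab fab' mulrDr. Qed.

Lemma additive_mulDl a a' b :
  f (a * b) = f a * f b -> f (a' * b) = f a' * f b ->
  f ((a + a') * b) = f (a + a') * f b.
Proof. by move=> fab fab'; rewrite mulrDl !fD fab fab' mulrDl. Qed.

End AdditiveMul.

Section FreeLift.
Variables (k : fieldType) (G : choiceType).
Local Notation F := (free_kalg k G).

Lemma free_ind (P : F -> Prop) :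
  (forall c m, P (<< c *g m >> : {malg k[{fmonom G}]})) -> P 0 ->
  (forall a b, P a -> P b -> P (a + b)) -> forall a, P a.
Proof. exact: malg_ind. Qed.

Lemma free_kscalU c (m : {fmonom G}) :
  kscal F c * (<< m >> : {malg k[{fmonom G}]})
  = (<< c *g m >> : {malg k[{fmonom G}]}) :> F.
Proof. by rewrite [LHS]malgM_def fgmulUU mulr1 mul1m. Qed.

Lemma free_genM (g : G) (s : seq G) :
  free_gen k g * (<< FMonom s >> : {malg k[{fmonom G}]})
  = (<< FMonom (g :: s) >> : {malg k[{fmonom G}]}) :> F.
Proof.
rewrite /free_gen [LHS]malgM_def fgmulUU mulr1; congr << _ >>.
by apply: val_inj; rewrite /= fmM fmU.
Qed.

Lemma free_generates : generates (@free_gen k G).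
Proof.
move=> P P1 PZ PD PM; apply: free_ind => [c m||]; last exact: PD.
  rewrite -free_kscalU; apply: PZ.
  rewrite -[m]fmK; elim: (fmonom_val m) => [|g s IHs].
    by rewrite -fmoneE.
  by rewrite -free_genM; apply: PM.
by have := @PZ 0 1 P1; rewrite rmorph0 mul0r.
Qed.

Variables (S : kalg k) (f : G -> S).

Definition free_eval (m : {fmonom G}) : S := \prod_(g <- (m : seq G)) f g.
Definition free_lift_fun (a : F) : S := lext free_eval a.

Fact free_lift_zmod : zmod_morphism free_lift_fun.
Proof. by move=> a b; apply: lextB. Qed.
HB.instance Definition _ :=
  GRing.isZmodMorphism.Build F S free_lift_fun free_lift_zmod.

Lemma free_liftK c : free_lift_fun (kscal F c) = kscal S c.
Proof.
rewrite /free_lift_fun lextU /free_eval fm1 big_nil mulr1; by [].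
Qed.

Let free_liftD (a b : F) : free_lift_fun (a + b) = free_lift_fun a + free_lift_fun b.
Proof. exact: lextD. Qed.

Fact free_lift_monoid : monoid_morphism free_lift_fun.
Proof.
split=> [|a b]; first by have := free_liftK 1; rewrite !rmorph1.
move: a; apply: free_ind => [c m||a a' IH IH'].
- move: b; apply: free_ind => [d n||b b' IH IH'].
  + rewrite /free_lift_fun [X in lext _ X]malgM_def fgmulUU !lextU rmorphM /free_eval fmM.
    by rewrite big_cat /= -!mulrA; congr (_ * _); rewrite !mulrA kscalC.
  + by rewrite mulr0 raddf0 /= mulr0.
  + exact: (additive_mulDr free_liftD IH IH').
- by rewrite mul0r raddf0 /= mul0r.
- exact: (additive_mulDl free_liftD IH IH').
Qed.
HB.instance Definition _ :=
  GRing.isMonoidMorphism.Build F S free_lift_fun free_lift_monoid.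

Definition free_lift : khom F S :=
  @KHom k F S (free_lift_fun : {rmorphism F -> S}) free_liftK.

Lemma free_liftE g : free_lift (free_gen k g) = f g.
Proof.
by rewrite /= /free_lift_fun /free_gen lextU rmorph1 mul1r /free_eval fmU big_seq1.
Qed.

End FreeLift.

Section QuoLift.
Variables (k : fieldType) (F : kalg k) (rel : F -> F -> Prop) (S : kalg k).
Variable f : khom F S.
Hypothesis f_rel : forall x y, rel x y -> f x = f y.
Local Notation Q := (quo_kalg rel).

Let f_ideal u : gen_ideal rel u -> f u = 0.
Proof.
elim=> [a x y b rxy||v w _ fv _ fw]; last by rewrite rmorphD fv fw addr0.
- by rewrite !rmorphM rmorphB (f_rel rxy) subrr mulr0 mul0r.
- by rewrite rmorph0.
Qed.

Definition quo_lift_fun (a : Q) : S := f (repr (a : quo rel)).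

Let quo_lift_pi u : quo_lift_fun (quo_pi rel u) = f u.
Proof.
apply/eqP; rewrite -subr_eq0 -rmorphB; apply/eqP/f_ideal.
by apply/quo_pi_eqP; rewrite quo_pi_repr.
Qed.

Fact quo_lift_zmod : zmod_morphism quo_lift_fun.
Proof.
move=> a b; rewrite -[a](quo_pi_repr (a : quo rel)) -[b](quo_pi_repr (b : quo rel)).
by rewrite -[_ - _](rmorphB (quo_pi rel)) !quo_lift_pi rmorphB.
Qed.
HB.instance Definition _ :=
  GRing.isZmodMorphism.Build Q S quo_lift_fun quo_lift_zmod.

Fact quo_lift_monoid : monoid_morphism quo_lift_fun.
Proof.
split=> [|a b].
  by rewrite -[1 in LHS](rmorph1 (quo_pi rel)) quo_lift_pi rmorph1.
rewrite -[a](quo_pi_repr (a : quo rel)) -[b](quo_pi_repr (b : quo rel)).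
by rewrite -[_ * _](rmorphM (quo_pi rel)) !quo_lift_pi rmorphM.
Qed.
HB.instance Definition _ :=
  GRing.isMonoidMorphism.Build Q S quo_lift_fun quo_lift_monoid.

Lemma quo_liftK c : quo_lift_fun (kscal Q c) = kscal S c.
Proof. by rewrite quo_lift_pi khomK. Qed.

Definition quo_lift : khom Q S :=
  @KHom k Q S (quo_lift_fun : {rmorphism Q -> S}) quo_liftK.

Lemma quo_liftE u : quo_lift (quo_pi rel u) = f u.
Proof. exact: quo_lift_pi. Qed.

End QuoLift.

Lemma quo_generates (k : fieldType) (G : choiceType)
    (rel : free_kalg k G -> free_kalg k G -> Prop) :
  @generates k (quo_kalg rel) G (fun g => quo_pi rel (free_gen k g)).
Proof.
move=> P P1 PZ PD PM a; rewrite -[a](quo_pi_repr (a : quo rel)).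
move: (repr _); apply: (@free_generates k G (fun u => P (quo_pi rel u))).
- by rewrite rmorph1.
- by move=> c u Pu; rewrite rmorphM; apply: PZ.
- by move=> u v Pu Pv; rewrite rmorphD; apply: PD.
- by move=> g u Pu; rewrite rmorphM; apply: PM.
Qed.

Section CornerAlgebra.
Variables (k : fieldType) (S : kalg k) (e : S).
Hypothesis ee : e * e = e.

Definition corner_pred : {pred S} := fun a => e * a * e == a.

Fact corner_zmod : zmod_closed corner_pred.
Proof.
split=> [|a b /eqP ea /eqP eb]; apply/eqP; first by rewrite mulr0 mul0r.
by rewrite mulrBr mulrBl ea eb.
Qed.
HB.instance Definition _ := GRing.isZmodClosed.Build S corner_pred corner_zmod.

(** The idempotent is the unit of the corner, so the type that carries the ring
    structure has the proof of idempotence as a parameter. *)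
Record corner (ide : e * e = e) :=
  Corner { corner_val : S; _ : corner_val \in corner_pred }.
HB.instance Definition _ := [isSub for @corner_val ee].
HB.instance Definition _ := [Choice of corner ee by <:].
HB.instance Definition _ := [SubChoice_isSubZmodule of corner ee by <:].

Local Notation C := (corner ee).

Lemma corner_l (a : C) : e * corner_val a = corner_val a.
Proof. by case: a => a /= /eqP <-; rewrite !mulrA ee. Qed.
Lemma corner_r (a : C) : corner_val a * e = corner_val a.
Proof. by case: a => a /= /eqP <-; rewrite -!mulrA ee. Qed.

Fact corner_mul_subproof (a b : C) : corner_val a * corner_val b \in corner_pred.
Proof. by apply/eqP; rewrite mulrA corner_l -mulrA corner_r. Qed.
Fact corner_one_subproof : e \in corner_pred.
Proof. by apply/eqP; rewrite !ee. Qed.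

Definition corner_mul (a b : C) : C := Corner ee (corner_mul_subproof a b).
Definition corner_one : C := Corner ee corner_one_subproof.

Fact corner_mulA : associative corner_mul.
Proof. by move=> a b c; apply: val_inj; rewrite /= mulrA. Qed.
Fact corner_mul1r : left_id corner_one corner_mul.
Proof. by move=> a; apply: val_inj; rewrite /= corner_l. Qed.
Fact corner_mulr1 : right_id corner_one corner_mul.
Proof. by move=> a; apply: val_inj; rewrite /= corner_r. Qed.
Fact corner_mulDl : left_distributive corner_mul +%R.
Proof. by move=> a b c; apply: val_inj; rewrite /= mulrDl. Qed.
Fact corner_mulDr : right_distributive corner_mul +%R.
Proof. by move=> a b c; apply: val_inj; rewrite /= mulrDr. Qed.
HB.instance Definition _ := GRing.Zmodule_isPzRing.Build C
  corner_mulA corner_mul1r corner_mulr1 corner_mulDl corner_mulDr.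

Fact corner_scal_subproof c : kscal S c * e \in corner_pred.
Proof. by apply/eqP; rewrite mulrA -kscalC -!mulrA !ee. Qed.
Definition corner_scal c : C := Corner ee (corner_scal_subproof c).

Fact corner_scal_zmod : zmod_morphism corner_scal.
Proof. by move=> c d; apply: val_inj; rewrite /= rmorphB mulrBl. Qed.
HB.instance Definition _ :=
  GRing.isZmodMorphism.Build k C corner_scal corner_scal_zmod.
Fact corner_scal_monoid : monoid_morphism corner_scal.
Proof.
split=> [|c d]; apply: val_inj; rewrite /= ?rmorph1 ?mul1r //.
rewrite rmorphM -!mulrA; congr (_ * _).
by rewrite mulrA -kscalC -mulrA ee.
Qed.
HB.instance Definition _ :=
  GRing.isMonoidMorphism.Build k C corner_scal corner_scal_monoid.

Fact corner_scalC c (a : C) : corner_scal c * a = a * corner_scal c.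
Proof.
by apply: val_inj; rewrite /= -mulrA corner_l mulrA -kscalC -mulrA corner_r.
Qed.

Definition corner_kalg : kalg k :=
  @KAlg k C (corner_scal : {rmorphism k -> C}) corner_scalC.

End CornerAlgebra.

Section MatrixAlgebra.
Variables (k : fieldType) (T : kalg k) (n : nat).

Definition mx_scal (c : k) : 'M[T]_n := (kscal T c)%:M.

Fact mx_scal_zmod : zmod_morphism mx_scal.
Proof. by move=> c d; rewrite /mx_scal rmorphB raddfB. Qed.
HB.instance Definition _ :=
  GRing.isZmodMorphism.Build k 'M[T]_n mx_scal mx_scal_zmod.
Fact mx_scal_monoid : monoid_morphism mx_scal.
Proof. by split=> [|c d]; rewrite /mx_scal ?rmorph1 // rmorphM scalar_mxM. Qed.
HB.instance Definition _ :=
  GRing.isMonoidMorphism.Build k 'M[T]_n mx_scal mx_scal_monoid.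

Fact mx_scalC c (a : 'M[T]_n) : mx_scal c * a = a * mx_scal c.
Proof.
apply/matrixP => i j; rewrite !mxE (bigD1 i) //= [RHS](bigD1 j) //= !mxE !eqxx.
rewrite !mulr1n kscalC !big1 // => l /negPf nl; rewrite !mxE ?nl ?mulr0 //.
by rewrite eq_sym nl mul0r.
Qed.

Definition mx_kalg : kalg k :=
  @KAlg k 'M[T]_n (mx_scal : {rmorphism k -> 'M[T]_n}) mx_scalC.

End MatrixAlgebra.

(** * Cube algebras *)

Lemma kscal_mul (k : fieldType) (S : kalg k) c d (a b : S) :
  kscal S c * a * (kscal S d * b) = kscal S (c * d) * (a * b).
Proof. by rewrite rmorphM -!mulrA (mulrA a) -kscalC -!mulrA. Qed.

(** The functions on the vertices of the n-cube, with [f i] the indicator of a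
    face, extended by commuting elements [U i] that exchange this face with the
    opposite one.  Both the tensor power of the path algebra and the corner of the
    VV algebra are of this kind.  Indices are natural numbers below n, so that no
    cast is needed to add dimensions. *)
Record cube_rel (S : pzRingType) (n : nat) (U f : nat -> S) : Prop := CubeRel {
  cubeUU : forall i j, (i < n)%N -> (j < n)%N -> U i * U j = U j * U i;
  cubeff : forall i j, (i < n)%N -> (j < n)%N -> f i * f j = f j * f i;
  cubef : forall i, (i < n)%N -> f i * f i = f i;
  cubeUf : forall i j, (i < n)%N -> (j < n)%N ->
    U i * f j = (if i == j then 1 - f j else f j) * U i
}.

(** The algebra presented by these relations, described by its universal property
    together with generation: tensor products are then computed without bases. *)
Record is_cube (k : fieldType) (T : kalg k) (n : nat) (U f : nat -> T) : Prop := IsCube {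
  cube_relP : cube_rel n U f;
  cube_gen : generates (fun g : bool * 'I_n => if g.1 then U g.2 else f g.2);
  cube_univ : forall (S : kalg k) (U' f' : nat -> S), cube_rel n U' f' ->
    exists phi : khom T S,
      forall i, (i < n)%N -> phi (U i) = U' i /\ phi (f i) = f' i
}.

Section BaseCube.
Variable k : fieldType.

Lemma base_cube : is_cube (T := base_kalg k) 0 (fun=> 0) (fun=> 0).
Proof.
split=> // [P P1 PZ PD _ a|S U' f' _].
  by rewrite -[a]mulr1; apply: (PZ a).
by exists (@KHom k (base_kalg k) S (kscal S) (fun=> erefl)).
Qed.

End BaseCube.

(** The path algebra of the two-cycle, given by the path [pb v n] of length n from
    v: there is exactly one for each v and n.  With U the sum of the two arrows and
    f the idempotent of a vertex, this path is U^n f or U^n (1 - f), which is why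
    the path algebra is the cube algebra in dimension one. *)
Section TwoCycleBasis.
Variables (k : fieldType) (A : kalg k) (pb : bool -> nat -> A).
Hypothesis pbM : forall v n w l,
  pb v n * pb w l = if w (+) odd l == v then pb w (n + l) else 0.
Hypothesis pb1 : 1 = pb true 0 + pb false 0.
Hypothesis pb_ind : forall P : A -> Prop,
  (forall c v n, P (kscal A c * pb v n)) -> P 0 ->
  (forall a b, P a -> P b -> P (a + b)) -> forall a, P a.
Hypothesis pb_ext : forall (S : kalg k) (h : bool -> nat -> S), exists l : A -> S,
  (forall a b, l (a + b) = l a + l b) /\
  (forall c v n, l (kscal A c * pb v n) = kscal S c * h v n).

Definition twoU : A := pb true 1 + pb false 1.
Definition twof : A := pb true 0.

Lemma twoU_pb v n : twoU * pb v n = pb v n.+1.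
Proof. by rewrite mulrDl !pbM; case: (v (+) odd n); rewrite ?addr0 ?add0r. Qed.

Lemma pb_false : pb false 0 = 1 - twof.
Proof. by rewrite pb1 addrC addKr. Qed.

Lemma two_cube_rel : cube_rel 1 (fun=> twoU) (fun=> twof).
Proof.
split=> // [i _|i j]; first by rewrite /twof pbM.
case: i => [|i] // _; case: j => [|j] // _.
by rewrite eqxx -pb_false twoU_pb mulrDr !pbM /= addr0.
Qed.

Lemma two_generates : generates (fun g : bool * 'I_1 => if g.1 then twoU else twof).
Proof.
move=> P P1 PZ PD PM.
have Pf : P twof by have := PM (false, ord0) 1 P1; rewrite mulr1.
have Pb v n : P (pb v n).
  elim: n => [|n IHn]; last by rewrite -twoU_pb; apply: (PM (true, ord0)).
  case: v => //; rewrite pb_false; apply: PD => //.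
  by have := PZ (-1) _ Pf; rewrite rmorphN rmorph1 mulN1r.
apply: pb_ind => // [c v n|]; first exact: PZ.
by have := PZ 0 _ P1; rewrite rmorph0 mul0r.
Qed.

Section Lift.
Variables (S : kalg k) (U f : nat -> S).
Hypothesis Uf : cube_rel 1 U f.

Let u := U 0.
Let vert v := if v then f 0 else 1 - f 0.

Let vert_mul v w : vert v * vert w = if v == w then vert v else 0.
Proof.
have ff := cubef Uf (ltn0Sn 0).
by case: v w => [] []; rewrite /vert /= ?mulrBr ?mulrBl ?mul1r ?mulr1 ?ff ?subrr ?subr0.
Qed.

Let vertU v n : vert v * u ^+ n = u ^+ n * vert (v (+) odd n).
Proof.
have uf : u * vert true = vert false * u by have := cubeUf Uf (ltn0Sn 0) (ltn0Sn 0).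
have vu w : vert w * u = u * vert (~~ w).
  case: w; rewrite ?uf //= /vert mulrBr mulr1 -/(vert true) uf /vert.
  by rewrite mulrBl mul1r subKr.
elim: n => [|n IHn]; first by rewrite expr0 mulr1 mul1r addbF.
by rewrite exprSr mulrA IHn -mulrA vu mulrA -addbN.
Qed.

Lemma two_lift : exists phi : khom A S, phi twoU = U 0 /\ phi twof = f 0.
Proof.
pose h v n := u ^+ n * vert v.
have [l [lD lZ]] := pb_ext h.
have lU v n : l (pb v n) = h v n by have := lZ 1 v n; rewrite !rmorph1 !mul1r.
have l0 : l 0 = 0 by apply: (addrI (l 0)); rewrite -lD !addr0.
have hM v n w j : l (pb v n * pb w j) = h v n * h w j.
  rewrite pbM /h -mulrA (mulrA (vert v)) vertU -(mulrA (u ^+ j)) vert_mul mulrA -exprD.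
  have -> : (v (+) odd j == w) = (w (+) odd j == v) by case: v w (odd j) => [] [] [].
  by case: eqP => [<-|_]; rewrite ?lU ?l0 ?mulr0 // -addbA addbb addbF.
have lM a b : l (a * b) = l a * l b.
  move: a; apply: pb_ind => [c v n||a a' IHa IHa'].
  - move: b; apply: pb_ind => [d w j||b b' IHb IHb'].
    + rewrite kscal_mul pbM !lZ kscal_mul.
      rewrite -hM pbM; case: ifP => _; first by rewrite lZ lU.
      by rewrite mulr0 l0 mulr0.
    + by rewrite mulr0 l0 mulr0.
    + exact: additive_mulDr.
  - by rewrite mul0r l0 mul0r.
  - exact: additive_mulDl.
have l1 : l 1 = 1 by rewrite pb1 lD !lU /h expr0 !mul1r /vert addrC subrK.
have lB : zmod_morphism l.
  by move=> a b; apply: (addIr (l b)); rewrite -lD !subrK.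
pose lB' := GRing.isZmodMorphism.Build A S l lB.
pose lM' := GRing.isMonoidMorphism.Build A S l (l1, lM).
pose phi : {rmorphism A -> S} := HB.pack l lB' lM'.
have lK c : phi (kscal A c) = kscal S c.
  rewrite -[kscal A c]mulr1 pb1 mulrDr /= lD !lZ -mulrDr /h expr0 !mul1r /vert.
  by rewrite addrC subrK mulr1.
exists (KHom lK); split; rewrite /= ?lD !lU /h ?expr0 ?mul1r //.
by rewrite expr1 -mulrDr /vert addrC subrK mulr1.
Qed.

End Lift.

Lemma two_cycle_cube : is_cube 1 (fun=> twoU) (fun=> twof).
Proof.
split=> [||S U f Uf]; [exact: two_cube_rel | exact: two_generates |].
by have [phi phiE] := two_lift Uf; exists phi => -[].
Qed.

End TwoCycleBasis.

Section PathCube.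
Variable k : fieldType.
Local Notation A := (path_kalg k two_cycle).

Lemma two_walk_subproof (v : bool) n : @is_walk two_cycle v (traject negb v n).
Proof. by elim: n v => //= n IHn v; rewrite eqxx IHn. Qed.

Definition two_path (v : bool) n : qpath two_cycle :=
  @QPath two_cycle (v, traject negb v n) (two_walk_subproof v n).

Lemma two_path_end (v : bool) n : ptgt (two_path v n) = v (+) odd n.
Proof.
rewrite /ptgt /walk_end /=; elim: n v => [|n IHn] v; first by rewrite addbF.
by rewrite /= IHn addNb addbN.
Qed.

Lemma two_pathP (x : qpath two_cycle) : x = two_path (psrc x) (size (val x).2).
Proof.
apply: val_inj; case: x => -[v w] /= wP; rewrite /psrc /=; congr (_, _).
by elim: w v wP => //= a w IHw v /andP[/eqP-> /IHw {1}->].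
Qed.

Lemma two_pathM v n w l :
  (pbasis k (two_path v n) : A) * pbasis k (two_path w l)
  = if w (+) odd l == v then pbasis k (two_path w (n + l)) : A else 0.
Proof.
rewrite [LHS]path_mulU /pmul.
have [e|ne] := eqVneq (ptgt (two_path w l)) (psrc (two_path v n)).
  have [z -> ez] := pcompP e; rewrite -two_path_end e eqxx.
  congr pbasis; rewrite (two_pathP z) /psrc ez /= size_cat !size_traject.
  by rewrite addnC.
by rewrite /Defs.pcomp (negPf ne) -two_path_end; case: eqP ne => // -> /eqP.
Qed.

Lemma two_path_one :
  path_one k two_cycle = pbasis k (two_path true 0) + pbasis k (two_path false 0).
Proof.
have trivE v : ptriv (v : vertex two_cycle) = two_path v 0 by apply: val_inj.
by rewrite -!trivE /path_one big_bool.
Qed.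

Lemma path_kscalE c (a : A) : kscal A c * a = (c *: (a : pathalg k two_cycle) : A).
Proof. by rewrite [LHS]path_mulZl; congr (_ *: _); apply: path_mul1r. Qed.

Lemma path_cube : exists U f, is_cube (T := A) 1 U f.
Proof.
pose pb v n : A := pbasis k (two_path v n).
exists (fun=> twoU pb), (fun=> twof pb); apply: two_cycle_cube.
- exact: two_pathM.
- exact: two_path_one.
- move=> P PZ P0 PD; apply: path_malg_ind => // c x.
  by have := PZ c (psrc x) (size (val x).2); rewrite path_kscalE /pb -two_pathP.
- move=> S h; exists (lext (fun x : qpath two_cycle => h (psrc x) (size (val x).2))); split.
    exact: lextD.
  by move=> c v n; rewrite path_kscalE /pb -malgUZ lextU /= size_traject.
Qed.

End PathCube.

(** The tensor product of an m-cube algebra and an n-cube algebra is an (m + n)-cube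
    algebra: its presentation only adds that the two factors commute. *)
Section TensorCube.
Variables (k : fieldType) (A B : kalg k).
Local Notation T := (tens A B).

Definition pure (a : A) (b : B) : T := quo_pi (@tens_rel k A B) (free_gen k (a, b)).

Lemma pureDl a a' b : pure (a + a') b = pure a b + pure a' b.
Proof. by rewrite /pure (quo_pi_rel (TensDl a a' b)) rmorphD. Qed.
Lemma pureDr a b b' : pure a (b + b') = pure a b + pure a b'.
Proof. by rewrite /pure (quo_pi_rel (TensDr a b b')) rmorphD. Qed.
Lemma pureZl c a b : pure (kscal A c * a) b = kscal T c * pure a b.
Proof. by rewrite /pure (quo_pi_rel (TensZl c a b)) rmorphM. Qed.
Lemma pureZr c a b : pure a (kscal B c * b) = kscal T c * pure a b.
Proof. by rewrite /pure (quo_pi_rel (TensZr c a b)) rmorphM. Qed.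
Lemma pureM a a' b b' : pure a b * pure a' b' = pure (a * a') (b * b').
Proof. by rewrite /pure -(quo_pi_rel (TensM a a' b b')) rmorphM. Qed.
Lemma pure1 : pure 1 1 = 1.
Proof. by rewrite /pure (quo_pi_rel (Tens1 A B)) rmorph1. Qed.
Lemma pureBl a a' b : pure (a - a') b = pure a b - pure a' b.
Proof. by apply: (addIr (pure a' b)); rewrite -pureDl !subrK. Qed.
Lemma pureBr a b b' : pure a (b - b') = pure a b - pure a b'.
Proof. by apply: (addIr (pure a b')); rewrite -pureDr !subrK. Qed.

Section Lift.
Variables (S : kalg k) (alpha : khom A S) (beta : khom B S).
Hypothesis ab_comm : forall a b, alpha a * beta b = beta b * alpha a.

Lemma tens_lift : exists phi : khom T S, forall a b, phi (pure a b) = alpha a * beta b.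
Proof.
pose f := free_lift (fun x : A * B => alpha x.1 * beta x.2).
have fE a b : f (free_gen k (a, b)) = alpha a * beta b.
  exact: (free_liftE (fun x : A * B => alpha x.1 * beta x.2)).
have frel x y : tens_rel x y -> f x = f y.
  case=> [a a' b|a b b'|c a b|c a b|a a' b b'|]; rewrite ?rmorphD ?rmorphM !fE.
  - by rewrite rmorphD mulrDl.
  - by rewrite rmorphD mulrDr.
  - by rewrite rmorphM !khomK mulrA.
  - by rewrite rmorphM !khomK !mulrA kscalC.
  - by rewrite !rmorphM -!mulrA (mulrA (beta b)) -ab_comm -!mulrA.
  - by rewrite !rmorph1 mulr1.
by exists (quo_lift frel) => a b; rewrite quo_liftE fE.
Qed.

End Lift.

Section Generation.
Variables (I J : Type) (g : I -> A) (h : J -> B).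
Hypotheses (g_gen : generates g) (h_gen : generates h).

Lemma tens_generates (P : T -> Prop) :
    P 1 -> (forall c a, P a -> P (kscal T c * a)) ->
    (forall a b, P a -> P b -> P (a + b)) ->
    (forall i a, P a -> P (pure (g i) 1 * a)) ->
    (forall j a, P a -> P (pure 1 (h j) * a)) -> forall a, P a.
Proof.
move=> P1 PZ PD Pg Ph.
have PA a : forall t, P t -> P (pure a 1 * t).
  move: a; apply: g_gen => [t|c a Pa t|a a' Pa Pa' t|i a Pa t] Pt.
  - by rewrite pure1 mul1r.
  - by rewrite pureZl -mulrA; apply/PZ/Pa.
  - by rewrite pureDl mulrDl; apply: PD; [apply: Pa | apply: Pa'].
  - by rewrite -[1]mulr1 -pureM -mulrA; apply/Pg/Pa.
have PB b : forall t, P t -> P (pure 1 b * t).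
  move: b; apply: h_gen => [t|c a Pa t|a a' Pa Pa' t|i a Pa t] Pt.
  - by rewrite pure1 mul1r.
  - by rewrite pureZr -mulrA; apply/PZ/Pa.
  - by rewrite pureDr mulrDl; apply: PD; [apply: Pa | apply: Pa'].
  - by rewrite -[X in pure X _]mulr1 -pureM -mulrA; apply/Ph/Pa.
apply: quo_generates => // -[a b] t Pt.
rewrite -[quo_pi _ _]/(pure a b) -[a]mulr1 -[b]mul1r -pureM -mulrA.
exact/PA/PB.
Qed.

End Generation.

Section Cubes.
Variables (m n : nat) (U f : nat -> A) (V h : nat -> B).
Hypotheses (cA : is_cube m U f) (cB : is_cube n V h).

Let Ut i := if (i < m)%N then pure (U i) 1 else pure 1 (V (i - m)).
Let ft i := if (i < m)%N then pure (f i) 1 else pure 1 (h (i - m)).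

Let sub_lt i : (i < m + n)%N -> (m <= i)%N -> (i - m < n)%N.
Proof. by move=> lti lei; rewrite ltn_subLR. Qed.

Let tens_cube_rel : cube_rel (m + n) Ut ft.
Proof.
have [RA RB] := (cube_relP cA, cube_relP cB).
split=> [i j|i j|i|i j] li; rewrite /Ut /ft.
- move=> lj; case: ltnP => [im|/(sub_lt li) im]; case: ltnP => [jm|/(sub_lt lj) jm];
    rewrite !pureM ?mul1r ?mulr1 //.
    by rewrite (cubeUU RA).
  by rewrite (cubeUU RB).
- move=> lj; case: ltnP => [im|/(sub_lt li) im]; case: ltnP => [jm|/(sub_lt lj) jm];
    rewrite !pureM ?mul1r ?mulr1 //.
    by rewrite (cubeff RA).
  by rewrite (cubeff RB).
- case: ltnP => [im|/(sub_lt li) im]; rewrite !pureM ?mul1r ?mulr1.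
    by rewrite (cubef RA).
  by rewrite (cubef RB).
- move=> lj; case: ltnP => [im|mi]; case: ltnP => [jm|mj].
  + rewrite pureM mulr1 (cubeUf RA) //; case: eqP => _; last by rewrite pureM mulr1.
    by rewrite -pure1 -pureBl pureM mulr1.
  + have /negPf-> : i != j by rewrite neq_ltn (leq_trans im mj).
    by rewrite !pureM !mul1r !mulr1.
  + have /negPf-> : i != j by rewrite neq_ltn (leq_trans jm mi) orbT.
    by rewrite !pureM !mul1r !mulr1.
  + rewrite pureM mulr1 (cubeUf RB) ?sub_lt // (_ : (i - m == j - m)%N = (i == j)).
      case: eqP => _; last by rewrite pureM mulr1.
      by rewrite -pure1 -pureBr pureM mulr1.
    by rewrite -(eqn_add2r m) !subnK.
Qed.

Lemma tens_cube : is_cube (T := T) (m + n) Ut ft.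
Proof.
split=> [|P P1 PZ PD PM|S U' f' R]; first exact: tens_cube_rel.
  apply: (tens_generates (cube_gen cA) (cube_gen cB)) => // -[b i] a Pa /=.
    have := PM (b, lshift n i) a Pa; rewrite /Ut /ft /= ltn_ord.
    by case: b.
  have := PM (b, rshift m i) a Pa; rewrite /Ut /ft /= ltnNge leq_addr /= addKn.
  by case: b.
have [UU ff fi Uf] := R.
have lm i : (i < m)%N -> (i < m + n)%N by move/leq_trans; apply; apply: leq_addr.
have ln i : (i < n)%N -> (m + i < m + n)%N by rewrite ltn_add2l.
have R1 : cube_rel m U' f'.
  by split=> [i j /lm li /lm|i j /lm li /lm|i /lm|i j /lm li /lm];
    [apply: UU | apply: ff | apply: fi | apply: Uf].
have R2 : cube_rel n (fun i => U' (m + i)%N) (fun i => f' (m + i)%N).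
  split=> [i j /ln li /ln|i j /ln li /ln|i /ln|i j /ln li /ln lj];
    [exact: UU | exact: ff | exact: fi |].
  by rewrite Uf // eqn_add2l.
have [al alE] := cube_univ cA R1; have [be beE] := cube_univ cB R2.
have comm a b : al a * be b = be b * al a.
  move: a; apply: (cube_gen cA) => [|c a ca|a a' ca ca'|g a ca].
  - by rewrite rmorph1 mul1r mulr1.
  - by rewrite rmorphM khomK -mulrA ca mulrA kscalC -mulrA.
  - by rewrite rmorphD mulrDl mulrDr ca ca'.
  rewrite rmorphM -mulrA ca !mulrA; congr (_ * _) => {ca a}.
  move: b; apply: (cube_gen cB) => [|c a ca|a a' ca ca'|h' a ca].
  - by rewrite rmorph1 mul1r mulr1.
  - by rewrite rmorphM khomK -mulrA -ca !mulrA kscalC.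
  - by rewrite rmorphD mulrDl mulrDr ca ca'.
  rewrite rmorphM -mulrA -ca !mulrA; congr (_ * _) => {ca a}.
  case: g h' => b1 i [b2 j] /=.
  have [li lj] := (lm _ (ltn_ord i), ln _ (ltn_ord j)).
  have ij : (i == m + j :> nat) = false.
    by apply/negbTE; rewrite neq_ltn (leq_trans (ltn_ord i) (leq_addr _ _)).
  have [eU ef] := alE _ (ltn_ord i); have [eV eh] := beE _ (ltn_ord j).
  case: b1; case: b2; rewrite ?eU ?ef ?eV ?eh.
  - exact: UU.
  - by rewrite Uf // ij.
  - by rewrite Uf // eq_sym ij.
  - exact: ff.
have [phi phiE] := tens_lift comm; exists phi => i li.
rewrite /Ut /ft; case: ltnP => [im|mi].
  by have [<- <-] := alE i im; rewrite !phiE !rmorph1 !mulr1.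
have [] := beE _ (sub_lt li mi); rewrite subnKC // => <- <-.
by rewrite !phiE !rmorph1 !mul1r.
Qed.

End Cubes.
End TensorCube.

Lemma tens_pow_cube (k : fieldType) (A : kalg k) U f n :
  is_cube (T := A) 1 U f -> exists U' f', is_cube (T := tens_pow A n) n U' f'.
Proof.
move=> cA; elim: n => [|[|n] [U' [f' cn]]]; first by do 2!eexists; apply: base_cube.
  by exists U, f.
by do 2!eexists; apply: (tens_cube cA cn).
Qed.

Lemma two_cycle_tens_cube (k : fieldType) (m : nat) :
  (0 < m)%N -> exists U f,
  is_cube (T := tens (tens_pow (path_kalg k two_cycle) m.-1) (path_kalg k two_cycle)) m U f.
Proof.
move=> m_gt0; have [U [f cA]] := path_cube k.
have [U' [f' cn]] := tens_pow_cube m.-1 cA.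
have := tens_cube cn cA; rewrite addn1 (prednK m_gt0) => c.
exact: (ex_intro _ _ (ex_intro _ _ c)).
Qed.

(** * Signed orderings

    A sequence of the VV algebra of multiplicity one is a signed ordering of the
    vertices, that is, a chamber of the hyperplane arrangement of type B_m.  The
    coordinate of a vertex is its signed position, counted from 1; pi and the
    sigma_j act on all coordinates at once by the following permutations of the
    integers. *)

Section Sact.
Variable m : nat.
Local Notation gen := (option 'I_m.-1).

Definition sact (s : gen) (t : int) : int :=
  match s with
  | None => if (t == 1) || (t == -1) then - t else t
  | Some j =>
      if t == j%:Z + 1 then j%:Z + 2 else if t == j%:Z + 2 then j%:Z + 1 else
      if t == - (j%:Z + 1) then - (j%:Z + 2) else if t == - (j%:Z + 2) then - (j%:Z + 1)
      else t
  end.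

Lemma sact_none t : let u := sact None t in
  (t = 1 /\ u = -1) \/ (t = -1 /\ u = 1) \/ (t <> 1 /\ t <> -1 /\ u = t).
Proof.
rewrite /=; case: eqP => [->|n1]; first by left.
by case: eqP => [->|n2]; right; [left | right].
Qed.

Lemma sact_some (j : 'I_m.-1) t : let u := sact (Some j) t in
  (t = j%:Z + 1 /\ u = j%:Z + 2) \/ (t = j%:Z + 2 /\ u = j%:Z + 1) \/
  (t = - (j%:Z + 1) /\ u = - (j%:Z + 2)) \/ (t = - (j%:Z + 2) /\ u = - (j%:Z + 1)) \/
  (t <> j%:Z + 1 /\ t <> j%:Z + 2 /\ t <> - (j%:Z + 1) /\ t <> - (j%:Z + 2) /\ u = t).
Proof.
rewrite /=; case: eqP => [->|n1]; first by left.
case: eqP => [->|n2]; first by right; left.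
case: eqP => [->|n3]; first by right; right; left.
by case: eqP => [->|n4]; right; right; right; [left | right].
Qed.

End Sact.

(* Splits on the innermost value of [sact]; the contradictory cases are discarded
   before the next one, which keeps the number of branches linear in the word. *)
Ltac sact_lia :=
  try match goal with
  | |- context [@sact ?m ?s ?t] =>
    lazymatch t with context [@sact _ _ _] => fail | _ => idtac end;
    let u := fresh "u" in let H := fresh "H" in
    lazymatch s with
    | None => pose proof (@sact_none m t) as H
    | Some ?j => pose proof (@sact_some m j t) as H
    end;
    set u := @sact m s t; fold u in H; clearbody u; cbv zeta in H;
    repeat (destruct H as [H|H]; [destruct H as [? ?]; subst; try (exfalso; lia)|]);
    [.. | repeat match type of H with _ /\ _ => destruct H as [? H] end; subst];
    sact_lia
  end; lia.

Section SactTheory.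
Variable m : nat.
Local Notation gen := (option 'I_m.-1).
Implicit Types (s : gen) (t : int).

Lemma sactK s : involutive (sact s).
Proof. by case: s => [j|] t; sact_lia. Qed.

Lemma sactN s t : sact s (- t) = - sact s t.
Proof. by case: s => [j|]; sact_lia. Qed.

Lemma sact_far (j j' : 'I_m.-1) t : (j.+1 < j')%N ->
  sact (Some j) (sact (Some j') t) = sact (Some j') (sact (Some j) t).
Proof. by move=> lt; sact_lia. Qed.

Lemma sact_pi_far (j : 'I_m.-1) t : (0 < j)%N ->
  sact (None : gen) (sact (Some j) t) = sact (Some j) (sact (None : gen) t).
Proof. by move=> lt; sact_lia. Qed.

Lemma sact_braid (j j' : 'I_m.-1) t : j' = j.+1 :> nat ->
  sact (Some j) (sact (Some j') (sact (Some j) t))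
  = sact (Some j') (sact (Some j) (sact (Some j') t)).
Proof. by move=> e; sact_lia. Qed.

Lemma sact_pi_braid (j : 'I_m.-1) t : j = 0%N :> nat ->
  sact (Some j) (sact (None : gen) (sact (Some j) (sact (None : gen) t)))
  = sact (None : gen) (sact (Some j) (sact (None : gen) (sact (Some j) t))).
Proof. by move=> e; sact_lia. Qed.

Lemma sact_eq0 s t : (sact s t == 0) = (t == 0).
Proof.
apply/eqP/eqP; last by move=> ->; case: s => [j|]; sact_lia.
by case: s => [j|]; sact_lia.
Qed.

End SactTheory.

Section Theta.
Variables (k : fieldType) (nu : {mset k}) (m : nat).
Local Notation TI := (thetaI nu m).
Implicit Types (i j : TI) (a b : k).

Hypothesis nu1 : multiplicity_one nu.

Definition ent i l : k := nth 0 (theta_val i) l.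

Lemma ent_tnth i (l : 'I_m) : tnth i l = ent i l.
Proof. exact: tnth_nth. Qed.

Lemma theta_count i a : (count_mem a (theta_val i) + count_mem a^-1 (theta_val i))%N = nu a.
Proof.
have /eqP/(congr1 (fun f : {mset k} => f a)) <- := valP i.
rewrite msetE2 !mset_seqE count_map; congr (_ + _)%N.
by apply: eq_count => b /=; apply/eqP/eqP => [->|<-]; rewrite invrK.
Qed.

Lemma nuV i a : nu a^-1 = nu a.
Proof. by rewrite -!(theta_count i) invrK addnC. Qed.

Lemma theta_uniq i : uniq (theta_val i).
Proof.
apply: count_mem_uniq => a; have := nu1 a; rewrite -(theta_count i) => le1.
have := has_pred1 a (theta_val i); rewrite has_count => <-.
by case: (count_mem a _) le1 => [|[|]].
Qed.

Lemma ent_mem i l : (l < m)%N -> ent i l \in theta_val i.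
Proof. by move=> lm; rewrite mem_nth ?size_tuple. Qed.

Lemma mem_nu i a : a \in theta_val i -> nu a != 0%N.
Proof. by rewrite -(theta_count i) -has_pred1 has_count addn_eq0 negb_and -lt0n => ->. Qed.

Lemma ent_nu i l : (l < m)%N -> nu (ent i l) != 0%N.
Proof. by move/(ent_mem i)/mem_nu. Qed.

Lemma mem_theta i a : nu a != 0%N -> (a \in theta_val i) || (a^-1 \in theta_val i).
Proof. by rewrite -(theta_count i) addn_eq0 negb_and -!has_pred1 !has_count !lt0n. Qed.

Lemma theta_neqV i a : a \in theta_val i -> a^-1 \notin theta_val i.
Proof.
move=> ai; apply/negP => bi; have := nu1 a; rewrite -(theta_count i).
move: ai bi; rewrite -!has_pred1 !has_count.
by case: (count_mem a _) => // ?; case: (count_mem a^-1 _) => // ?; rewrite addnS.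
Qed.

Lemma ent_index i a : a \in theta_val i ->
  exists2 l, (l < m)%N & a = ent i l.
Proof.
move=> ai; exists (index a (theta_val i)); last by rewrite /ent nth_index.
by rewrite -[m in (_ < m)%N](size_tuple (theta_val i)) index_mem.
Qed.

Lemma ent_cases i a : nu a != 0%N ->
  exists2 l, (l < m)%N & a = ent i l \/ a = (ent i l)^-1.
Proof.
case/(mem_theta i)/orP => /ent_index[l lm e]; exists l => //; first by left.
by right; rewrite -e invrK.
Qed.

(** The coordinate of the vertex [a] in the chamber [i].  It is odd in [a], and 0
    off the support, in particular at the element 0 of the field. *)
Definition tpos i a : int :=
  if a \in theta_val i then (index a (theta_val i))%:Z + 1
  else if a^-1 \in theta_val i then - ((index a^-1 (theta_val i))%:Z + 1) else 0.

Lemma index_ent i l : (l < m)%N -> index (ent i l) (theta_val i) = l.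
Proof. by move=> lm; rewrite index_uniq ?size_tuple ?theta_uniq. Qed.

Lemma tpos_ent i l : (l < m)%N -> tpos i (ent i l) = l%:Z + 1.
Proof. by move=> lm; rewrite /tpos ent_mem ?index_ent. Qed.

Lemma tpos_entV i l : (l < m)%N -> tpos i (ent i l)^-1 = - (l%:Z + 1).
Proof.
by move=> lm; rewrite /tpos (negPf (theta_neqV (ent_mem i lm))) invrK ent_mem ?index_ent.
Qed.

Lemma tpos_out i a : nu a = 0%N -> tpos i a = 0.
Proof.
move=> a0; rewrite /tpos; case: ifP => [/mem_nu|_]; first by rewrite a0.
by case: ifP => // /mem_nu; rewrite (nuV i) a0.
Qed.

Lemma tposV i a : tpos i a^-1 = - tpos i a.
Proof.
have [a0|an] := eqVneq (nu a) 0%N; first by rewrite !tpos_out ?oppr0 // (nuV i).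
have [l lm [->|->]] := ent_cases i an; rewrite ?invrK tpos_ent // tpos_entV //.
by rewrite opprK.
Qed.

Lemma tpos_neq0 i a : nu a != 0%N -> tpos i a != 0.
Proof. by move=> /(ent_cases i)[l lm [->|->]]; rewrite ?tpos_entV ?tpos_ent //; lia. Qed.

Lemma tpos_bound i a : `|tpos i a| <= m%:Z.
Proof.
have [a0|an] := eqVneq (nu a) 0%N; first by rewrite tpos_out ?normr0.
by have [l lm [->|->]] := ent_cases i an; rewrite ?tpos_entV ?tpos_ent //; lia.
Qed.

Lemma ent_tval i a (l : nat) : tpos i a = l%:Z + 1 -> ent i l = a.
Proof.
have [a0|an] := eqVneq (nu a) 0%N; first by rewrite tpos_out //; lia.
have [l' lm [->|->]] := ent_cases i an; rewrite ?tpos_entV ?tpos_ent // => e.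
  by congr ent; lia.
by exfalso; lia.
Qed.

Lemma ent_tvalN i a (l : nat) : tpos i a = - (l%:Z + 1) -> ent i l = a^-1.
Proof. by move=> e; apply: ent_tval; rewrite tposV e opprK. Qed.

Lemma tpos_ent_of i j a (l : nat) : tpos j a = l%:Z + 1 -> tpos i (ent j l) = tpos i a.
Proof. by move/ent_tval->. Qed.

Lemma tpos_ent_ofN i j a (l : nat) :
  tpos j a = - (l%:Z + 1) -> tpos i (ent j l) = - tpos i a.
Proof. by move/ent_tvalN->; rewrite tposV. Qed.

Lemma tpos_inj i a b : nu a != 0%N -> tpos i a = tpos i b -> a = b.
Proof.
move=> an e; have [l lm [ea|ea]] := ent_cases i an; rewrite ea in e *.
  by apply: ent_tval; rewrite -e tpos_ent.
by apply: invr_inj; rewrite invrK; apply: ent_tvalN; rewrite -e tpos_entV.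
Qed.

Lemma tpos_injN i a b : nu a != 0%N -> tpos i a = - tpos i b -> a = b^-1.
Proof. by move=> an; rewrite -tposV; apply: tpos_inj. Qed.

Lemma theta_eqP i j : (forall a, nu a != 0%N -> tpos i a = tpos j a) -> i = j.
Proof.
move=> e; apply: val_inj; apply: val_inj; apply: (@eq_from_nth _ 0).
  by rewrite !size_tuple.
rewrite size_tuple => l lm; rewrite -/(ent i l) -/(ent j l); apply/esym/ent_tval.
by rewrite -e ?tpos_ent ?ent_nu.
Qed.

(** pi is [None] and sigma_j is [Some j]. *)
Definition wact (s : option 'I_m.-1) i : TI :=
  if s is Some l then theta_swap l i else theta_inv i.

Lemma ent_swap (l : 'I_m.-1) i : ent (theta_swap l i) l = ent i l.+1 /\
  ent (theta_swap l i) l.+1 = ent i l.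
Proof.
split.
  by rewrite -[LHS](ent_tnth _ (pos0 l)) tnth_mktuple ent_tnth /spos tpermL.
by rewrite -[LHS](ent_tnth _ (pos1 l)) tnth_mktuple ent_tnth /spos tpermR.
Qed.

Lemma ent_swapD (l : 'I_m.-1) i l' : (l' < m)%N -> l' != l -> l' != l.+1 ->
  ent (theta_swap l i) l' = ent i l'.
Proof.
move=> lm n0 n1; rewrite -[LHS](ent_tnth _ (Ordinal lm)) tnth_mktuple ent_tnth /spos.
by rewrite tpermD // -val_eqE /= eq_sym.
Qed.

Lemma ent_inv i l : (l < m)%N ->
  ent (theta_inv i) l = if l == 0%N then (ent i l)^-1 else ent i l.
Proof.
by move=> lm; rewrite -[LHS](ent_tnth _ (Ordinal lm)) tnth_mktuple ent_tnth.
Qed.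

Lemma pos_lt (l : 'I_m.-1) : (l.+1 < m)%N.
Proof. exact: pos1_subproof. Qed.

Lemma tpos_wact s i a : tpos (wact s i) a = sact s (tpos i a).
Proof.
have [a0|an] := eqVneq (nu a) 0%N.
  by rewrite !tpos_out //; apply/esym/eqP; rewrite sact_eq0.
wlog [l lm ->] : a {an} / exists2 l, (l < m)%N & a = ent i l.
  move=> IH; have [l lm [e|e]] := ent_cases i an; first by apply: IH; exists l.
  by rewrite e !tposV sactN IH //; exists l.
rewrite tpos_ent //; case: s => [s|] /=.
  have [e0 e1] := ent_swap s i; have sm := pos_lt s.
  have [->|n0] := eqVneq l s; first by rewrite -e1 tpos_ent // eqxx; lia.
  have [->|n1] := eqVneq l s.+1.
    by rewrite -e0 tpos_ent 1?ltnW //; repeat case: eqP; lia.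
  by rewrite -(ent_swapD (l := s)) // tpos_ent //; repeat case: eqP; lia.
have := ent_inv i lm; have [l0|ln] := eqVneq l 0%N => e.
  by rewrite -[ent i l]invrK -e tpos_entV // l0.
rewrite -e tpos_ent //; case: ifP => [/orP[/eqP|/eqP]|//]; lia.
Qed.

Lemma wactK s : involutive (wact s).
Proof. by move=> i; apply: theta_eqP => a _; rewrite !tpos_wact sactK. Qed.

End Theta.

(** * Walls and regions *)

(** The support of nu as a tree rooted at q.  [tv h] is the h-th vertex, [tp h] the
    index of the neighbour through which it is reached from q, and [td h] tells
    which way the arrow between the two points.  A parent has a smaller index than
    its children, which is what the choice of representatives below depends on. *)
Record tree_data (k : fieldType) (p q : k) (nu : {mset k}) (m : nat) := TreeData {
  tv : nat -> k;
  tp : nat -> nat;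
  td : nat -> bool;
  tree_nu1 : multiplicity_one nu;
  tree_p0 : p != 0;
  tree_p4 : p ^+ 4 != 1;
  tree_td0 : td 0 = true;
  tree_tv0 : tv 0 = q;
  tree_tv_neq0 : forall h, (h < m)%N -> tv h != 0;
  tree_inj : forall h g, (h < m)%N -> (g < m)%N -> tv h = tv g -> h = g;
  tree_injV : forall h g, (h < m)%N -> (g < m)%N -> tv h <> (tv g)^-1;
  tree_nuE : forall a, nu a = (\sum_(h < m) ((tv h == a) + ((tv h)^-1 == a)))%N;
  tree_tp : forall h, (0 < h < m)%N -> (tp h < h)%N;
  tree_arr : forall h, (0 < h < m)%N ->
    if td h then tv h = p ^+ 2 * tv (tp h) else tv (tp h) = p ^+ 2 * tv h;
  tree_arrP : forall a b, nu a != 0%N -> nu b != 0%N -> a = p ^+ 2 * b ->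
    exists2 h, (0 < h < m)%N &
      if td h then (a = tv h /\ b = tv (tp h)) \/ (a = (tv (tp h))^-1 /\ b = (tv h)^-1)
      else (a = tv (tp h) /\ b = tv h) \/ (a = (tv h)^-1 /\ b = (tv (tp h))^-1)
}.

Section Region.
Variables (k : fieldType) (p q : k) (nu : {mset k}) (m : nat).
Variable D : tree_data p q nu m.
Local Notation TI := (thetaI nu m).
Implicit Types (i j : TI) (s : option 'I_m.-1) (a b : k).

Local Notation V := (tv D).
Let nu1 := tree_nu1 D.

(** The parent of the vertex h.  For the root it is the element 0 of the field, whose
    coordinate is 0: the wall t_q = 0 then has the form t_v = t_(parent of v) of all
    the others. *)
Definition tup h : k := if h == 0%N then 0 else V (tp D h).

Lemma tupS h : (0 < h)%N -> tup h = V (tp D h).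
Proof. by case: h. Qed.

Lemma nu_tv h : (h < m)%N -> nu (V h) != 0%N.
Proof.
by move=> hm; rewrite (tree_nuE D) (bigD1 (Ordinal hm)) //= eqxx.
Qed.

Lemma nu_0 : nu 0 = 0%N.
Proof.
rewrite (tree_nuE D) big1 // => h _.
by rewrite invr_eq0 (negPf (tree_tv_neq0 D (ltn_ord h))).
Qed.

Lemma nu_neq0 a : nu a != 0%N -> a != 0.
Proof. by apply: contraNneq => ->; rewrite nu_0. Qed.

Lemma tp_lt h : (0 < h)%N -> (h < m)%N -> (tp D h < h)%N /\ (tp D h < m)%N.
Proof.
move=> h0 hm; have lt : (tp D h < h)%N by rewrite tree_tp // h0.
by rewrite lt (ltn_trans lt).
Qed.

Lemma nu_tup h : (0 < h)%N -> (h < m)%N -> nu (tup h) != 0%N.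
Proof.
by move=> h0 hm; rewrite tupS //; apply: nu_tv; case: (tp_lt h0 hm).
Qed.

Lemma tpos_0 i : tpos i 0 = 0.
Proof. exact: tpos_out nu_0. Qed.

Lemma tup_neq (h : nat) : (h < m)%N -> V h <> tup h /\ V h <> (tup h)^-1.
Proof.
move=> hm; rewrite /tup; case: eqP => [_|/eqP].
  by rewrite invr0; split; apply/eqP/(tree_tv_neq0 D).
rewrite -lt0n => h0; have [lt ltm] := tp_lt h0 hm; split; last exact: tree_injV.
by move/(tree_inj hm ltm) => e; move: lt; rewrite -e ltnn.
Qed.

Lemma tpos_tup i h : (h < m)%N ->
  tpos i (V h) <> 0 /\ tpos i (V h) <> tpos i (tup h) /\ tpos i (V h) <> - tpos i (tup h).
Proof.
move=> hm; have [n1 n2] := tup_neq hm; have vn := nu_tv hm.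
split; first exact/eqP/(tpos_neq0 nu1 i vn).
by split=> [/(tpos_inj nu1 vn)|/(tpos_injN nu1 vn)].
Qed.

Lemma tpos_tup0 i h : (h < m)%N -> tpos i (tup h) = 0 -> h = 0%N.
Proof.
by case: h => // h hm /eqP; rewrite (negPf (tpos_neq0 nu1 _ (nu_tup _ hm))).
Qed.

(** Only m of the hyperplanes of the arrangement carry a factor, one for each vertex
    h; [reg i] records on which side of each of them the chamber [i] lies. *)
Definition reg i : {ffun 'I_m -> bool} := [ffun h : 'I_m => tpos i (tup h) < tpos i (V h)].

(** The step [s] from the chamber [j] leads closer to [i]: read in the coordinates of
    [i], it sorts two neighbouring entries of [j] or makes the first one positive. *)
Definition desc s j i : bool :=
  if s is Some l then tpos i (ent j l.+1) < tpos i (ent j l) else tpos i (ent j 0) < 0.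

Definition rdiff j i : {set 'I_m} := [set h | reg j h != reg i h].

Lemma rdiff_some (l : 'I_m.-1) j (h : 'I_m) :
  let v := tpos j (V h) in let u := tpos j (tup h) in
  h \in rdiff j (wact (Some l) j) <->
  (v = l%:Z + 1 /\ u = l%:Z + 2) \/ (v = l%:Z + 2 /\ u = l%:Z + 1) \/
  (v = - (l%:Z + 1) /\ u = - (l%:Z + 2)) \/ (v = - (l%:Z + 2) /\ u = - (l%:Z + 1)).
Proof.
cbv zeta; have [v0 [vu vu']] := tpos_tup j (ltn_ord h).
rewrite inE !ffunE !(tpos_wact nu1).
move: (tpos j (V h)) (tpos j (tup h)) v0 vu vu' => v u v0 vu vu'.
by split; sact_lia.
Qed.

Lemma rdiff_none j (h : 'I_m) :
  h \in rdiff j (wact None j) <-> (tpos j (V h) = 1 \/ tpos j (V h) = -1) /\ h = 0%N :> nat.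
Proof.
have [v0 [vu vu']] := tpos_tup j (ltn_ord h).
have h0 := @tpos_tup0 j h (ltn_ord h).
have u0 : h = 0%N :> nat -> tpos j (tup h) = 0 by move=> e; rewrite /tup e tpos_0.
rewrite inE !ffunE !(tpos_wact nu1).
move: (tpos j (V h)) (tpos j (tup h)) v0 vu vu' h0 u0 => v u v0 vu vu' h0 u0.
split; last by move=> [e1 /u0 e2]; move: e1 e2; sact_lia.
move=> d; suff [e1 /h0 e2] : (v = 1 \/ v = -1) /\ u = 0 by [].
by move: d; clear h0 u0; sact_lia.
Qed.

(** A step across the wall h leads closer to [i] exactly when h separates [j] from
    [i].  The order of the coordinates of h and of its parent changes only when they
    sit, with the same sign, at the two exchanged places. *)
Lemma desc_rdiff s j i h : h \in rdiff j (wact s j) -> desc s j i = (reg j h != reg i h).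
Proof.
have [v0 [vu vu']] := tpos_tup i (ltn_ord h).
case: s => [l|] /=.
  rewrite rdiff_some !ffunE.
  case=> [[ev eu]|[[ev eu]|[[ev eu]|[ev eu]]]]; rewrite ev eu.
  - have eu' : tpos j (tup h) = (l.+1)%:Z + 1 by lia.
    by rewrite (tpos_ent_of nu1 _ ev) (tpos_ent_of nu1 _ eu'); lia.
  - have ev' : tpos j (V h) = (l.+1)%:Z + 1 by lia.
    by rewrite (tpos_ent_of nu1 _ eu) (tpos_ent_of nu1 _ ev'); lia.
  - have eu' : tpos j (tup h) = - ((l.+1)%:Z + 1) by lia.
    by rewrite (tpos_ent_ofN nu1 _ ev) (tpos_ent_ofN nu1 _ eu'); lia.
  - have ev' : tpos j (V h) = - ((l.+1)%:Z + 1) by lia.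
    by rewrite (tpos_ent_ofN nu1 _ eu) (tpos_ent_ofN nu1 _ ev'); lia.
rewrite rdiff_none !ffunE => -[ev h0].
have -> : tup h = 0 by rewrite /tup h0.
rewrite !tpos_0; case: ev => ev; rewrite ev.
  by rewrite (tpos_ent_of nu1 i (l := 0) ev); lia.
by rewrite (tpos_ent_ofN nu1 i (l := 0) ev); lia.
Qed.

(** The factor picked up by crossing the wall h twice, for a function [f] that gives
    the coordinates of the vertices. *)
Definition wallz (R : zmodType) (f : k -> R) h : R :=
  if td D h then f (V h) - f (tup h) else f (tup h) - f (V h).

Definition adj h a b := (V h = a /\ tup h = b) \/ (V h = b /\ tup h = a).

(** A step by sigma_l crosses the wall h when the two exchanged entries are the ends
    of the edge h, or their inverses. *)
Lemma rdiff_adj (l : 'I_m.-1) j (h : 'I_m) :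
  h \in rdiff j (wact (Some l) j) <->
  adj h (ent j l) (ent j l.+1) \/ adj h (ent j l)^-1 (ent j l.+1)^-1.
Proof.
have sm := pos_lt l; have lm := ltnW sm.
have e0 := tpos_ent nu1 j lm; have e1 := tpos_ent nu1 j sm.
have e0' := tpos_entV nu1 j lm; have e1' := tpos_entV nu1 j sm.
rewrite rdiff_some; split.
  case=> [[ev eu]|[[ev eu]|[[ev eu]|[ev eu]]]].
  - left; left; split; apply/esym/(ent_tval nu1) => //; lia.
  - left; right; split; apply/esym/(ent_tval nu1) => //; lia.
  - right; left; split; apply/invr_inj; rewrite invrK; apply/esym/(ent_tvalN nu1) => //; lia.
  - right; right; split; apply/invr_inj; rewrite invrK; apply/esym/(ent_tvalN nu1) => //; lia.
by case=> -[] [-> ->]; rewrite ?e0 ?e1 ?e0' ?e1'; lia.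
Qed.

Lemma adj_inj (h g : 'I_m) a b : adj h a b -> adj g a b -> h = g.
Proof.
have [hm gm] := (ltn_ord h, ltn_ord g).
have inj : V h = V g -> h = g by move/(tree_inj hm gm)/val_inj.
have cross : V h = tup g -> V g = tup h -> h = g.
  rewrite /tup; case: eqP => [_ /eqP|/eqP]; first by rewrite (negPf (tree_tv_neq0 D hm)).
  rewrite -lt0n => g0 e; case: eqP => [_ /eqP|/eqP]; first by rewrite (negPf (tree_tv_neq0 D gm)).
  rewrite -lt0n => h0 e'; have [lg lgm] := tp_lt g0 gm; have [lh lhm] := tp_lt h0 hm.
  move: (tree_inj hm lgm e) (tree_inj gm lhm e') => eh eg.
  by move: lg lh; rewrite -eh -eg => l1 /(ltn_trans l1); rewrite ltnn.
by case=> -[eh uh] [] [eg ug]; [apply: inj | apply: cross | apply: cross | apply: inj]; congruence.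
Qed.

Lemma adj_injV (h g : 'I_m) a b : adj h a b -> adj g a^-1 b^-1 -> h = g.
Proof.
have [hm gm] := (ltn_ord h, ltn_ord g).
have inj : V h <> (V g)^-1 by apply: tree_injV.
have cross : V h = (tup g)^-1 -> h = g.
  rewrite /tup; case: eqP => [_ /eqP|/eqP].
    by rewrite invr0 (negPf (tree_tv_neq0 D hm)).
  rewrite -lt0n => g0 e; case: (tree_injV hm (g := tp D g) _ e).
  by case: (tp_lt g0 gm).
case=> -[eh uh] [] [eg ug].
- by case: inj; rewrite eg invrK.
- by apply: cross; rewrite ug invrK.
- by apply: cross; rewrite ug invrK.
- by case: inj; rewrite eg invrK.
Qed.

Lemma rdiff_some_inj (l : 'I_m.-1) j (h g : 'I_m) :
  h \in rdiff j (wact (Some l) j) -> g \in rdiff j (wact (Some l) j) -> h = g.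
Proof.
rewrite !rdiff_adj => -[ah|ah] [ag|ag].
- exact: adj_inj ah ag.
- exact: adj_injV ah ag.
- by apply/esym; apply: adj_injV ag ah.
- exact: adj_inj ah ag.
Qed.

Lemma arr_asym a b : nu b != 0%N -> arrowI p a b -> ~~ arrowI p b a.
Proof.
move=> /nu_neq0 b0 /eqP->; apply/negP => /eqP/esym/eqP.
rewrite mulrA -exprD -subr_eq0 -[X in _ - X]mul1r -mulrBl mulf_eq0 subr_eq0.
by rewrite (negPf (tree_p4 D)) (negPf b0).
Qed.

Lemma adj_sym h a b : adj h a b -> adj h b a.
Proof. by case; [right | left]. Qed.

(** An arrow between two elements of the support comes from one edge of the tree, and
    its direction gives the sign with which that wall enters the relations. *)
Lemma arrow_wall a b : nu a != 0%N -> nu b != 0%N -> arrowI p a b ->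
  exists h : 'I_m, (adj h a b \/ adj h a^-1 b^-1) /\
    forall (R : zmodType) (f : k -> R), (forall c, f c^-1 = - f c) ->
      f a - f b = wallz f h.
Proof.
move=> an bn /eqP/(tree_arrP D an bn)[h /andP[h0 hm] hE].
exists (Ordinal hm); have eu := tupS h0.
rewrite /wallz /adj /= eu; case: (td D h) hE => -[[-> ->]|[-> ->]];
  rewrite ?invrK; split; try (by left; auto); try (by right; auto).
- by [].
- by move=> R f fN; rewrite !fN opprK addrC.
- by [].
- by move=> R f fN; rewrite !fN opprK addrC.
Qed.

Lemma adj_arrow (h : 'I_m) a b : b != 0 -> adj h a b -> a != 0 ->
  arrowI p a b || arrowI p b a.
Proof.
have hm := ltn_ord h.
have arr : tup h != 0 -> arrowI p (V h) (tup h) || arrowI p (tup h) (V h).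
  have [h0|] := eqVneq (h : nat) 0%N; first by rewrite /tup h0 !eqxx.
  rewrite -lt0n => h0 _; rewrite tupS // /arrowI.
  by have := @tree_arr _ _ _ _ _ D h; rewrite h0 hm; case: (td D h) => -> //;
    rewrite eqxx ?orbT.
by move=> b0 [[<- eu]|[<- eu]] a0; rewrite -eu; [|rewrite orbC]; apply: arr; rewrite eu.
Qed.

Lemma arrow_inv a b : a != 0 -> b != 0 -> arrowI p a^-1 b^-1 -> arrowI p b a.
Proof.
move=> a0 b0 /eqP e; apply/eqP.
by rewrite -[a]invrK e invfM invrK mulVKf // expf_neq0 // (tree_p0 D).
Qed.

Lemma rdiff_arrow (l : 'I_m.-1) j (h : 'I_m) :
  let a := ent j l in let b := ent j l.+1 in
  h \in rdiff j (wact (Some l) j) -> arrowI p a b || arrowI p b a.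
Proof.
have sm := pos_lt l; have lm := ltnW sm.
have a0 := nu_neq0 (ent_nu j lm); have b0 := nu_neq0 (ent_nu j sm).
move=> /=; rewrite rdiff_adj => -[ah|ah]; first exact: adj_arrow ah a0.
have := adj_arrow _ ah; rewrite !invr_eq0 => /(_ b0 a0).
by case/orP => /arrow_inv -> //; rewrite orbT.
Qed.

Lemma ent_neq j (l : 'I_m.-1) : (ent j l == ent j l.+1) = false.
Proof.
have sm := pos_lt l.
by rewrite nth_uniq ?size_tuple ?(theta_uniq nu1) ?(ltnW sm) // ltn_eqF.
Qed.

Lemma arr_total (l : 'I_m.-1) j : let a := ent j l in let b := ent j l.+1 in
  ~~ arr_none p a b -> ~~ arr_only p b a -> arr_only p a b.
Proof.
have as_ := arr_asym (ent_nu j (pos_lt l)) (a := ent j l).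
rewrite /arr_none /arr_only ent_neq /=; move: as_.
by case: (arrowI p (ent j l) _); case: (arrowI p _ (ent j l)) => //= /(_ isT).
Qed.

(** The square of sigma_l is the product of the factors of the walls that it crosses,
    of which there is at most one.  [f] stands for the coordinates in any algebra,
    since both the VV algebra and its matrix model use this; [r0] and [r1] are the
    values of the relation in cases that do not occur. *)
Lemma sigma_wall (R : pzRingType) (f : k -> R) (r0 r1 : R) (l : 'I_m.-1) j :
    (forall c, f c^-1 = - f c) ->
  let a := ent j l in let b := ent j l.+1 in
  (if a == b then r0 else if arr_none p a b then 1
   else if arr_only p b a then f b - f a
   else if arr_only p a b then f a - f b else r1)
  = \prod_(h in rdiff j (wact (Some l) j)) wallz f h.
Proof.
move=> fN a b; have sm := pos_lt l; have lm := ltnW sm.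
have an := ent_nu j lm; have bn := ent_nu j sm; rewrite -/a -/b in an bn.
rewrite /a /b ent_neq -/a -/b /arr_none /arr_only /a /b ent_neq -/a -/b /=.
have one (h : 'I_m) : adj h a b \/ adj h a^-1 b^-1 ->
    \prod_(g in rdiff j (wact (Some l) j)) wallz f g = wallz f h.
  move=> ah; have hin : h \in rdiff j (wact (Some l) j) by apply/rdiff_adj.
  rewrite (big_pred1 h) // => g /=; apply/idP/eqP => [gin|-> //].
  exact: rdiff_some_inj gin hin.
have [ab|nab] /= := boolP (arrowI p a b).
  have nba := arr_asym bn ab; rewrite (negPf nba) /=.
  by have [h [/one-> ->]] := arrow_wall an bn ab.
have [ba|nba] /= := boolP (arrowI p b a).
  have [h [ah ->]] // := arrow_wall bn an ba; rewrite (one h) //.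
  by case: ah => /adj_sym; [left | right].
rewrite big_pred0 // => h; apply/negbTE/negP => /rdiff_arrow.
by rewrite -/a -/b (negPf nab) (negPf nba).
Qed.

Lemma pi_wall (R : pzRingType) (f : k -> R) j :
    (0 < m)%N -> f 0 = 0 -> (forall c, f c^-1 = - f c) ->
  let a := ent j 0 in
  (if a == q then f a else if a == q^-1 then - f a else 1)
  = \prod_(h in rdiff j (wact None j)) wallz f h.
Proof.
move=> m0 f0 fN a; have an : nu a != 0%N := ent_nu j m0.
have qn : nu q != 0%N by rewrite -(tree_tv0 D) nu_tv.
have tpa : tpos j a = 1 by rewrite /a (tpos_ent nu1).
have one : tpos j q = 1 \/ tpos j q = -1 ->
    \prod_(g in rdiff j (wact None j)) wallz f g = f q.
  move=> tq; rewrite (big_pred1 (Ordinal m0)) => [|g].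
    by rewrite /wallz /tup /= (tree_td0 D) f0 subr0 (tree_tv0 D).
  apply/idP/eqP => [/rdiff_none[_ g0]|->]; first exact: val_inj.
  by apply/rdiff_none; rewrite (tree_tv0 D).
have [ea|na] := eqVneq a q; first by rewrite one ?ea //; left; rewrite -ea.
have [ea|na'] := eqVneq a q^-1.
  rewrite one ?ea ?fN ?opprK //; right.
  by rewrite -[q]invrK -ea (tposV nu1) tpa.
rewrite big_pred0 // => h; apply/negbTE/negP => /rdiff_none[tv h0].
move: tv; rewrite h0 (tree_tv0 D) => -[tq|tq].
  by case/eqP: na; apply: (tpos_inj nu1 an (i := j)); rewrite tpa tq.
by case/eqP: na'; apply: (tpos_injN nu1 an (i := j)); rewrite tpa tq opprK.
Qed.

Lemma rdiff_inj s j (h g : 'I_m) :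
  h \in rdiff j (wact s j) -> g \in rdiff j (wact s j) -> h = g.
Proof.
case: s => [l|]; first exact: rdiff_some_inj.
by rewrite !rdiff_none => -[_ h0] [_ g0]; apply: val_inj; rewrite /= h0 g0.
Qed.

(** The region on the other side of the wall h. *)
Definition flip (h : 'I_m) (eps : {ffun 'I_m -> bool}) : {ffun 'I_m -> bool} :=
  [ffun g => if g == h then ~~ eps g else eps g].

Lemma flipE h eps g : flip h eps g = if g == h then ~~ eps g else eps g.
Proof. by rewrite ffunE. Qed.

Lemma flipK h : involutive (flip h).
Proof. by move=> e; apply/ffunP => g; rewrite !ffunE; case: eqP; rewrite ?negbK. Qed.

Lemma flipC h g e : flip h (flip g e) = flip g (flip h e).
Proof. by apply/ffunP => x; rewrite !ffunE; case: eqP; case: eqP. Qed.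

Lemma reg_wact s j :
  reg (wact s j) = reg j \/ exists h, reg (wact s j) = flip h (reg j).
Proof.
have [r0|[h hr]] := set_0Vmem (rdiff j (wact s j)); [left | right].
  by apply/ffunP => g; move/setP/(_ g): r0; rewrite !in_set => /negbFE/eqP.
exists h; apply/ffunP => g; rewrite [RHS]ffunE; case: eqP => [->|/eqP ng].
  by move: hr; rewrite inE; case: (reg j h); case: (reg _ h).
apply/eqP; apply: contraTT ng => ng; rewrite negbK; apply/eqP.
by apply: rdiff_inj hr; rewrite inE eq_sym.
Qed.

(** The representative of a region lists the vertices in the order of the tree and
    varies their signs.  A parent comes before its children, so the coordinate of h
    is larger in absolute value than that of its parent: the sign of h alone decides
    on which side of the wall h the chamber lies, and every region is reached. *)

Definition rep_tuple (eps : {ffun 'I_m -> bool}) : m.-tuple k :=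
  [tuple if eps l then V l else (V l)^-1 | l < m].

Lemma theta_seq_count (t : m.-tuple k) :
  (forall a, \sum_(l < m) ((tnth t l == a) + ((tnth t l)^-1 == a)) = nu a)%N ->
  theta_seq nu t.
Proof.
move=> cnt; apply/eqP/msetP => a; rewrite -cnt msetE2 !mset_seqE count_map.
rewrite -!sum1_count !big_mkcond !big_tuple big_split /=.
rewrite [X in (_ + X = _)%N]big_mkcond.
by congr (_ + _)%N; apply: eq_bigr => l _; rewrite ?tnth_map; case: (_ == a).
Qed.

Lemma rep_theta eps : theta_seq nu (rep_tuple eps).
Proof.
apply: theta_seq_count => a; rewrite (tree_nuE D).
apply: eq_bigr => l _; rewrite tnth_mktuple; case: (eps l); rewrite // invrK.
exact: addnC.
Qed.

Definition rep eps : TI := ThetaI (rep_theta eps).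

Lemma tpos_rep eps (l : 'I_m) :
  tpos (rep eps) (V l) = if eps l then l%:Z + 1 else - (l%:Z + 1).
Proof.
have : ent (rep eps) l = if eps l then V l else (V l)^-1.
  by rewrite -ent_tnth tnth_mktuple.
case: (eps l) => e; first by rewrite -e (tpos_ent nu1).
by rewrite -[V l]invrK -e (tpos_entV nu1).
Qed.

Lemma reg_rep eps : reg (rep eps) = eps.
Proof.
apply/ffunP => h; rewrite ffunE tpos_rep.
have le : `|tpos (rep eps) (tup h)| <= h%:Z.
  have [h0|] := eqVneq (h : nat) 0%N; first by rewrite /tup h0 tpos_0.
  rewrite -lt0n => h0; have [lt ltm] := tp_lt h0 (ltn_ord h); rewrite tupS //.
  by rewrite (tpos_rep eps (Ordinal ltm)) /=; case: ifP; lia.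
by case: (eps h); lia.
Qed.

Lemma rep_inj : injective rep.
Proof. exact: can_inj reg_rep. Qed.

(** Without a descent the coordinates in [i] of the entries of [j] are positive and
    increasing, and they are at most m, so they are 1, ..., m. *)
Lemma desc_eq i j : (forall s, ~~ desc s j i) -> j = i.
Proof.
move=> nd; pose c l := tpos i (ent j l).
have c_neq l (lm : (l < m)%N) : c l <> 0 by apply/eqP/(tpos_neq0 nu1)/ent_nu.
have c0 : (0 < m)%N -> 1 <= c 0%N.
  by move=> m0; have := nd None; have := c_neq _ m0; rewrite /= /c; lia.
have cS l : (l.+1 < m)%N -> c l < c l.+1.
  move=> lm; have lm' : (l < m.-1)%N by lia.
  have := nd (Some (Ordinal lm')); rewrite /= -/(c l) -/(c l.+1).
  have ne : c l <> c l.+1.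
    move/(tpos_inj nu1 (ent_nu j (ltnW lm)))/eqP.
    by rewrite (ent_neq j (Ordinal lm')).
  lia.
have lo l : (l < m)%N -> l%:Z + 1 <= c l.
  elim: l => [|l IHl] lm; first by have := c0 lm; lia.
  by have := IHl (ltnW lm); have := cS _ lm; lia.
have up d : forall l, (l + d.+1 = m)%N -> c l <= l%:Z + 1.
  elim: d => [|d IHd] l e.
    by have := tpos_bound nu1 i (ent j l); rewrite -/(c l); lia.
  have e' : (l.+1 + d.+1 = m)%N by lia.
  have lm : (l.+1 < m)%N by lia.
  by have := IHd _ e'; have := cS _ lm; lia.
have cE l : (l < m)%N -> c l = l%:Z + 1.
  move=> lm; have e : (l + (m - l.+1).+1 = m)%N by lia.
  by have := lo _ lm; have := up _ _ e; lia.
apply: (theta_eqP nu1) => a an; have [l lm ea] := ent_cases j an.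
have := cE _ lm; rewrite /c => ce.
by case: ea => ->; rewrite ?(tposV nu1) ce (tpos_ent nu1).
Qed.

(** Descents increase this potential, by the rearrangement inequality; as it is
    bounded, every chain of descents ends. *)

Definition pot i j : int := \sum_(l < m) (l%:Z + 1) * tpos i (ent j l).

Lemma pot_desc s i j : (0 < m)%N -> desc s j i -> pot i j < pot i (wact s j).
Proof.
move=> m0; case: s => [l|] /= d; rewrite /pot.
  have [e0 e1] := ent_swap l j.
  have n01 : pos1 l != pos0 l by rewrite -val_eqE /= gtn_eqF.
  rewrite (bigD1 (pos0 l)) // (bigD1 (pos1 l)) //= [X in _ < X](bigD1 (pos0 l)) //.
  rewrite [X in _ < _ + X](bigD1 (pos1 l)) //= e0 e1.
  rewrite [X in _ < _ + (_ + X)](eq_bigr (fun g : 'I_m => (g%:Z + 1) * tpos i (ent j g))).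
    by move: (\sum_(_ < _ | _) _) => S; nia.
  move=> g /andP[g0 g1]; rewrite ent_swapD //.
rewrite (bigD1 (Ordinal m0)) //= [X in _ < X](bigD1 (Ordinal m0)) //= ent_inv //=.
rewrite [X in _ < _ + X](eq_bigr (fun g : 'I_m => (g%:Z + 1) * tpos i (ent j g))).
  by rewrite (tposV nu1); move: (\sum_(_ < _ | _) _) => S; lia.
by move=> g g0; rewrite ent_inv // -[(g : nat) == 0%N]/(val g == val (Ordinal m0)) val_eqE (negPf g0).
Qed.

Lemma pot_bound i j : pot i j <= \sum_(l < m) (l%:Z + 1) * m%:Z.
Proof.
by apply: ler_sum => l _; apply: ler_wpM2l; [lia | have := tpos_bound nu1 i (ent j l); lia].
Qed.

Definition depth i j : nat := absz ((\sum_(l < m) (l%:Z + 1) * m%:Z) - pot i j)%R.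

Lemma depth_desc s i j : (0 < m)%N -> desc s j i -> (depth i (wact s j) < depth i j)%N.
Proof.
move=> m0 d; rewrite /depth; have := pot_desc m0 d.
by have := pot_bound i j; have := pot_bound i (wact s j); lia.
Qed.

End Region.

(** * The relations without correction terms *)

Section VVRelations.
Variables (k : fieldType) (p q : k) (nu : {mset k}) (m : nat).
Local Notation TI := (thetaI nu m).

Definition sigma_coef (S : pzRingType) (x : 'I_m -> S) (j : 'I_m.-1) (i : TI) : S :=
  let a := ent i j in let b := ent i j.+1 in
  if a == b then 0 else if arr_none p a b then 1
  else if arr_only p b a then x (pos1 j) - x (pos0 j)
  else if arr_only p a b then x (pos0 j) - x (pos1 j)
  else (x (pos1 j) - x (pos0 j)) * (x (pos0 j) - x (pos1 j)).

Definition pi_coef (S : pzRingType) (x : 'I_m -> S) (l : 'I_m) (i : TI) : S :=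
  if ent i l == q then x l else if ent i l == q^-1 then - x l else 1.

(** The relations of the VV algebra in multiplicity one: no sequence repeats an entry
    up to inversion, so all correction terms vanish.  [g None] stands for pi and
    [g (Some j)] for sigma_j. *)
Record vvrep (S : pzRingType) (x : 'I_m -> S) (g : option 'I_m.-1 -> S) (e : TI -> S) :
    Prop := VVRep {
  vv_ee : forall i i', e i * e i' = if i == i' then e i else 0;
  vv_ge : forall s i, g s * e i = e (wact s i) * g s;
  vv_xe : forall l i, x l * e i = e i * x l;
  vv_e1 : \sum_i e i = 1;
  vv_xx : forall l l', x l * x l' = x l' * x l;
  vv_ss : forall j i, g (Some j) * g (Some j) * e i = sigma_coef x j i * e i;
  vv_pp : forall (l : 'I_m) i, l = 0%N :> nat ->
    g None * g None * e i = pi_coef x l i * e i;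
  vv_far : forall j j' : 'I_m.-1, (j.+1 < j')%N ->
    g (Some j) * g (Some j') = g (Some j') * g (Some j);
  vv_pfar : forall j : 'I_m.-1, (0 < j)%N -> g None * g (Some j) = g (Some j) * g None;
  vv_braid : forall (j j' : 'I_m.-1) i, j' = j.+1 :> nat ->
    g (Some j') * g (Some j) * g (Some j') * e i
    = g (Some j) * g (Some j') * g (Some j) * e i;
  vv_pbraid : forall (j : 'I_m.-1) i, j = 0%N :> nat ->
    g (Some j) * g None * g (Some j) * g None * e i
    = g None * g (Some j) * g None * g (Some j) * e i;
  vv_sx : forall j l i, g (Some j) * x l * e i = x (spos j l) * g (Some j) * e i;
  vv_px0 : forall l : 'I_m, l = 0%N :> nat -> g None * x l = - x l * g None;
  vv_px : forall l : 'I_m, l <> 0%N :> nat -> g None * x l = x l * g None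
}.

Hypothesis nu1 : multiplicity_one nu.

Lemma ent_distinct (i : TI) (l l' : 'I_m) : l != l' :> nat ->
  (tnth i l == tnth i l') = false /\ ((tnth i l)^-1 == tnth i l') = false.
Proof.
move=> nl; rewrite !ent_tnth; split; apply/eqP => e.
  have := tpos_ent nu1 i (ltn_ord l'); rewrite -e (tpos_ent nu1) //.
  by move: nl; lia.
have := tpos_ent nu1 i (ltn_ord l'); rewrite -e (tpos_entV nu1) //.
by move: nl; lia.
Qed.

Lemma pos_neq (j : 'I_m.-1) : pos0 j != pos1 j :> nat.
Proof. by rewrite /=; lia. Qed.

Local Notation W := (vv_kalg p q nu m).
Local Notation F := (free_kalg k (vvgen m TI)).

Definition gen_of (s : option 'I_m.-1) : vvgen m TI :=
  if s is Some j then GenSigma j else GenPi.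

Definition vv_gen (h : vvgen m TI) : W := quo_pi (@vv_rel k p q nu m) (free_gen k h).

(** A morphism from the free algebra respects the defining relations if and only if
    its values on the generators satisfy the simplified ones.  One direction defines
    morphisms on the VV algebra, the other gives the relations in it. *)
Section Evaluate.
Variables (S : kalg k) (f : khom F S).
Variables (x : 'I_m -> S) (g : option 'I_m.-1 -> S) (e : TI -> S).
Hypothesis fX : forall l, f (free_gen k (GenX l)) = x l.
Hypothesis fS : forall j, f (free_gen k (GenSigma j)) = g (Some j).
Hypothesis fP : f (free_gen k GenPi) = g None.
Hypothesis fE : forall i, f (free_gen k (GenE i)) = e i.

Let fM a b a' b' : f a = a' -> f b = b' -> f (a * b) = a' * b'.
Proof. by move=> <- <-; apply: rmorphM. Qed.
Let fD2 a b a' b' : f a = a' -> f b = b' -> f (a - b) = a' - b'.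
Proof. by move=> <- <-; apply: rmorphB. Qed.
Let fN a a' : f a = a' -> f (- a) = - a'.
Proof. by move=> <-; apply: rmorphN. Qed.
Let f2 a a' : f a = a' -> f (a ^+ 2) = a' * a'.
Proof. exact: (fun h => fM h h). Qed.
Let f0 : f 0 = 0. Proof. exact: rmorph0. Qed.
Let f1 : f 1 = 1. Proof. exact: rmorph1. Qed.
Let fif (b : bool) u v u' v' : f u = u' -> f v = v' ->
  f (if b then u else v) = if b then u' else v'.
Proof. by case: b. Qed.

(* The value of [f] on a word, by recursion on its syntax. *)
Ltac feval := match goal with
  | |- _ (free_gen _ (GenX _)) = _ => exact (fX _)
  | |- _ (free_gen _ (GenSigma _)) = _ => exact (fS _)
  | |- _ (free_gen _ GenPi) = _ => exact fP
  | |- _ (free_gen _ (GenE _)) = _ => exact (fE _)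
  | |- _ (_ ^+ 2) = _ => eapply f2; feval
  | |- _ (_ * _) = _ => eapply fM; [feval | feval]
  | |- _ (@Algebra.add _ _ (@Algebra.opp _ _)) = _ => eapply fD2; [feval | feval]
  | |- _ (@Algebra.opp _ _) = _ => eapply fN; feval
  | |- _ (@Algebra.zero _) = _ => exact f0
  | |- _ (@GRing.one _) = _ => exact f1
  | |- _ (if _ then _ else _) = _ => eapply fif; [feval | feval]
  end.

Let eqf u v u' v' : f u = u' -> f v = v' -> u' = v' -> f u = f v.
Proof. by move=> -> ->. Qed.

Let qef u v u' v' : f u = f v -> f u = u' -> f v = v' -> u' = v'.
Proof. by move=> <- <-. Qed.

Let f_sigma j i : f (sigma_sq p j i) = sigma_coef x j i.
Proof.
by rewrite /sigma_sq /sigma_coef (ent_tnth i (pos0 j)) (ent_tnth i (pos1 j)); feval.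
Qed.

Let f_pi l i : f (pi_sq q l i) = pi_coef x l i.
Proof. by rewrite /pi_sq /pi_coef ent_tnth; feval. Qed.

Let no_braid (j j' : 'I_m.-1) (i : TI) : j' = j.+1 :> nat -> braid_defect p j j' i = 0 :> F.
Proof.
move=> ej; rewrite /braid_defect.
by have [|-> _] := @ent_distinct i (pos0 j) (pos1 j'); first by rewrite /= ej; lia.
Qed.

Let no_sx (j : 'I_m.-1) (l : 'I_m) (i : TI) : sigma_x_defect j l i = 0 :> F.
Proof. by rewrite /sigma_x_defect; have [-> _] := ent_distinct i (pos_neq j). Qed.

Let no_pbraid (j : 'I_m.-1) (i : TI) : pi_braid_defect q j i = 0 :> F.
Proof. by rewrite /pi_braid_defect; have [_ ->] := ent_distinct i (pos_neq j). Qed.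

Lemma vvrep_rel u v : vvrep x g e -> vv_rel p q u v -> f u = f v.
Proof.
move=> R; case=> {u v}.
- move=> i i'; eapply eqf; [feval | feval | exact: (vv_ee R)].
- move=> j i; eapply eqf; [feval | feval | exact: (vv_ge R)].
- move=> l i; eapply eqf; [feval | feval | exact: (vv_xe R)].
- rewrite f1 rmorph_sum -(vv_e1 R); apply: eq_bigr => i _; exact: fE.
- move=> l l'; eapply eqf; [feval | feval | exact: (vv_xx R)].
- move=> j i; eapply eqf; [feval | apply: fM; [exact: f_sigma | feval] | exact: (vv_ss R)].
- move=> j j' /orP[lt|lt]; (eapply eqf; [feval | feval |]); first exact: (vv_far R).
  by apply/esym/(vv_far R).
- move=> j j' i ej; rewrite (no_braid i ej); eapply eqf; [feval | feval |].
  by rewrite mul0r mulrBl (vv_braid R) // subrr.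
- move=> j l i; rewrite no_sx; eapply eqf; [feval | feval |].
  by rewrite mul0r mulrBl (vv_sx R) // subrr.
- move=> i; eapply eqf; [feval | feval | exact: (vv_ge R None)].
- move=> l i l0; eapply eqf; [feval | apply: fM; [exact: f_pi | feval] | exact: (vv_pp R)].
- move=> l l0; eapply eqf; [feval | feval | by rewrite (vv_px0 R) // mulNr].
- move=> l l0; eapply eqf; [feval | feval | exact: (vv_px R)].
- move=> j i j0; rewrite no_pbraid; eapply eqf; [feval | feval |].
  by rewrite mul0r !mulrA (vv_pbraid R) // subrr.
- move=> j /eqP; rewrite -lt0n => j0; eapply eqf; [feval | feval | exact: (vv_pfar R)].
Qed.

Lemma rel_vvrep : (forall u v, vv_rel p q u v -> f u = f v) -> vvrep x g e.
Proof.
move=> fR; split.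
- move=> i i'; eapply qef; [exact: fR (VVee _ _ i i') | feval | feval].
- case=> [j|] i; first by eapply qef; [exact: fR (VVse _ _ j i) | feval | feval].
  by eapply qef; [exact: fR (VVpe _ _ i) | feval | feval].
- move=> l i; eapply qef; [exact: fR (VVxe _ _ l i) | feval | feval].
- have := fR _ _ (VVe1 p q nu m); rewrite f1 rmorph_sum => <-.
  by apply: eq_bigr => i _; rewrite -fE.
- move=> l l'; eapply qef; [exact: fR (VVxx _ _ nu l l') | feval | feval].
- move=> j i; eapply qef; [exact: fR (VVsq _ _ j i) | feval | apply: fM; [exact: f_sigma | feval]].
- move=> l i l0; eapply qef; [exact: fR (VVpp _ _ i l0) | feval | apply: fM; [exact: f_pi | feval]].
- move=> j j' lt; have lt' : (j.+1 < j')%N || (j'.+1 < j)%N by rewrite lt.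
  by eapply qef; [exact: fR (VVfar _ _ nu lt') | feval | feval].
- move=> j; rewrite lt0n => /eqP j0.
  by eapply qef; [exact: fR (VVps _ _ nu j0) | feval | feval].
- move=> j j' i ej; apply/eqP; rewrite -subr_eq0 -mulrBl -(mul0r (e i)); apply/eqP.
  by eapply qef; [exact: fR (VVbraid _ _ i ej) | feval | rewrite (no_braid i ej); feval].
- move=> j i j0; apply/eqP; rewrite -subr_eq0 -!mulrA -(mul0r (e i)); apply/eqP.
  rewrite !mulrA -(mulrA (g _ * g _)) -[X in _ - X * _](mulrA (g _ * g _)).
  by eapply qef; [exact: fR (VVpbraid _ _ i j0) | feval | rewrite no_pbraid; feval].
- move=> j l i; apply/eqP; rewrite -subr_eq0 -mulrBl -(mul0r (e i)); apply/eqP.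
  by eapply qef; [exact: fR (VVsx _ _ j l i) | feval | rewrite no_sx; feval].
- move=> l l0; rewrite mulNr.
  by eapply qef; [exact: fR (VVpx0 _ _ nu l0) | feval | feval].
- by move=> l l0; eapply qef; [exact: fR (VVpx _ _ nu l0) | feval | feval].
Qed.

End Evaluate.

Lemma vv_gens : vvrep (fun l => vv_gen (GenX l)) (fun s => vv_gen (gen_of s))
  (fun i => vv_gen (GenE i)).
Proof.
pose f : khom F W := @KHom k F W (quo_pi (@vv_rel k p q nu m)) (fun=> erefl).
by apply: (@rel_vvrep W f) => // u v; apply: quo_pi_rel.
Qed.

Lemma vv_lift (S : kalg k) (x : 'I_m -> S) (g : option 'I_m.-1 -> S) (e : TI -> S) :
  vvrep x g e -> exists psi : khom W S,
    [/\ forall l, psi (vv_gen (GenX l)) = x l,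
        forall s, psi (vv_gen (gen_of s)) = g s &
        forall i, psi (vv_gen (GenE i)) = e i].
Proof.
move=> R; pose val (h : vvgen m TI) : S :=
  match h with
  | GenX l => x l
  | GenSigma j => g (Some j)
  | GenPi => g None
  | GenE i => e i
  end.
have fE h : free_lift val (free_gen k h) = val h := free_liftE val h.
have fR u v : vv_rel p q u v -> free_lift val u = free_lift val v.
  by apply: (vvrep_rel _ _ _ _ R) => *; exact: fE.
exists (quo_lift fR); split=> [l|[j|]|i]; rewrite quo_liftE; exact: fE.
Qed.

End VVRelations.

(** * Galleries *)

Section Coherence.
Variables (k : fieldType) (p q : k) (nu : {mset k}) (m : nat).
Variable D : tree_data p q nu m.
Hypothesis m_gt0 : (0 < m)%N.
Local Notation TI := (thetaI nu m).
Local Notation gen := (option 'I_m.-1).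
Let nu1 := tree_nu1 D.
Variables (W : pzRingType) (x : 'I_m -> W) (g : gen -> W) (e : TI -> W).
Hypothesis R : vvrep p q x g e.
Implicit Types (i j : TI) (s t : gen).

Lemma idem_gen s j : e j * g s = g s * e (wact s j).
Proof. by rewrite (vv_ge R) (wactK nu1). Qed.

Lemma vv_ext (a b : W) : (forall j, a * e j = b * e j) -> a = b.
Proof.
move=> ab; rewrite -[a]mulr1 -[b]mulr1 -(vv_e1 R) !mulr_sumr.
by apply: eq_bigr => j _; apply: ab.
Qed.

(** [gallery i j a]: [a] is the product of the generators along a shortest gallery
    from the chamber [i] to the chamber [j]. *)
Inductive gallery i : TI -> W -> Prop :=
| GalleryNil : gallery i i (e i)
| GalleryCons s j a : desc s j i -> gallery i (wact s j) a -> gallery i j (g s * a).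

Lemma descNid s i : ~~ desc s i i.
Proof.
case: s => [l|] /=; last by rewrite (tpos_ent nu1).
have sm := pos_lt l.
by rewrite !(tpos_ent nu1) ?(ltnW sm) //; lia.
Qed.

Lemma gallery_inv i j a : gallery i j a ->
  (j = i /\ a = e i) \/
  exists s b, [/\ desc s j i, gallery i (wact s j) b & a = g s * b].
Proof. by case=> [|s j' b d gb]; [left | right; exists s, b]. Qed.

Lemma gallery_ex i j : exists a, gallery i j a.
Proof.
have [n] := ubnP (depth i j); elim: n j => // n IHn j le.
have [/existsP[s d]|/existsPn nd] := boolP [exists s, desc s j i].
  have [|a ga] := IHn (wact s j); first exact: leq_trans (depth_desc D m_gt0 d) _.
  by exists (g s * a); apply: GalleryCons.
by exists (e i); rewrite (desc_eq D nd); apply: GalleryNil.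
Qed.

Lemma gallery_el i j a : gallery i j a -> e j * a = a.
Proof.
elim=> [|s j' b d _ IH]; first by rewrite (vv_ee R) eqxx.
by rewrite mulrA idem_gen -mulrA IH.
Qed.

Lemma gallery_er i j a : gallery i j a -> a * e i = a.
Proof.
elim=> [|s j' b d _ IH]; first by rewrite (vv_ee R) eqxx.
by rewrite -mulrA IH.
Qed.

Lemma cswap i j (l : 'I_m.-1) : let c j l := tpos i (ent j l) in
  c (wact (Some l) j) l = c j l.+1 /\ c (wact (Some l) j) l.+1 = c j l.
Proof. by rewrite /=; have [-> ->] := ent_swap l j. Qed.

Lemma cswapD i j (l : 'I_m.-1) l' : (l' < m)%N -> l' != l -> l' != l.+1 ->
  tpos i (ent (wact (Some l) j) l') = tpos i (ent j l').
Proof. by move=> lm n0 n1; rewrite /= ent_swapD. Qed.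

Lemma cinv0 i j : tpos i (ent (wact None j) 0) = - tpos i (ent j 0).
Proof. by rewrite /= ent_inv // (tposV nu1). Qed.

Lemma cinvS i j l : (0 < l)%N -> (l < m)%N ->
  tpos i (ent (wact None j) l) = tpos i (ent j l).
Proof. by move=> l0 lm; rewrite /= ent_inv // eqn0Ngt l0. Qed.

Definition gen_lt s t : bool :=
  match s, t with
  | None, Some _ => true
  | Some j, Some j' => (j < j')%N
  | _, None => false
  end.

(** Two different first steps lie in a common residue of rank two.  If both lead
    towards [i], then so does every step on either side of that residue, and the two
    sides have the same product by the braid relations, or because the generators
    commute. *)
Lemma gallery_diamond i j s t : gen_lt s t -> desc s j i -> desc t j i ->
  exists a b, [/\ gallery i (wact s j) a, gallery i (wact t j) b & g s * a = g t * b].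
Proof.
have far : g s * g t = g t * g s -> wact s (wact t j) = wact t (wact s j) ->
    desc t (wact s j) i -> desc s (wact t j) i ->
    exists a b, [/\ gallery i (wact s j) a, gallery i (wact t j) b & g s * a = g t * b].
  move=> gC wC dt ds; have [a ga] := gallery_ex i (wact t (wact s j)).
  exists (g t * a), (g s * a); split; try exact: GalleryCons.
    by apply: GalleryCons; rewrite // wC.
  by rewrite !mulrA gC.
case: s t far => [l|] [l'|] far //= lt ds dt; last first.
  have [l0|ln] := eqVneq (l' : nat) 0%N.
    have lm : (1 < m)%N by have := pos_lt l'; lia.
    have c0 j' := cinv0 i j'; have c1 j' := @cinvS i j' 1 isT lm.
    have [s0 s1] : (forall j', tpos i (ent (wact (Some l') j') 0) = tpos i (ent j' 1)) /\
       (forall j', tpos i (ent (wact (Some l') j') 1) = tpos i (ent j' 0)).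
      by split=> j'; have [] := cswap i j' l'; rewrite l0.
    move: dt; rewrite l0 => dt.
    pose w1 := wact (Some l') (wact None (wact (Some l') (wact None j))).
    have w2 : w1 = wact None (wact (Some l') (wact None (wact (Some l') j))).
      by apply: (theta_eqP nu1) => a _; rewrite !(tpos_wact nu1) sact_pi_braid.
    have [a ga] := gallery_ex i w1.
    exists (g (Some l') * (g None * (g (Some l') * a))),
           (g None * (g (Some l') * (g None * a))).
    split.
    - do 3!(apply: GalleryCons; first by rewrite /desc ?l0 ?(c0, c1, s0, s1); lia).
      exact: ga.
    - do 3!(apply: GalleryCons; first by rewrite /desc ?l0 ?(c0, c1, s0, s1); lia).
      by rewrite -w2.
    - by rewrite !mulrA -(gallery_el ga) !mulrA (vv_pbraid R).
  have l0 : (0 < l')%N by rewrite lt0n.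
  have sm := pos_lt l'.
  apply: far; first exact: (vv_pfar R).
  - by apply: (theta_eqP nu1) => a _; rewrite !(tpos_wact nu1) sact_pi_far.
  - by rewrite /desc !cinvS ?(ltnW sm).
  - by rewrite /desc cswapD // eq_sym.
have [ll|] := eqVneq (l' : nat) l.+1; last first.
  move=> ne; have lt' : (l.+1 < l')%N by lia.
  have [sm sm'] := (pos_lt l, pos_lt l').
  apply: far; first exact: (vv_far R).
  - by apply: (theta_eqP nu1) => a _; rewrite !(tpos_wact nu1) sact_far.
  - by rewrite /desc !cswapD ?(ltnW sm') //; lia.
  - by rewrite /desc !cswapD ?(ltnW sm) //; lia.
have [sm sm'] := (pos_lt l, pos_lt l').
have [s0 s1] : (forall j', tpos i (ent (wact (Some l) j') l) = tpos i (ent j' l.+1)) /\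
       (forall j', tpos i (ent (wact (Some l) j') l.+1) = tpos i (ent j' l)).
  by split=> j'; have [] := cswap i j' l.
have s2 j' : tpos i (ent (wact (Some l) j') l.+2) = tpos i (ent j' l.+2).
  by rewrite cswapD //; lia.
have [t1 t2] : (forall j', tpos i (ent (wact (Some l') j') l.+1) = tpos i (ent j' l.+2)) /\
       (forall j', tpos i (ent (wact (Some l') j') l.+2) = tpos i (ent j' l.+1)).
  by split=> j'; have [] := cswap i j' l'; rewrite ll.
have t0 j' : tpos i (ent (wact (Some l') j') l) = tpos i (ent j' l).
  by rewrite cswapD //; lia.
move: dt; rewrite ll => dt.
pose w1 := wact (Some l) (wact (Some l') (wact (Some l) j)).
have w2 : w1 = wact (Some l') (wact (Some l) (wact (Some l') j)).
  by apply: (theta_eqP nu1) => a _; rewrite !(tpos_wact nu1) sact_braid.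
have [a ga] := gallery_ex i w1.
exists (g (Some l') * (g (Some l) * a)), (g (Some l) * (g (Some l') * a)); split.
- do 2!(apply: GalleryCons; first by rewrite /desc ?ll ?(s0, s1, s2, t0, t1, t2); lia).
  exact: ga.
- do 2!(apply: GalleryCons; first by rewrite /desc ?ll ?(s0, s1, s2, t0, t1, t2); lia).
  by rewrite -w2.
- by rewrite !mulrA -(gallery_el ga) !mulrA (vv_braid R _ ll).
Qed.

(** The product depends on the two chambers only.  As in the theorem of Matsumoto, this
    follows by induction on the distance from the comparison of two first steps. *)
Lemma gallery_uniq i j a b : gallery i j a -> gallery i j b -> a = b.
Proof.
have [n] := ubnP (depth i j); elim: n j a b => // n IHn j a b le ga gb.
have step s a1 b1 : desc s j i -> gallery i (wact s j) a1 -> gallery i (wact s j) b1 ->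
    a1 = b1.
  by move=> d; apply: IHn; apply: leq_trans (depth_desc D m_gt0 d) _.
case: (gallery_inv ga) => [[ej ->]|[s [a1 [ds ga1 ->]]]].
  case: (gallery_inv gb) => [[_ ->]//|[s [b1 [ds _ _]]]].
  by move: ds; rewrite ej (negPf (descNid _ _)).
case: (gallery_inv gb) => [[ej _]|[t [b1 [dt gb1 ->]]]].
  by move: ds; rewrite ej (negPf (descNid _ _)).
have [est|nst] := eqVneq s t.
  by subst t; rewrite (step s a1 b1).
have [st|ts] : gen_lt s t \/ gen_lt t s.
- case: s t nst {ds dt ga1 gb1} => [l|] [l'|] //=; [|by right|by left].
  by move=> ne; case: (ltngtP l l') => [|| /val_inj el]; [left|right|rewrite el eqxx in ne].
- have [a2 [b2 [ga2 gb2 e2]]] := gallery_diamond st ds dt.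
  by rewrite (step s a1 a2) // (step t b1 b2).
- have [a2 [b2 [ga2 gb2 e2]]] := gallery_diamond ts dt ds.
  by rewrite (step t b1 a2) // (step s a1 b2).
Qed.

(** The element of e(j) W e(i) attached to two chambers. *)
Definition gal i j : W := projT1 (cid (gallery_ex i j)).

Lemma galP i j : gallery i j (gal i j).
Proof. exact: projT2 (cid (gallery_ex i j)). Qed.

Lemma gal_id i : gal i i = e i.
Proof. exact: gallery_uniq (galP i i) (GalleryNil i). Qed.

Lemma gal_desc s i j : desc s j i -> gal i j = g s * gal i (wact s j).
Proof. by move=> d; apply: gallery_uniq (galP i j) (GalleryCons d (galP _ _)). Qed.

Lemma gal_el i j : e j * gal i j = gal i j.
Proof. exact: gallery_el (galP i j). Qed.

Lemma gal_er i j : gal i j * e i = gal i j.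
Proof. exact: gallery_er (galP i j). Qed.

Lemma gal_el0 i j j' : e j' * gal i j = if j' == j then gal i j else 0.
Proof.
by rewrite -(gal_el i j) mulrA (vv_ee R); case: eqP => [->|_]; rewrite ?mul0r.
Qed.

Lemma gal_er0 i j i' : gal i j * e i' = if i == i' then gal i j else 0.
Proof.
by rewrite -(gal_er i j) -mulrA (vv_ee R); case: eqP => _; rewrite ?mulr0.
Qed.

Lemma desc_wact s i j : desc s (wact s j) i = ~~ desc s j i.
Proof.
case: s => [l|].
  have [s0 s1] := cswap i j l; rewrite /desc s0 s1.
  have sm := pos_lt l; have ne := ent_neq D j l.
  suff ne' : tpos i (ent j l) <> tpos i (ent j l.+1) by lia.
  by move/(tpos_inj nu1 (ent_nu j (ltnW sm)))/eqP; rewrite ne.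
rewrite /desc cinv0; have /eqP := tpos_neq0 nu1 i (ent_nu j m_gt0); lia.
Qed.

(** The generator x at the place |t|, with the sign of t. *)

Definition xpos (t : int) : W :=
  match t with
  | Posz 0 => 0
  | Posz n.+1 => if insub n is Some l then x l else 0
  | Negz n => - (if insub n is Some l then x l else 0)
  end.

Lemma xposN (t : int) : xpos (- t) = - xpos t.
Proof.
by case: t => [[|n]|n]; rewrite ?NegzE ?opprK //= ?oppr0.
Qed.

Lemma xposS (l : 'I_m) : xpos (l%:Z + 1) = x l.
Proof.
have -> : l%:Z + 1 = Posz l.+1 by lia.
by rewrite /xpos insubT //= => lm; congr x; apply: val_inj.
Qed.

Lemma g_xpos s (t : int) i : g s * xpos t * e i = xpos (sact s t) * g s * e i.
Proof.
have pos (l : 'I_m) : g s * x l * e i = xpos (sact s (l%:Z + 1)) * g s * e i.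
  case: s => [j|].
    have sm := pos_lt j.
    rewrite (vv_sx R) /spos; congr (_ * _ * _); rewrite -xposS; congr xpos.
    have [->|n0] := eqVneq l (pos0 j); first by rewrite tpermL /= eqxx; lia.
    have [->|n1] := eqVneq l (pos1 j); first by rewrite tpermR /=; repeat case: eqP; lia.
    rewrite tpermD 1?eq_sym //; move: n0 n1; rewrite -!val_eqE /= => n0 n1.
    by repeat case: eqP; lia.
  have [l0|ln] := eqVneq (l : nat) 0%N.
    have -> : sact None (l%:Z + 1) = - (l%:Z + 1) by rewrite l0.
    by rewrite xposN xposS (vv_px0 R l0).
  have -> : sact None (l%:Z + 1) = l%:Z + 1 by rewrite /sact; case: ifP => // /orP[]; lia.
  by rewrite xposS (vv_px R) //; apply/eqP.
have pos' n : g s * xpos (Posz n.+1) * e i = xpos (sact s (Posz n.+1)) * g s * e i.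
  have [nm|mn] := ltnP n m.
    have en : n%:Z + 1 = Posz n.+1 by lia.
    by have := pos (Ordinal nm); rewrite -xposS -[nat_of_ord (Ordinal nm)]/n en.
  have out : xpos (Posz n.+1) = 0 by rewrite /xpos insubF // ltnNge mn.
  have -> : sact s (Posz n.+1) = Posz n.+1.
    case: s {pos} => [j|].
      by have := pos_lt j => jm; rewrite /sact; repeat case: eqP; lia.
    by rewrite /sact; case: ifP => // /orP[]; lia.
  by rewrite out mulr0 !mul0r.
case: t => [[|n]|n]; last by rewrite NegzE sactN !xposN mulrN !mulNr pos'.
  have /eqP -> : sact s 0 == 0 by rewrite sact_eq0.
  by rewrite mulr0 !mul0r.
exact: pos'.
Qed.

Lemma xpos_e (t : int) i : xpos t * e i = e i * xpos t.
Proof.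
have h n : (if insub n is Some l then x l else 0) * e i
          = e i * (if insub n is Some l then x l else 0).
  by case: insub => [l|]; rewrite ?(vv_xe R) // mulr0 mul0r.
by case: t => [[|n]|n] /=; rewrite ?mulrN ?mulNr ?h // mulr0 mul0r.
Qed.

(** The coordinate of the vertex [a] as an element of the algebra.  It is x_l or - x_l
    according to the place and sign of [a] in the sequence; with this sign the
    generators carry it along, so it is central. *)
Definition yy (a : k) : W := \sum_j xpos (tpos j a) * e j.

Lemma yy_e a j : yy a * e j = xpos (tpos j a) * e j.
Proof.
rewrite /yy mulr_suml (bigD1 j) //= big1 ?addr0 => [|i ni].
  by rewrite -mulrA (vv_ee R) eqxx.
by rewrite -mulrA (vv_ee R) (negPf ni) mulr0.
Qed.

Lemma e_yy a j : e j * yy a = yy a * e j.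
Proof.
rewrite yy_e xpos_e /yy mulr_sumr (bigD1 j) //= big1 ?addr0 => [|i ni].
  by rewrite mulrA -xpos_e -mulrA (vv_ee R) eqxx xpos_e.
by rewrite mulrA -xpos_e -mulrA (vv_ee R) eq_sym (negPf ni) mulr0.
Qed.

Lemma g_yy s a : g s * yy a = yy a * g s.
Proof.
apply: vv_ext => j.
have -> : yy a * g s * e j = xpos (tpos (wact s j) a) * g s * e j.
  by rewrite -!mulrA (vv_ge R) !mulrA yy_e.
by rewrite -mulrA yy_e mulrA g_xpos (tpos_wact nu1).
Qed.

Lemma yyV a : yy a^-1 = - yy a.
Proof.
by rewrite /yy -sumrN; apply: eq_bigr => j _; rewrite (tposV nu1) xposN mulNr.
Qed.

Lemma yy0 : yy 0 = 0.
Proof. by rewrite /yy big1 // => j _; rewrite (tpos_0 D) mul0r. Qed.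

Lemma x_yy (l : 'I_m) j : x l * e j = yy (ent j l) * e j.
Proof. by rewrite yy_e (tpos_ent nu1) // xposS. Qed.

Local Notation zz := (wallz D yy).

Lemma central_wallz (a : W) h : (forall b, a * yy b = yy b * a) -> a * zz h = zz h * a.
Proof. by move=> c; rewrite /wallz; case: ifP; rewrite mulrBr mulrBl !c. Qed.

Lemma yyC_gal i j b : gal i j * yy b = yy b * gal i j.
Proof.
elim: (galP i j) => [|s j' a d _ IH]; first exact: e_yy.
by rewrite -mulrA IH mulrA g_yy mulrA.
Qed.

(** The square of a generator is the product of the factors of the walls crossed. *)
Lemma gg_wall s j :
  g s * g s * e j = \prod_(h in rdiff D j (wact s j)) zz h * e j.
Proof.
case: s => [l|].
  rewrite (vv_ss R) -(sigma_wall D 0 ((yy (ent j l.+1) - yy (ent j l))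
    * (yy (ent j l) - yy (ent j l.+1))) l j yyV) /sigma_coef.
  have e0 : x (pos0 l) * e j = yy (ent j l) * e j := x_yy (pos0 l) j.
  have e1 : x (pos1 l) * e j = yy (ent j l.+1) * e j := x_yy (pos1 l) j.
  rewrite (ent_neq D); case: ifP => // _; case: ifP => _; first by rewrite !mulrBl e0 e1.
  case: ifP => _; first by rewrite !mulrBl e0 e1.
  have xC l1 l2 : x l1 * (x l2 * e j) = yy (ent j l1) * (yy (ent j l2) * e j).
    by rewrite (vv_xe R) mulrA x_yy -mulrA -(vv_xe R) x_yy.
  rewrite -!mulrA !mulrBl !mulrBr.
  by rewrite (xC (pos0 l) (pos0 l)) (xC (pos0 l) (pos1 l)) (xC (pos1 l) (pos0 l)) (xC (pos1 l) (pos1 l)).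
rewrite -(pi_wall D j m_gt0 yy0 yyV) (vv_pp R (l := Ordinal m_gt0)) // /pi_coef /=.
have e0 : x (Ordinal m_gt0) * e j = yy (ent j 0) * e j := x_yy (Ordinal m_gt0) j.
by case: ifP => _ //; case: ifP => _ //; rewrite !mulNr e0.
Qed.

Lemma gg_same s j : reg D (wact s j) = reg D j -> g s * g s * e j = e j.
Proof.
by move=> er; rewrite gg_wall big_pred0 ?mul1r // => h; rewrite inE er eqxx.
Qed.

Lemma gg_flip s j h : reg D (wact s j) = flip h (reg D j) -> g s * g s * e j = zz h * e j.
Proof.
move=> er; rewrite gg_wall (big_pred1 h) // => h'; rewrite inE er flipE /=.
by have [->|nh] := eqVneq h' h; [case: (reg D _ _) | rewrite eqxx].
Qed.

(** The wall h is crossed on the way from i to j and again from j to j'. *)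

Definition between i j j' (h : 'I_m) : bool :=
  (reg D j' h != reg D j h) && (reg D j h != reg D i h).

(** Composing two galleries yields the direct one times the factors of the walls that
    are crossed twice; at most one such wall occurs below.  By induction on the second
    gallery: its last step crosses h back exactly when h separates j from i. *)
Lemma gal_comp i j j' (h0 : 'I_m) :
    (forall h, between i j j' h -> h = h0) ->
  gal j j' * gal i j = (if between i j j' h0 then zz h0 else 1) * gal i j'.
Proof.
elim: (galP j j') => [|s j1 a d ga IH] sub.
  by rewrite /between eqxx mul1r gal_el.
have dj := desc_rdiff (D := D) j (s := s) (j := j1).
have di := desc_rdiff (D := D) i (s := s) (j := j1).
set j2 := wact s j1 in ga IH dj di *.
have same : reg D j2 = reg D j1 -> forall h, between i j j1 h = between i j j2 h.
  by rewrite /between => -> h.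
case: (reg_wact D s j1) => [er|[h er]]; rewrite -/j2 in er.
  rewrite -mulrA IH; last by move=> h; rewrite -same //; apply: sub.
  rewrite same //; case: (boolP (desc s j1 i)) => di'.
    rewrite [gal i j1](gal_desc di') -/j2; case: ifP => _; last by rewrite !mul1r.
    rewrite mulrA (central_wallz (a := g s)) ?mulrA //; first by move=> b; apply: g_yy.
  have di2 : desc s j2 i by rewrite desc_wact.
  rewrite [gal i j2](gal_desc di2) /j2 (wactK nu1) -/j2.
  have ggE : g s * (g s * gal i j1) = gal i j1.
    by rewrite -(gal_el i j1) !mulrA gg_same.
  case: ifP => _; last by rewrite !mul1r ggE.
  by rewrite mulrA (central_wallz (a := g s)) -?mulrA ?ggE // => b; apply: g_yy.
have hin : h \in rdiff D j1 j2.
  by rewrite inE er flipE eqxx; case: (reg D _ _).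
have h12 : reg D j2 h = ~~ reg D j1 h by rewrite er flipE eqxx.
have hD h' : h' != h -> reg D j2 h' = reg D j1 h' by move=> nh; rewrite er flipE (negPf nh).
move: d; rewrite (dj _ hin) => dj'.
have b2h : between i j j2 h = false.
  by rewrite /between h12; move: dj'; case: (reg D j1 h); case: (reg D j h).
have sub2 h' : between i j j2 h' -> between i j j1 h'.
  have [->|nh] := eqVneq h' h; first by rewrite b2h.
  by rewrite /between hD.
rewrite -mulrA IH; last by move=> h' /sub2; apply: sub.
have b1h : between i j j1 h = ~~ desc s j1 i.
  by rewrite (di _ hin) /between dj' /=; move: dj'; case: (reg D j1 h); case: (reg D j h); case: (reg D i h).
case: (boolP (desc s j1 i)) => di'.
  have -> : between i j j1 h0 = between i j j2 h0.
    have [->|nh] := eqVneq h0 h; first by rewrite b1h b2h di'.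
    by rewrite /between hD.
  rewrite [gal i j1](gal_desc di') -/j2; case: ifP => _; last by rewrite !mul1r.
  by rewrite mulrA (central_wallz (a := g s)) ?mulrA // => b; apply: g_yy.
have e0 : h = h0 by apply: sub; rewrite b1h.
rewrite -e0 b2h b1h di' mul1r.
have di2 : desc s j2 i by rewrite desc_wact.
rewrite [gal i j2](gal_desc di2) /j2 (wactK nu1).
by rewrite -(gal_el i j1) !mulrA (gg_flip er).
Qed.

End Coherence.

(** * The matrix model of the algebra over a cube algebra *)

Section CubeElements.
Variables (T : pzRingType) (m : nat) (U f : nat -> T).
Hypothesis C : cube_rel m U f.
Implicit Types (h g : 'I_m) (eps : {ffun 'I_m -> bool}).

Definition vert (h : 'I_m) (b : bool) : T := if b then f h else 1 - f h.
(** The idempotents of the vertices of the cube. *)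
Definition vertex_idem eps : T := \prod_(h < m) vert h (eps h).

Let vert_comm h g b c : vert h b * vert g c = vert g c * vert h b.
Proof.
have vc (a : T) (l : 'I_m) d : GRing.comm a (f l) -> GRing.comm a (vert l d).
  by move=> al; case: d => //; apply: commrB => //; apply: commr1.
by apply: (vc); apply: commr_sym; apply: vc; apply: (cubeff C).
Qed.

Let vert_mul h b c : vert h b * vert h c = if b == c then vert h b else 0.
Proof.
have ff : f h * f h = f h by apply: (cubef C).
by case: b c => [] []; rewrite /vert ?(mulrBl, mulrBr, mul1r, mulr1) ?ff ?subrr ?subr0.
Qed.

Let U_vert g h b : U g * vert h b = vert h (if g == h then ~~ b else b) * U g.
Proof.
have Uf : U g * f h = (if g == h then 1 - f h else f h) * U g by apply: (cubeUf C).
case: b; rewrite /vert; first by rewrite Uf; case: eqP.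
rewrite mulrBr mulr1 Uf; case: eqP => _; last by rewrite mulrBl mul1r.
by rewrite mulrBl mul1r opprB addrC subrK.
Qed.

Let vert_prod (s : seq 'I_m) h eps b :
  h \in s -> vert h b * \prod_(g <- s) vert g (eps g)
             = if b == eps h then \prod_(g <- s) vert g (eps g) else 0.
Proof.
elim: s => // g s IHs; rewrite inE big_cons; have [->|nh] /= := eqVneq h g.
  by move=> _; rewrite mulrA vert_mul; case: eqP => [->|_]; rewrite ?mul0r.
by move/IHs => IH; rewrite mulrA vert_comm -mulrA IH; case: eqP; rewrite ?mulr0.
Qed.

Let vert_prodC (s : seq 'I_m) h eps b :
  vert h b * \prod_(g <- s) vert g (eps g) = \prod_(g <- s) vert g (eps g) * vert h b.
Proof.
elim: s => [|g s IHs]; first by rewrite big_nil mulr1 mul1r.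
by rewrite big_cons mulrA vert_comm -mulrA IHs mulrA.
Qed.

Lemma vert_idem h b eps :
  vert h b * vertex_idem eps = if b == eps h then vertex_idem eps else 0.
Proof. by apply: vert_prod; rewrite mem_index_enum. Qed.

Lemma idem_vert h b eps :
  vertex_idem eps * vert h b = if b == eps h then vertex_idem eps else 0.
Proof. by rewrite -vert_prodC vert_idem. Qed.

Lemma f_idem h eps : f h * vertex_idem eps = if eps h then vertex_idem eps else 0.
Proof. by rewrite -[f h]/(vert h true) vert_idem; case: (eps h). Qed.

Lemma vertex_idemM eps eta :
  vertex_idem eps * vertex_idem eta = if eps == eta then vertex_idem eps else 0.
Proof.
have [<-|ne] := eqVneq eps eta.
  have idem (s : seq 'I_m) : {subset s <= index_enum 'I_m} ->
      \prod_(g <- s) vert g (eps g) * vertex_idem eps = vertex_idem eps.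
    elim: s => [|g s IHs] sub; first by rewrite big_nil mul1r.
    rewrite big_cons -mulrA IHs ?vert_idem ?eqxx // => h hs.
    by apply: sub; rewrite inE hs orbT.
  exact: idem.
have [h hne] : exists h, eps h != eta h.
  apply/existsP; apply: contraNT ne => /existsPn e; apply/eqP/ffunP => h.
  by apply/eqP; rewrite -[_ == _]negbK e.
have := vert_idem h (eps h) eta; rewrite (negPf hne) => z.
have {1}-> : vertex_idem eps = vertex_idem eps * vert h (eps h) by rewrite idem_vert eqxx.
by rewrite -mulrA z mulr0.
Qed.

Lemma vertex_idem_sum : \sum_eps vertex_idem eps = 1.
Proof.
rewrite -(bigA_distr_bigA (fun h b => vert h b)) big1 // => h _.
by rewrite big_bool /= addrC subrK.
Qed.

Lemma U_idem h eps : U h * vertex_idem eps = vertex_idem (flip h eps) * U h.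
Proof.
rewrite /vertex_idem; elim: (index_enum _) => [|g s IHs].
  by rewrite !big_nil mulr1 mul1r.
by rewrite !big_cons mulrA U_vert -mulrA IHs mulrA flipE eq_sym; case: eqP.
Qed.

Section Heights.
Variables (k : fieldType) (p q : k) (nu : {mset k}) (D : tree_data p q nu m).
Local Notation V := (tv D).

(** The factor of the wall h has to be U_h^2, and it is the difference of the
    coordinates of h and of its parent.  These equations are solved for the
    coordinates from the root upwards. *)
Lemma heights_ex : exists Y : nat -> T,
  (forall h : nat, (h < m)%N -> U h * U h =
     let up := if h == 0%N then 0 else Y (tp D h) in
     if td D h then Y h - up else up - Y h) /\
  (forall (h : nat) c, (h < m)%N -> (forall g : nat, (g < m)%N -> c * U g = U g * c) -> c * Y h = Y h * c).
Proof.
suff /(_ m) [Y [YE Yc]] : forall n, exists Y : nat -> T,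
  (forall h : nat, (h < n)%N -> (h < m)%N -> U h * U h =
     let up := if h == 0%N then 0 else Y (tp D h) in
     if td D h then Y h - up else up - Y h) /\
  (forall (h : nat) c, (h < n)%N -> (h < m)%N ->
     (forall g : nat, (g < m)%N -> c * U g = U g * c) -> c * Y h = Y h * c).
  by exists Y; split=> [h hm|h c hm]; [apply: YE | apply: Yc].
elim=> [|n [Y [YE Yc]]]; first by exists (fun=> 0).
pose up (h : nat) := if h == 0%N then 0 else Y (tp D h).
pose yn := if td D n then up n + U n * U n else up n - U n * U n.
exists (fun h : nat => if h == n then yn else Y h).
have upE (h : nat) : (h < n.+1)%N -> (h < m)%N ->
    (if h == 0%N then 0 else if tp D h == n then yn else Y (tp D h)) = up h.
  move=> hn hm; rewrite /up; case: eqP => // /eqP; rewrite -lt0n => h0.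
  have lt : (tp D h < h)%N by rewrite tree_tp // h0.
  by rewrite (ltn_eqF (leq_trans lt _)).
split=> [h hn hm|h c hn hm cU].
  rewrite /= upE //; have [->|ne] := eqVneq h n.
    rewrite /yn; case: (td D n); first by rewrite addrAC subrr add0r.
    by rewrite opprB addrC subrK.
  by have := YE h; rewrite /up; apply=> //; rewrite ltn_neqAle ne.
have [en|ne] := eqVneq h n; last by apply: Yc => //; rewrite ltn_neqAle ne.
have cUU : c * (U n * U n) = U n * U n * c.
  by move: (cU _ hm); rewrite en => cn; rewrite mulrA cn -mulrA cn mulrA.
have cup : c * up n = up n * c.
  rewrite /up; case: eqP => [|/eqP]; first by rewrite mulr0 mul0r.
  rewrite -lt0n => n0; have nm : (n < m)%N by rewrite -en.
  by have [lt ltm] := tp_lt D n0 nm; apply: Yc.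
by rewrite /yn; case: (td D n); rewrite ?(mulrBr, mulrBl, mulrDr, mulrDl) cup cUU.
Qed.

End Heights.
End CubeElements.

Section Monomial.
Variables (T : pzRingType) (X : finType).
Local Notation M := 'M[T]_#|X|.

(** Monomial matrices, indexed by an arbitrary finite type: the column [c] has its only
    nonzero entry [t c] in the row [a c]. *)
Definition mono (a : X -> X) (t : X -> T) : M :=
  \matrix_(r, c) if enum_val r == a (enum_val c) then t (enum_val c) else 0.

Definition entry (A : M) (i j : X) : T := A (enum_rank i) (enum_rank j).

Lemma entry_mono a t i j : entry (mono a t) i j = if i == a j then t j else 0.
Proof. by rewrite /entry mxE !enum_rankK. Qed.

Lemma entry_inj (A B : M) : (forall i j, entry A i j = entry B i j) -> A = B.
Proof.
by move=> AB; apply/matrixP => i j; have := AB (enum_val i) (enum_val j); rewrite /entry !enum_valK.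
Qed.

Lemma entryD (A B : M) i j : entry (A + B) i j = entry A i j + entry B i j.
Proof. by rewrite /entry mxE. Qed.

Lemma entry1 i j : entry (1 : M) i j = (i == j)%:R.
Proof. by rewrite /entry mxE (inj_eq enum_rank_inj). Qed.

Lemma entryM (A B : M) i j : entry (A * B) i j = \sum_l entry A i l * entry B l j.
Proof.
rewrite /entry mxE (reindex (@enum_rank X)) //=.
exact: onW_bij (enum_rank_bij X).
Qed.

Lemma entry_monoM a t (A : M) i j :
  entry (mono a t * A) i j = \sum_(l | i == a l) t l * entry A l j.
Proof.
rewrite entryM [RHS]big_mkcond; apply: eq_bigr => l _; rewrite entry_mono.
by case: eqP => _; rewrite // mul0r.
Qed.

Lemma entryM_mono a t (A : M) i j :
  entry (A * mono a t) i j = entry A i (a j) * t j.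
Proof.
rewrite entryM (bigD1 (a j)) //= entry_mono eqxx big1 ?addr0 // => l nl.
by rewrite entry_mono (negPf nl) mulr0.
Qed.

Lemma mono_mul a b t s : mono a t * mono b s = mono (a \o b) (fun c => t (b c) * s c).
Proof.
apply: entry_inj => i j; rewrite entryM_mono !entry_mono /=.
by case: eqP => _; rewrite // mul0r.
Qed.

Lemma eq_mono a b t s :
  (forall c, t c = s c) -> (forall c, t c != 0 -> a c = b c) -> mono a t = mono b s.
Proof.
move=> ts ab; apply: entry_inj => i j; rewrite !entry_mono -ts.
have [->|nz] := eqVneq (t j) 0; first by do 2!case: eqP.
by rewrite ab.
Qed.

Lemma monoD a t s : mono a t + mono a s = mono a (fun c => t c + s c).
Proof.
apply: entry_inj => i j; rewrite entryD !entry_mono.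
by case: eqP => _; rewrite // addr0.
Qed.

Lemma monoN a t : - mono a t = mono a (fun c => - t c).
Proof.
by apply/matrixP => i j; rewrite !mxE; case: eqP => _; rewrite // oppr0.
Qed.

Lemma mono0 a : mono a (fun=> 0) = 0.
Proof. by apply/matrixP => i j; rewrite !mxE; case: eqP. Qed.

Definition diag (i : X) : M := mono id (fun c => if c == i then 1 else 0).

Lemma mono_diag a t i : mono a t * diag i = mono (fun=> a i) (fun c => if c == i then t i else 0).
Proof.
rewrite mono_mul; apply: eq_mono => c /=; have [->|n] := eqVneq c i; rewrite ?mulr1 ?mulr0 //.
by rewrite eqxx.
Qed.

End Monomial.

Section MatrixModel.
Variables (k : fieldType) (p q : k) (nu : {mset k}) (m : nat).
Variable D : tree_data p q nu m.
Hypothesis m_gt0 : (0 < m)%N.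
Local Notation TI := (thetaI nu m).
Local Notation gen := (option 'I_m.-1).
Let nu1 := tree_nu1 D.
Local Notation V := (tv D).
Variables (T : pzRingType) (U f : nat -> T).
Hypothesis C : cube_rel m U f.
Variable Y : nat -> T.
Hypothesis YE : forall h, (h < m)%N -> U h * U h =
  let up := if h == 0%N then 0 else Y (tp D h) in
  if td D h then Y h - up else up - Y h.
Hypothesis YC : forall h c, (h < m)%N ->
  (forall g, (g < m)%N -> c * U g = U g * c) -> c * Y h = Y h * c.
Implicit Types (i j c : TI) (s : gen) (h : 'I_m).

Definition height (a : k) : T :=
  \sum_(h < m) (if V h == a then Y h else if (V h)^-1 == a then - Y h else 0).

Lemma height_tv (h : nat) : (h < m)%N -> height (V h) = Y h.
Proof.
move=> hm; rewrite /height (bigD1 (Ordinal hm)) //= eqxx big1 ?addr0 // => g ng.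
case: eqP => [/(tree_inj (ltn_ord g) hm) e|_].
  by move: ng; rewrite -val_eqE /= e eqxx.
by case: eqP => // e; case: (tree_injV hm (ltn_ord g) (esym e)).
Qed.

Lemma heightV a : height a^-1 = - height a.
Proof.
rewrite /height -sumrN; apply: eq_bigr => h _; have hm := ltn_ord h.
have -> : (V h == a^-1) = ((V h)^-1 == a) by rewrite -(inj_eq invr_inj) invrK.
rewrite (inj_eq invr_inj); case: eqP => [ea|_]; case: eqP => [eb|_]; rewrite ?opprK ?oppr0 //.
by case: (@tree_injV _ _ _ _ _ D h h hm hm); rewrite ea eb.
Qed.

Lemma height0 : height 0 = 0.
Proof.
rewrite /height big1 // => h _.
by rewrite invr_eq0 (negPf (tree_tv_neq0 D (ltn_ord h))).
Qed.

Lemma height_wall h : wallz D height h = U h * U h.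
Proof.
have hm := ltn_ord h; rewrite (YE hm) /wallz height_tv //.
suff -> : height (tup D h) = if h == 0%N :> nat then 0 else Y (tp D h) by [].
case: eqP => [h0|/eqP]; first by rewrite /tup h0 height0.
by rewrite -lt0n => h0; rewrite tupS // height_tv //; case: (tp_lt D h0 hm).
Qed.

Lemma heightC (c : T) a :
  (forall g, (g < m)%N -> c * U g = U g * c) -> c * height a = height a * c.
Proof.
move=> cU; rewrite /height mulr_sumr mulr_suml; apply: eq_bigr => h _.
by do 2?case: eqP => _; rewrite ?(mulrN, mulNr) ?(YC _ cU) ?mulr0 ?mul0r.
Qed.

Lemma heightCU g a : (g < m)%N -> U g * height a = height a * U g.
Proof. by move=> gm; apply: heightC => h hm; apply: (cubeUU C). Qed.

Lemma heightCC a b : height a * height b = height b * height a.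
Proof. by apply: heightC => g gm; rewrite heightCU. Qed.

(** The product of the U_h over the walls between two chambers. *)
Definition Ud i j : T := \prod_(h in rdiff D i j) U h.

Lemma rdiff_sym i j : rdiff D i j = rdiff D j i.
Proof. by apply/setP => h; rewrite !inE eq_sym. Qed.

Lemma Ud_id i : Ud i i = 1.
Proof. by rewrite /Ud big_pred0 // => h; rewrite inE eqxx. Qed.

Lemma U_prod h (S : {set 'I_m}) : h \notin S ->
  U h * \prod_(g in S) U g = \prod_(g in h |: S) U g.
Proof.
move=> hS; rewrite !(big_mkcond (fun g => g \in _)).
have : h \in index_enum 'I_m by rewrite mem_index_enum.
have := index_enum_uniq 'I_m; elim: (index_enum _) => // g s IHs /=.
case/andP => gs us; rewrite inE !big_cons; case/orP => [/eqP eg|hs].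
  subst g; rewrite in_setU1 eqxx (negPf hS) mul1r; congr (_ * _).
  apply: eq_big_seq => g gs'; rewrite in_setU1.
  by case: eqP => // eg; move: gs; rewrite -eg gs'.
have nh : (g == h) = false by apply: contraNF gs => /eqP->.
rewrite in_setU1 nh /= -IHs //; case: ifP => _; last by rewrite !mul1r.
by rewrite !mulrA (cubeUU C).
Qed.

Lemma Ud_height i j a : Ud i j * height a = height a * Ud i j.
Proof.
rewrite /Ud; apply: (big_rec (fun z => z * height a = height a * z)).
  by rewrite mulr1 mul1r.
by move=> g z _ IH; rewrite -mulrA IH mulrA heightCU // mulrA.
Qed.

Lemma rdiff_wact s j : rdiff D j (wact s j) = set0 \/
  exists2 h, rdiff D j (wact s j) = [set h] & reg D (wact s j) = flip h (reg D j).
Proof.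
case: (reg_wact D s j) => [er|[h er]]; [left | right].
  by apply/setP => h; rewrite !inE er eqxx.
exists h => //; apply/setP => g; rewrite !inE er flipE.
by have [->|ng] := eqVneq g h; [case: (reg D _ _) | rewrite eqxx].
Qed.

(** A step that leads away from [c] crosses at most one wall, and one that has not been
    crossed since [c]. *)
Lemma Ud_asc s j c : ~~ desc s j c -> Ud j (wact s j) * Ud c j = Ud c (wact s j).
Proof.
move=> nd; case: (rdiff_wact s j) => [r0|[h r1 er]].
  rewrite {1}/Ud r0 big_set0 mul1r /Ud; congr bigop; apply/boolp.funext => g.
  have /setP/(_ g) := r0; rewrite !inE => /negbFE/eqP <-; by [].
have hin : h \in rdiff D j (wact s j) by rewrite r1 set11.
have eqr : reg D j h = reg D c h.
  by apply/eqP; apply: contraNT nd; rewrite (desc_rdiff c hin).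
rewrite {1}/Ud r1 big_set1 /Ud U_prod; last by rewrite inE eqr eqxx.
apply: eq_bigl => g; rewrite !inE er flipE; have [->|ng] //= := eqVneq g h.
by rewrite eqr; case: (reg D c h).
Qed.

Lemma Ud2 s j : Ud (wact s j) j * Ud j (wact s j)
  = \prod_(h in rdiff D j (wact s j)) wallz D height h.
Proof.
rewrite {1}/Ud rdiff_sym /Ud; case: (rdiff_wact s j) => [->|[h -> _]].
  by rewrite !big_set0 mulr1.
by rewrite !big_set1 height_wall.
Qed.

Local Notation M := 'M[T]_#|{: TI}|.

Definition mxIdem i : M := diag T i.
Definition mxX (l : 'I_m) : M := mono id (fun c => height (ent c l)).
(** A word whose steps all lead away from the starting chamber has a matrix of this form;
    its entries depend on the endpoint only, which makes the braid relations hold. *)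
Definition along (a : TI -> TI) : M := mono a (fun c => Ud c (a c)).
Definition mxG s : M := along (wact s).

Lemma mxG_along s a : (forall c, ~~ desc s (a c) c) -> mxG s * along a = along (wact s \o a).
Proof. by move=> nd; rewrite mono_mul; apply: eq_mono => // c; rewrite Ud_asc. Qed.

Lemma eq_along a b : a =1 b -> along a = along b.
Proof. by move=> ab; apply: eq_mono => c; rewrite ab. Qed.

Let cent c (l : nat) : (l < m)%N -> tpos c (ent c l) = l%:Z + 1.
Proof. exact: tpos_ent. Qed.

Lemma model_far (l l' : 'I_m.-1) : (l.+1 < l')%N ->
  mxG (Some l) * mxG (Some l') = mxG (Some l') * mxG (Some l).
Proof.
move=> lt; have [sm sm'] := (pos_lt l, pos_lt l').
rewrite !mxG_along => [|c|c].
- apply: eq_along => c; apply: (theta_eqP nu1) => a _.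
  by rewrite /comp !(tpos_wact nu1) sact_far.
- by rewrite /desc !cswapD ?cent; lia.
- by rewrite /desc !cswapD ?cent; lia.
Qed.

Lemma model_pfar (l : 'I_m.-1) : (0 < l)%N ->
  mxG None * mxG (Some l) = mxG (Some l) * mxG None.
Proof.
move=> l0; have sm := pos_lt l.
rewrite !mxG_along => [|c|c].
- apply: eq_along => c; apply: (theta_eqP nu1) => a _.
  by rewrite /comp !(tpos_wact nu1) sact_pi_far.
- by rewrite /desc !cinvS ?cent; lia.
- by rewrite /desc !cswapD ?cent; lia.
Qed.

Lemma model_braid (l l' : 'I_m.-1) : l' = l.+1 :> nat ->
  mxG (Some l') * mxG (Some l) * mxG (Some l') =
  mxG (Some l) * mxG (Some l') * mxG (Some l).
Proof.
move=> ll; have [sm sm'] := (pos_lt l, pos_lt l').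
have [s0 s1] : (forall i j, tpos i (ent (wact (Some l) j) l) = tpos i (ent j l.+1)) /\
       (forall i j, tpos i (ent (wact (Some l) j) l.+1) = tpos i (ent j l)).
  by split=> i j; have [] := cswap i j l.
have s2 i j : tpos i (ent (wact (Some l) j) l.+2) = tpos i (ent j l.+2).
  by rewrite cswapD //; lia.
have [t1 t2] : (forall i j, tpos i (ent (wact (Some l') j) l.+1) = tpos i (ent j l.+2)) /\
       (forall i j, tpos i (ent (wact (Some l') j) l.+2) = tpos i (ent j l.+1)).
  by split=> i j; have [] := cswap i j l'; rewrite ll.
have t0 i j : tpos i (ent (wact (Some l') j) l) = tpos i (ent j l).
  by rewrite cswapD //; lia.
have [c0 c1] : (forall c, tpos c (ent c l) = l%:Z + 1) /\
    (forall c, tpos c (ent c l.+1) = l.+1%:Z + 1).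
  by split=> c; rewrite cent //; lia.
have c2 c : tpos c (ent c l.+2) = l.+2%:Z + 1 by rewrite cent //; lia.
rewrite -!mulrA !mxG_along => [|c|c|c|c];
  try by rewrite /desc /comp ?ll ?(s0, s1, s2, t0, t1, t2) ?(c0, c1, c2); lia.
apply: eq_along => c; apply: (theta_eqP nu1) => a _.
by rewrite /comp !(tpos_wact nu1) (sact_braid _ ll).
Qed.

Lemma model_pbraid (l : 'I_m.-1) : l = 0%N :> nat ->
  mxG (Some l) * mxG None * mxG (Some l) * mxG None
  = mxG None * mxG (Some l) * mxG None * mxG (Some l).
Proof.
move=> l0; have lm : (1 < m)%N by have := pos_lt l; lia.
have i0 i j := cinv0 D m_gt0 i j; have i1 i j := @cinvS _ _ _ i j 1 isT lm.
have [s0 s1] : (forall i j, tpos i (ent (wact (Some l) j) 0) = tpos i (ent j 1)) /\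
   (forall i j, tpos i (ent (wact (Some l) j) 1) = tpos i (ent j 0)).
  by split=> i j; have [] := cswap i j l; rewrite l0.
have [c0 c1] : (forall c, tpos c (ent c 0) = 1) /\ (forall c, tpos c (ent c 1) = 2).
  by split=> c; rewrite cent.
rewrite -!mulrA !mxG_along => [|c|c|c|c|c|c];
  try by rewrite /desc /comp ?l0 ?(i0, i1, s0, s1) ?(c0, c1); lia.
apply: eq_along => c; apply: (theta_eqP nu1) => a _.
by rewrite /comp !(tpos_wact nu1) sact_pi_braid.
Qed.

Let loc i (t : T) : M := mono (fun=> i) (fun c => if c == i then t else 0).

Let loc_eq a t i : mono a t * mxIdem i = mono (fun=> a i) (fun c => if c == i then t i else 0).
Proof. exact: mono_diag. Qed.

Let locB (A B : M) i t u :
  A * mxIdem i = loc i t -> B * mxIdem i = loc i u -> (A - B) * mxIdem i = loc i (t - u).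
Proof.
move=> eA eB; rewrite mulrBl eA eB /loc monoN monoD; apply: eq_mono => // c.
by case: eqP; rewrite ?subr0.
Qed.

Let loc1 i : 1 * mxIdem i = loc i 1.
Proof.
rewrite mul1r /loc /mxIdem /diag; apply: eq_mono => // c.
by have [->|nc] := eqVneq c i; rewrite ?eqxx.
Qed.

Let mxX_idem l i : mxX l * mxIdem i = loc i (height (ent i l)).
Proof. exact: loc_eq. Qed.

Lemma mxGG s i : mxG s * mxG s * mxIdem i
  = loc i (\prod_(h in rdiff D i (wact s i)) wallz D height h).
Proof.
by rewrite /mxG /along mono_mul loc_eq /loc /= (wactK nu1) -Ud2.
Qed.

Lemma model_ss (l : 'I_m.-1) i :
  mxG (Some l) * mxG (Some l) * mxIdem i = sigma_coef p mxX l i * mxIdem i.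
Proof.
rewrite mxGG -(sigma_wall D 0 0 l i heightV) /sigma_coef.
have X0 := mxX_idem (pos0 l) i; have X1 := mxX_idem (pos1 l) i.
rewrite (ent_neq D); case: (boolP (arr_none _ _ _)) => n0; first by rewrite loc1.
case: (boolP (arr_only _ (ent i l.+1) _)) => n1; first by rewrite (locB X1 X0).
by rewrite (arr_total D n0 n1) (locB X0 X1).
Qed.

Lemma model_pp (l : 'I_m) i : l = 0%N :> nat ->
  mxG None * mxG None * mxIdem i = pi_coef q mxX l i * mxIdem i.
Proof.
move=> l0; rewrite mxGG -(pi_wall D i m_gt0 height0 heightV) /pi_coef.
have X0 := mxX_idem l i; rewrite l0 in X0 *.
case: ifP => _; first by rewrite X0.
case: ifP => _; last by rewrite loc1.
have := @locB 0 (mxX l) i 0 (height (ent i 0)); rewrite !sub0r => -> //.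
rewrite mul0r /loc -(mono0 T (fun=> i)); apply: eq_mono => // c; by case: eqP.
Qed.

(** The generators act on T-valued functions on the chambers by moving the chamber and
    multiplying by the U_h of the walls crossed: crossing the wall h twice gives U_h^2,
    as required. *)
Lemma matrix_model : vvrep p q mxX mxG mxIdem.
Proof.
split.
- move=> i i'; rewrite loc_eq /=; case: (eqVneq i i') => [->|ne].
    by rewrite -/(loc i' 1) -loc1 mul1r.
  rewrite -(mono0 T (fun=> i')); apply: eq_mono => // c; by case: eqP.
- move=> s i; rewrite /mxG /along loc_eq /mxIdem /diag mono_mul; apply: eq_mono => c /=.
    rewrite (inj_eq (can_inj (wactK nu1 s))).
    by have [->|nc] := eqVneq c i; rewrite ?mul1r ?mul0r ?mulr1 ?mulr0.
  by have [->|nc] := eqVneq c i; rewrite // eqxx.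
- move=> l i; rewrite /mxX /mxIdem /diag !mono_mul; apply: eq_mono => // c /=.
  by case: eqP; rewrite ?mulr1 ?mul1r ?mulr0 ?mul0r.
- apply: entry_inj => i j; rewrite entry1 /entry summxE (bigD1 j) //= big1 => [|c nc].
    by rewrite -/(entry _ _ _) entry_mono eqxx addr0; case: eqP.
  by rewrite -/(entry _ _ _) entry_mono [j == c]eq_sym (negPf nc); case: eqP.
- by move=> l l'; rewrite /mxX !mono_mul; apply: eq_mono => // c /=; rewrite heightCC.
- exact: model_ss.
- exact: model_pp.
- exact: model_far.
- exact: model_pfar.
- by move=> l l' i e; rewrite model_braid.
- by move=> l i e; rewrite model_pbraid.
- move=> l l' i; rewrite /mxG /along /mxX mono_mul [in RHS]mono_mul !loc_eq /=.
  have -> : ent (theta_swap l i) (spos l l') = ent i l'.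
    by rewrite -!ent_tnth tnth_mktuple /spos tpermK.
  by congr mono; apply: boolp.funext => c; case: ifP => // _; rewrite Ud_height.
- move=> l l0; rewrite mulNr /mxG /along /mxX !mono_mul monoN.
  apply: eq_mono => // c /=; rewrite l0 ent_inv //= heightV.
  by rewrite Ud_height mulNr opprK.
- move=> l /eqP l0; rewrite /mxG /along /mxX !mono_mul.
  apply: eq_mono => // c /=; rewrite ent_inv // (negPf l0).
  by rewrite Ud_height.
Qed.

End MatrixModel.

(** * The corner at the representatives *)

Section Equivalence.
Variables (k : fieldType) (p q : k) (nu : {mset k}) (m : nat).
Variable D : tree_data p q nu m.
Hypothesis m_gt0 : (0 < m)%N.
Local Notation TI := (thetaI nu m).
Local Notation gen := (option 'I_m.-1).
Local Notation EPS := {ffun 'I_m -> bool}.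
Let nu1 := tree_nu1 D.

Variables (W : kalg k) (x : 'I_m -> W) (g : gen -> W) (e : TI -> W).
Hypothesis R : vvrep p q x g e.
Hypothesis W_ind : forall P : W -> Prop,
  P 1 -> (forall c a, P a -> P (kscal W c * a)) ->
  (forall a b, P a -> P b -> P (a + b)) ->
  (forall l a, P a -> P (x l * a)) -> (forall s a, P a -> P (g s * a)) ->
  (forall i a, P a -> P (e i * a)) -> forall a, P a.
Hypothesis W_lift : forall (S : kalg k) (x' : 'I_m -> S) (g' : gen -> S) (e' : TI -> S),
  vvrep p q x' g' e' -> exists psi : khom W S,
  [/\ forall l, psi (x l) = x' l, forall s, psi (g s) = g' s & forall i, psi (e i) = e' i].

Variables (T : kalg k) (U f : nat -> T).
Hypothesis cube : is_cube m U f.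
Let C := cube_relP cube.

Implicit Types (i j : TI) (s : gen) (h : 'I_m) (eps eta : EPS).

Local Notation gl := (gal D m_gt0 g e).
Local Notation rp := (rep D).
Local Notation rg := (reg D).
Local Notation zz := (wallz D (yy x e)).

Definition eR : W := \sum_eps e (rp eps).
Definition isrep j : bool := j == rp (rg j).

Lemma isrep_rep eps : isrep (rp eps).
Proof. by rewrite /isrep reg_rep. Qed.

Lemma rep_eqE eps j : (rp eps == j) = (eps == rg j) && isrep j.
Proof.
apply/eqP/andP => [<-|[/eqP-> /eqP <-] //]; first by rewrite reg_rep isrep_rep.
Qed.

Lemma e_eR j : e j * eR = if isrep j then e j else 0.
Proof.
rewrite /eR mulr_sumr (bigD1 (rg j)) //= big1 ?addr0 => [|eps ne].
  by rewrite (vv_ee R) /isrep.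
by rewrite (vv_ee R) eq_sym rep_eqE (negPf ne).
Qed.

Lemma eR_e j : eR * e j = if isrep j then e j else 0.
Proof.
rewrite /eR mulr_suml (bigD1 (rg j)) //= big1 ?addr0 => [|eps ne].
  by rewrite (vv_ee R) /isrep eq_sym; case: eqP => // <-.
by rewrite (vv_ee R) rep_eqE (negPf ne).
Qed.

Lemma eReR : eR * eR = eR.
Proof. by rewrite {1}/eR mulr_suml; apply: eq_bigr => eps _; rewrite e_eR isrep_rep. Qed.

Lemma gl_eR i j : gl i j * eR = if isrep i then gl i j else 0.
Proof.
by rewrite -(gal_er D m_gt0 R i j) -mulrA e_eR; case: ifP; rewrite ?mulr0.
Qed.

Lemma eR_gl i j : eR * gl i j = if isrep j then gl i j else 0.
Proof.
by rewrite -(gal_el D m_gt0 R i j) mulrA eR_e; case: ifP; rewrite ?mul0r.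
Qed.

Lemma gl_comp i j j' : (forall h, ~~ between D i j j' h) -> gl j j' * gl i j = gl i j'.
Proof.
move=> nb; rewrite (gal_comp m_gt0 R (h0 := Ordinal m_gt0)) => [|h].
  by rewrite (negPf (nb _)) mul1r.
by rewrite (negPf (nb h)).
Qed.

(** Chambers of one region are isomorphic objects, so the idempotent [eR] of the
    representatives is full. *)
Lemma gl_inv i j : rg i = rg j -> gl j i * gl i j = e i.
Proof.
move=> eq; rewrite gl_comp => [|h]; first exact: (gal_id D m_gt0 R).
by rewrite /between eq eqxx.
Qed.

(** Crossing the wall h and coming back crosses no other wall twice. *)
Lemma gl_back h eps :
  gl (rp (flip h eps)) (rp eps) * gl (rp eps) (rp (flip h eps)) = zz h * e (rp eps).
Proof.
have bt h' : between D (rp eps) (rp (flip h eps)) (rp eps) h' = (h' == h).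
  rewrite /between !reg_rep flipE; have [->|ne] := eqVneq h' h; last by rewrite eqxx.
  by case: (eps h).
rewrite (gal_comp m_gt0 R (h0 := h)) ?bt ?eqxx ?(gal_id D m_gt0 R) // => h'.
by rewrite bt => /eqP.
Qed.

(** The generators of the corner, restricted to a set [c] of regions: [upart] carries
    each representative to the one across the wall h. *)

Definition upart h (c : EPS -> bool) : W :=
  \sum_eps (if c eps then gl (rp eps) (rp (flip h eps)) else 0).
Definition epart (c : EPS -> bool) : W := \sum_eps (if c eps then e (rp eps) else 0).

Lemma gl_upart eta j h c : gl (rp eta) j * upart h c =
  if c (flip h eta) then gl (rp eta) j * gl (rp (flip h eta)) (rp eta) else 0.
Proof.
rewrite /upart mulr_sumr (bigD1 (flip h eta)) //= big1 ?addr0 => [|eps ne].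
  by rewrite flipK; case: ifP; rewrite ?mulr0.
case: ifP => _; rewrite ?mulr0 // -(gal_er D m_gt0 R (rp eta) j) -mulrA.
rewrite (gal_el0 D m_gt0 R) (inj_eq (@rep_inj _ _ _ _ _ D)) ifN ?mulr0 //.
by apply: contraNneq ne => ->; rewrite flipK.
Qed.

Lemma gl_epart eta j c : gl (rp eta) j * epart c = if c eta then gl (rp eta) j else 0.
Proof.
rewrite /epart mulr_sumr (bigD1 eta) //= big1 ?addr0 => [|eps ne].
  by case: ifP; rewrite ?mulr0 // (gal_er D m_gt0 R).
case: ifP => _; rewrite ?mulr0 // (gal_er0 D m_gt0 R) (inj_eq (@rep_inj _ _ _ _ _ D)).
by rewrite eq_sym (negPf ne).
Qed.

Lemma e_epart eta c : e (rp eta) * epart c = if c eta then e (rp eta) else 0.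
Proof. by have := gl_epart eta (rp eta) c; rewrite (gal_id D m_gt0 R). Qed.

Lemma epart_e eta c : epart c * e (rp eta) = if c eta then e (rp eta) else 0.
Proof.
rewrite /epart mulr_suml (bigD1 eta) //= big1 ?addr0 => [|eps ne].
  by case: ifP; rewrite ?mul0r // (vv_ee R) eqxx.
by case: ifP => _; rewrite ?mul0r // (vv_ee R) (inj_eq (@rep_inj _ _ _ _ _ D)) (negPf ne).
Qed.

Lemma epartM c d : epart c * epart d = epart (fun eps => c eps && d eps).
Proof.
rewrite {1}/epart mulr_suml; apply: eq_bigr => eps _.
by case: (c eps); rewrite ?mul0r //= e_epart.
Qed.

Lemma epart_upart h c d : epart c * upart h d = upart h (fun eps => d eps && c (flip h eps)).
Proof.
rewrite /upart mulr_sumr; apply: eq_bigr => eps _; case: (d eps) => /=; last by rewrite mulr0.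
by rewrite -(gal_el D m_gt0 R) mulrA epart_e; case: ifP => _; rewrite ?mul0r.
Qed.

Lemma upart_epart h c d : upart h c * epart d = upart h (fun eps => c eps && d eps).
Proof.
rewrite {1}/upart mulr_suml; apply: eq_bigr => eps _.
by case: (c eps); rewrite ?mul0r //= gl_epart.
Qed.

Lemma upartM h h' : upart h xpredT * upart h' xpredT =
  \sum_eps gl (rp (flip h' eps)) (rp (flip h (flip h' eps))) * gl (rp eps) (rp (flip h' eps)).
Proof.
rewrite {1}/upart mulr_suml (reindex_inj (can_inj (flipK h'))) /=.
by apply: eq_bigr => eps _; rewrite gl_upart flipK.
Qed.

Lemma upartC h h' : upart h xpredT * upart h' xpredT = upart h' xpredT * upart h xpredT.
Proof.
have [->//|ne] := eqVneq h h'.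
have comp (a b : 'I_m) eps : a != b ->
    gl (rp (flip b eps)) (rp (flip a (flip b eps))) * gl (rp eps) (rp (flip b eps))
    = gl (rp eps) (rp (flip a (flip b eps))).
  move=> nab; apply: gl_comp => c; rewrite /between !reg_rep !flipE.
  have [->|nca] := eqVneq c a; last by rewrite eqxx.
  by rewrite (negPf nab) eqxx andbF.
rewrite !upartM; apply: eq_bigr => eps _; rewrite comp // comp; last by rewrite eq_sym.
by rewrite flipC.
Qed.

Lemma upart_sq h : upart h xpredT * upart h xpredT = zz h * eR.
Proof.
rewrite upartM /eR mulr_sumr; apply: eq_bigr => eps _.
by rewrite flipK gl_back.
Qed.

Lemma eR_upart h c : eR * upart h c = upart h c.
Proof.
rewrite /upart mulr_sumr; apply: eq_bigr => eps _.
by case: ifP => _; rewrite ?mulr0 // eR_gl isrep_rep.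
Qed.

Lemma upart_eR h c : upart h c * eR = upart h c.
Proof.
rewrite /upart mulr_suml; apply: eq_bigr => eps _.
by case: ifP => _; rewrite ?mul0r // gl_eR isrep_rep.
Qed.

Lemma epartT : eR = epart xpredT.
Proof. by []. Qed.


Local Notation CW := (corner_kalg eReR).

Lemma upart_corner h : upart h xpredT \in corner_pred eR.
Proof. by apply/eqP; rewrite eR_upart upart_eR. Qed.
Lemma epart_corner c : epart c \in corner_pred eR.
Proof. by apply/eqP; rewrite epartT !epartM; apply: eq_bigr => eps _; rewrite andbT. Qed.

Definition cornerU (n : nat) : CW :=
  if insub n is Some h then Corner eReR (upart_corner h) else 0.
Definition cornerf (n : nat) : CW :=
  if insub n is Some h then Corner eReR (epart_corner (fun eps => eps h)) else 0.

Lemma cornerU_val h : corner_val (cornerU h) = upart h xpredT.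
Proof. by rewrite /cornerU valK. Qed.
Lemma cornerf_val h : corner_val (cornerf h) = epart (fun eps => eps h).
Proof. by rewrite /cornerf valK. Qed.

(** The corner satisfies the relations of the cube: two different walls can be crossed
    in either order because neither is crossed twice. *)
Lemma corner_cube : cube_rel m cornerU cornerf.
Proof.
have ord (P : nat -> Prop) : (forall h, P h) -> forall n, (n < m)%N -> P n.
  by move=> Ph n nm; apply: (Ph (Ordinal nm)).
have inj (a b : CW) : corner_val a = corner_val b -> a = b by apply: val_inj.
split.
- move=> n n' nm n'm; move: n nm n' n'm.
  apply: (ord) => h; apply: (ord) => h'; apply: (inj).
  by rewrite [LHS]/= [RHS]/= !cornerU_val upartC.
- move=> n n' nm n'm; move: n nm n' n'm.
  apply: (ord) => h; apply: (ord) => h'; apply: (inj).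
  rewrite [LHS]/= [RHS]/= !cornerf_val !epartM.
  by apply: eq_bigr => eps _; rewrite andbC.
- apply: (ord) => h; apply: (inj); rewrite [LHS]/= !cornerf_val epartM.
  by apply: eq_bigr => eps _; rewrite andbb.
- move=> n n' nm n'm; move: n nm n' n'm.
  apply: (ord) => h; apply: (ord) => h'; apply: (inj).
  rewrite [LHS]/= cornerU_val cornerf_val upart_epart val_eqE; case: eqP => [->|/eqP ne].
    rewrite [RHS]/= cornerU_val cornerf_val mulrBl eR_upart epart_upart.
    rewrite -sumrB; apply: eq_bigr => eps _; rewrite flipE eqxx /=.
    by case: (eps h'); rewrite /= ?subr0 ?subrr.
  rewrite [RHS]/= cornerU_val cornerf_val epart_upart.
  by apply: eq_bigr => eps _; rewrite flipE eq_sym (negPf ne).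
Qed.

Lemma phi_ex : exists phi : T -> W,
  [/\ [/\ forall a b, phi (a + b) = phi a + phi b,
      forall a b, phi (a * b) = phi a * phi b,
      forall c a, phi (kscal T c * a) = kscal W c * phi a &
      phi 1 = eR],
      forall h, phi (U h) = upart h xpredT &
      forall h, phi (f h) = epart (fun eps => eps h)].
Proof.
have [phi phiE] := cube_univ cube corner_cube.
exists (fun t => corner_val (phi t)); split; first split.
- by move=> a b; rewrite rmorphD.
- by move=> a b; rewrite rmorphM.
- move=> c a; rewrite rmorphM khomK.
  by rewrite [LHS]/= -mulrA corner_l.
- by rewrite rmorph1.
- by move=> h; have [-> _] := phiE h (ltn_ord h); rewrite cornerU_val.
- by move=> h; have [_ ->] := phiE h (ltn_ord h); rewrite cornerf_val.
Qed.

Section Phi.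
Variable phi : T -> W.
Hypothesis phiD : forall a b, phi (a + b) = phi a + phi b.
Hypothesis phiM : forall a b, phi (a * b) = phi a * phi b.
Hypothesis phiZ : forall c a, phi (kscal T c * a) = kscal W c * phi a.
Hypothesis phi1 : phi 1 = eR.
Hypothesis phiU : forall h, phi (U h) = upart h xpredT.
Hypothesis phif : forall h, phi (f h) = epart (fun eps => eps h).

Let phi0 : phi 0 = 0.
Proof. by apply: (addrI (phi 0)); rewrite -phiD !addr0. Qed.
Let phiB a b : phi (a - b) = phi a - phi b.
Proof. by apply: (addIr (phi b)); rewrite -phiD !subrK. Qed.
Let phiN a : phi (- a) = - phi a.
Proof. by rewrite -sub0r phiB phi0 sub0r. Qed.
Let phi_eR t : phi t * eR = phi t.
Proof. by rewrite -phi1 -phiM mulr1. Qed.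

Lemma phi_vert h b eta :
  phi (vert f h b) * e (rp eta) = if b == eta h then e (rp eta) else 0.
Proof.
case: b => /=; rewrite /vert ?phiB phif ?mulrBl epart_e; first by [].
rewrite phi1 eR_e isrep_rep; case: (eta h) => /=; by rewrite ?subrr ?subr0.
Qed.

Lemma phi_idem eps : phi (vertex_idem f eps) = e (rp eps).
Proof.
have loc eta (s : seq 'I_m) : phi (\prod_(h <- s) vert f h (eps h)) * e (rp eta)
    = if all (fun h => eps h == eta h) s then e (rp eta) else 0.
  elim: s => [|h s IHs]; first by rewrite big_nil phi1 eR_e isrep_rep.
  rewrite big_cons phiM -mulrA IHs /= andbC; case: ifP => _ /=; last by rewrite mulr0.
  exact: phi_vert.
rewrite -[LHS]phi_eR /eR mulr_sumr (bigD1 eps) //= loc.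
rewrite (_ : all _ _); last by apply/allP => h _.
rewrite big1 ?addr0 // => eta ne; rewrite loc ifN //.
apply: contra ne => /allP e1; apply/eqP/ffunP => h.
by apply/esym/eqP/e1; rewrite mem_index_enum.
Qed.

Variable Y : nat -> T.
Hypothesis YE : forall h : nat, (h < m)%N -> U h * U h =
  let up := if h == 0%N then 0 else Y (tp D h) in
  if td D h then Y h - up else up - Y h.

Lemma phi_Y n : (n < m)%N -> phi (Y n) = yy x e (tv D n) * eR.
Proof.
have [b] := ubnP n; elim: b n => // b IH n; rewrite ltnS => nb nm.
have := YE nm; move/(congr1 phi); rewrite phiM -[n in U n]/(nat_of_ord (Ordinal nm)) phiU.
rewrite upart_sq /=.
set up := if n == 0%N then _ else _.
have upE : phi up = yy x e (tup D n) * eR.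
  rewrite /up /tup; case: eqP => [_|/eqP]; first by rewrite phi0 (yy0 D) mul0r.
  rewrite -lt0n => n0; have [lt ltm] := tp_lt D n0 nm.
  by apply: IH => //; apply: leq_trans nb.
rewrite /wallz; case: (td D n); rewrite phiB upE mulrBl.
  by move/addIr.
by move/addrI/oppr_inj.
Qed.

(** The coordinates of the matrix model are sent to those of the algebra, since both are
    determined by the same factors of the walls. *)
Lemma phi_height a : nu a != 0%N -> phi (height D Y a) = yy x e a * eR.
Proof.
have tvE (h : 'I_m) : phi (height D Y (tv D h)) = yy x e (tv D h) * eR.
  by rewrite height_tv // phi_Y.
rewrite (tree_nuE D) sum_nat_eq0 negb_forall => /existsP[h /=].
rewrite addn_eq0 negb_and !eqb0 !negbK => /orP[/eqP<-|/eqP<-]; first exact: tvE.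
by rewrite heightV phiN tvE (yyV D) mulNr.
Qed.

Let wt j := gl (rp (rg j)) j.

(** A step across no wall that separates [i] from [j] just prolongs the gallery: if it
    leads back towards [i], it crosses no wall at all, and its square is trivial. *)
Lemma g_gl s i j : (forall h, h \in rdiff D j (wact s j) -> rg j h = rg i h) ->
  g s * gl i j = gl i (wact s j).
Proof.
move=> same; have [d|nd] := boolP (desc s j i); last first.
  have d' : desc s (wact s j) i by rewrite (desc_wact D m_gt0).
  by rewrite [RHS](gal_desc D m_gt0 R d') (wactK nu1).
rewrite [gl i j](gal_desc D m_gt0 R d) mulrA.
rewrite -(gal_el D m_gt0 R i (wact s j)) mulrA (gg_same (D := D) m_gt0 R) //.
rewrite (wactK nu1); apply/ffunP => h.
apply/eqP; apply: contraTT isT => ne.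
have hin : h \in rdiff D j (wact s j) by rewrite inE.
by move: d; rewrite (desc_rdiff i hin) (same _ hin) eqxx.
Qed.

Lemma g_wt s j : exists u, g s * wt j = wt (wact s j) * phi u.
Proof.
rewrite /wt g_gl => [|h _]; last by rewrite reg_rep.
case: (reg_wact D s j) => [er|[h er]]; rewrite er.
  by exists 1; rewrite phi1 gl_eR isrep_rep.
exists (U h); rewrite phiU gl_upart flipK /=; apply/esym/gl_comp => h'.
by rewrite /between er !reg_rep eqxx.
Qed.

Lemma x_wt (l : 'I_m) j : x l * wt j = wt j * phi (height D Y (ent j l)).
Proof.
rewrite phi_height ?(ent_nu j (ltn_ord l)) // /wt.
rewrite mulrA (yyC_gal D m_gt0 R) -mulrA gl_eR isrep_rep.
by rewrite -(gal_el D m_gt0 R _ j) !mulrA (x_yy D m_gt0 R).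
Qed.

(** The elements [wt j], from the representative of the region of [j] to [j], span W e
    over the image of the cube algebra: their span is stable under all generators.  It
    follows that [phi] maps onto the corner. *)
Lemma phi_span (w : W) : exists t : TI -> T, w * eR = \sum_j wt j * phi (t j).
Proof.
move: w; apply: W_ind.
- exists (fun j => if isrep j then 1 else 0).
  rewrite -(vv_e1 R) mulr_suml; apply: eq_bigr => j _; rewrite e_eR.
  case: ifP => [rj|_]; last by rewrite phi0 mulr0.
  rewrite phi1 /wt -(eqP rj) (gal_id D m_gt0 R) e_eR rj //.
- move=> c a [t at_]; exists (fun j => kscal T c * t j).
  rewrite -mulrA at_ mulr_sumr; apply: eq_bigr => j _.
  by rewrite phiZ !mulrA kscalC.
- move=> a b [t at_] [u bu]; exists (fun j => t j + u j).
  by rewrite mulrDl at_ bu -big_split; apply: eq_bigr => j _; rewrite phiD mulrDr.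
- move=> l a [t at_]; exists (fun j => height D Y (ent j l) * t j).
  rewrite -mulrA at_ mulr_sumr; apply: eq_bigr => j _.
  by rewrite mulrA x_wt phiM mulrA.
- move=> s a [t at_]; pose u j := projT1 (cid (g_wt s j)).
  have uE j : g s * wt j = wt (wact s j) * phi (u j) := projT2 (cid (g_wt s j)).
  exists (fun j => u (wact s j) * t (wact s j)).
  rewrite -mulrA at_ mulr_sumr (reindex_inj (can_inj (wactK nu1 s))) /=.
  by apply: eq_bigr => j _; rewrite mulrA uE (wactK nu1) phiM mulrA.
- move=> i a [t at_]; exists (fun j => if i == j then t j else 0).
  rewrite -mulrA at_ mulr_sumr; apply: eq_bigr => j _.
  rewrite mulrA /wt (gal_el0 D m_gt0 R); case: eqP => // _.
  by rewrite phi0 mul0r mulr0.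
Qed.

Lemma phi_corner (w : W) : exists t, phi t = eR * w * eR.
Proof.
have [t wt_] := phi_span w; rewrite -mulrA wt_ mulr_sumr.
exists (\sum_j (if isrep j then vertex_idem f (rg j) * t j else 0)).
rewrite (big_morph phi phiD phi0); apply: eq_bigr => j _.
rewrite mulrA /wt eR_gl; case: ifP => [rj|_]; last by rewrite phi0 mul0r.
by rewrite phiM phi_idem -{2}(eqP rj) -{1}(eqP rj) (gal_id D m_gt0 R).
Qed.

(** A left inverse of [phi], read off from the matrix model: the block of rows and columns
    of the representatives, cut down by the idempotents of the cube. *)
Section Theta.
Local Notation MW := (mx_kalg T #|{: TI}|).
Variable psi : khom W MW.
Hypothesis psig : forall s, psi (g s) = mxG D U s.
Hypothesis psie : forall i, psi (e i) = mxIdem T i.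

Local Notation ent_ w i j := (entry (psi w : 'M[T]_#|{: TI}|) i j).

Lemma psi_gal i j :
  psi (gl i j) = mono (fun=> j) (fun c => if c == i then Ud D U i j else 0) :> 'M[T]_#|{: TI}|.
Proof.
elim: (galP D m_gt0 g e i j) => [|s j' a d _ IH].
  rewrite psie /mxIdem /diag; apply: eq_mono => c.
    by rewrite Ud_id.
  by have [->|nc] := eqVneq c i; rewrite ?eqxx.
rewrite rmorphM psig IH [LHS]mono_mul; apply: eq_mono => c /=.
  case: eqP => _; last by rewrite mulr0.
  have nd : ~~ desc s (wact s j') i by rewrite (desc_wact D m_gt0) negbK.
  by rewrite (Ud_asc D C nd) (wactK nu1).
by rewrite [LHS](wactK nu1 s).
Qed.

Lemma entry_sum (I : finType) (F : I -> 'M[T]_#|{: TI}|) i j :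
  entry (\sum_c F c) i j = \sum_c entry (F c) i j.
Proof. exact: summxE. Qed.

Lemma Ud_flip h eps : Ud D U (rp (flip h eps)) (rp eps) = U h.
Proof.
rewrite /Ud (big_pred1 h) // => h'; rewrite inE !reg_rep flipE /=.
by have [->|ne] := eqVneq h' h; [case: (eps h) | rewrite eqxx].
Qed.

Lemma psi_upart h w eps i :
  ent_ (upart h xpredT * w) (rp eps) i = U h * ent_ w (rp (flip h eps)) i.
Proof.
rewrite rmorphM /upart rmorph_sum [X in entry X]mulr_suml entry_sum.
rewrite (bigD1 (flip h eps)) //= big1 ?addr0 => [|eta ne].
  rewrite psi_gal entry_monoM flipK (bigD1 (rp (flip h eps))) //= eqxx Ud_flip.
  by rewrite big1 ?addr0 // => c /andP[_ /negPf->]; rewrite mul0r.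
rewrite psi_gal entry_monoM big1 // => c /eqP/(@rep_inj _ _ _ _ _ D) ee.
by move: ne; rewrite ee flipK eqxx.
Qed.

Lemma psi_epart c w eps i :
  ent_ (epart c * w) (rp eps) i = if c eps then ent_ w (rp eps) i else 0.
Proof.
rewrite rmorphM /epart rmorph_sum [X in entry X]mulr_suml entry_sum.
have diagE eta : entry (mxIdem T (rp eta) * (psi w : 'M[T]_#|{: TI}|)) (rp eps) i
    = if eps == eta then ent_ w (rp eps) i else 0.
  rewrite /mxIdem /diag entry_monoM (bigD1 (rp eps)) //= (inj_eq (@rep_inj _ _ _ _ _ D)).
  rewrite big1 ?addr0 => [|l /andP[/eqP <- /eqP]] //.
  by case: eqP; rewrite ?mul1r ?mul0r.
rewrite (bigD1 eps) //= big1 ?addr0 => [|eta ne].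
  case: (c eps); first by rewrite psie diagE eqxx.
  by rewrite rmorph0 mul0r /entry mxE.
case: (c eta); first by rewrite psie diagE eq_sym (negPf ne).
by rewrite rmorph0 mul0r /entry mxE.
Qed.

Lemma psi_eRr w i eta : ent_ (w * eR) i (rp eta) = ent_ w i (rp eta).
Proof.
rewrite rmorphM /eR rmorph_sum [X in entry X]mulr_sumr entry_sum.
rewrite (bigD1 eta) //= big1 ?addr0 => [|eps ne].
  by rewrite psie /mxIdem /diag entryM_mono eqxx mulr1.
rewrite psie /mxIdem /diag entryM_mono (inj_eq (@rep_inj _ _ _ _ _ D)) eq_sym (negPf ne).
by rewrite mulr0.
Qed.

Definition theta (w : W) : T := \sum_eps \sum_eta
  vertex_idem f eps * ent_ w (rp eps) (rp eta) * vertex_idem f eta.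

Lemma thetaD w w' : theta (w + w') = theta w + theta w'.
Proof.
rewrite /theta -big_split; apply: eq_bigr => eps _.
rewrite -big_split; apply: eq_bigr => eta _.
by rewrite rmorphD [entry _ _ _]entryD mulrDr mulrDl.
Qed.

Lemma theta_eR : theta eR = 1.
Proof.
rewrite -(vertex_idem_sum m f); apply: eq_bigr => eps _.
have eE eta : ent_ eR (rp eps) (rp eta) = (eps == eta)%:R.
  rewrite epartT -[epart _]mulr1 psi_epart /= rmorph1 entry1.
  by rewrite (inj_eq (@rep_inj _ _ _ _ _ D)).
rewrite (bigD1 eps) //= big1 ?addr0 => [|eta ne].
  by rewrite eE eqxx mulr1 (vertex_idemM C) eqxx.
by rewrite eE eq_sym (negPf ne) mulr0 mul0r.
Qed.

Lemma theta_Z c w : theta (kscal W c * w) = kscal T c * theta w.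
Proof.
rewrite /theta mulr_sumr; apply: eq_bigr => eps _.
rewrite mulr_sumr; apply: eq_bigr => eta _.
rewrite rmorphM khomK.
have -> : entry (kscal MW c * psi w : 'M[T]_#|{: TI}|) (rp eps) (rp eta)
        = kscal T c * ent_ w (rp eps) (rp eta).
  by rewrite /entry [kscal MW c * _]mul_scalar_mx mxE.
by rewrite !mulrA kscalC.
Qed.

Lemma theta_U h w : theta (phi (U h) * w) = U h * theta w.
Proof.
rewrite phiU /theta mulr_sumr (reindex_inj (can_inj (flipK h))) /=.
apply: eq_bigr => eps _; rewrite mulr_sumr; apply: eq_bigr => eta _.
by rewrite psi_upart flipK !mulrA (U_idem C).
Qed.

Lemma theta_f h w : theta (phi (f h) * w) = f h * theta w.
Proof.
rewrite phif /theta mulr_sumr; apply: eq_bigr => eps _.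
rewrite mulr_sumr; apply: eq_bigr => eta _.
rewrite psi_epart !mulrA (f_idem C).
by case: (eps h); rewrite ?mulr0 ?mul0r.
Qed.

(** On words in the generators of the cube algebra, [theta] undoes [phi] letter by
    letter. *)
Lemma phiK_theta : cancel phi theta.
Proof.
apply: (cube_gen cube) => [|c a IH|a b IHa IHb|[b h] a IH] /=.
- by rewrite phi1 theta_eR.
- by rewrite phiZ theta_Z IH.
- by rewrite phiD thetaD IHa IHb.
- by case: b; rewrite phiM ?theta_U ?theta_f IH.
Qed.

Lemma theta_corner w : theta (eR * w * eR) = theta w.
Proof.
apply: eq_bigr => eps _; apply: eq_bigr => eta _.
by rewrite psi_eRr {1}epartT psi_epart.
Qed.

Lemma thetaK_phi w : phi (theta w) = phi 1 * w * phi 1.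
Proof.
have [t tE] := phi_corner w; rewrite phi1.
by rewrite -theta_corner -tE phiK_theta.
Qed.

Lemma morita_phi : morita_equivalent W T.
Proof.
apply: (@morita_corner _ W T _ phi theta wt (fun j => gl j (rp (rg j))) phiD phiM phiZ
  thetaD phiK_theta thetaK_phi).
- by move=> j; rewrite phi1 gl_eR isrep_rep.
- by move=> j; rewrite phi1 eR_gl isrep_rep.
- rewrite -(vv_e1 R); apply: eq_bigr => j _; apply: gl_inv.
  by rewrite reg_rep.
Qed.

End Theta.
End Phi.

(** Stated for any algebra with the generation and the universal property of the VV
    algebra, and any model of the m-cube algebra. *)
Lemma vv_cube_morita : morita_equivalent W T.
Proof.
have [phi [[phiD phiM phiZ phi1] phiU phif]] := phi_ex.
have [Y [YE YC]] := heights_ex U D.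
have [psi [_ psig psie]] := @W_lift (mx_kalg T #|{: TI}|) _ _ _ (matrix_model m_gt0 C YE YC).
exact: (morita_phi phiD phiM phiZ phi1 phiU phif YE psig psie).
Qed.

End Equivalence.

(** * The support of nu *)

Section Interval.
Variables (k : fieldType) (p q : k) (nu : {mset k}).
Hypothesis p_neq0 : p != 0.
Hypothesis q_neq0 : q != 0.
Hypothesis disjoint_I : forall a : k, ~ (in_Iplus p q a /\ in_Iminus p q a).
Hypothesis p_not_root1 : forall n : nat, (0 < n)%N -> p ^+ n <> 1.
Hypothesis nu_theta : is_thetaNI p q nu.
Hypothesis nu_mult1 : multiplicity_one nu.
(** The vertex p^(2n) q. *)
Definition orb (n : int) : k := p ^ (2 * n) * q.

Lemma orb_neq0 n : orb n != 0.
Proof. by rewrite mulf_neq0 ?expfz_neq0. Qed.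

Lemma orbS n : orb (n + 1) = p ^+ 2 * orb n.
Proof. by rewrite /orb mulrDr mulr1 addrC expfzDr // mulrA. Qed.

Lemma orb_inj : injective orb.
Proof.
have p1 (z : int) : p ^ z = 1 -> z = 0.
  case: z => [[|n]|n] // e; first by case: (@p_not_root1 n.+1).
  by case: (@p_not_root1 n.+1) => //; apply: invr_inj; rewrite invr1 -e.
move=> a b /(mulIf q_neq0) e.
have : p ^ (2 * a - 2 * b) = 1.
  by rewrite expfzDr // e -expfzDr // subrr expr0z.
by move/p1; lia.
Qed.

Lemma orb_injV a b : orb a <> (orb b)^-1.
Proof.
move=> e; apply: (@disjoint_I (orb a)); split; first by exists a.
by exists (- b); rewrite e invfM mulrC mulrN invr_expz mulrC.
Qed.

Variables lo hi : int.
Hypothesis nu_conn : forall i : k, (in_Iplus p q i /\ nu i <> 0%N) <->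
  (exists n : int, (lo <= n <= hi)%R /\ i = p ^ (2 * n) * q).

Lemma nu_orb n : (nu (orb n) != 0%N) = (lo <= n <= hi).
Proof.
apply/idP/idP => [/eqP nn|nn].
  have [n' [le /orb_inj->]] : exists n', (lo <= n' <= hi)%R /\ orb n = orb n'.
    by apply/nu_conn; split=> //; exists n.
  exact: le.
by apply/eqP; have [_ h] := nu_conn (orb n); case: h => //; exists n.
Qed.

Lemma nu_orbV n : nu (orb n)^-1 = nu (orb n).
Proof. by case: nu_theta => _ /(_ (orb n)). Qed.

Lemma nu_supp a : nu a != 0%N -> exists2 n, (lo <= n <= hi) & a = orb n \/ a = (orb n)^-1.
Proof.
move=> an; case: (nu_theta) => /(_ a (elimN eqP an)) [[n ea]|[n ea]] _.
  by exists n; [rewrite -nu_orb /orb -ea | left].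
have ea' : a = (orb (- n))^-1.
  by rewrite /orb ea invfM mulrN -invr_expz invrK mulrC.
by exists (- n); [rewrite -nu_orb -nu_orbV -ea' | right].
Qed.

Hypothesis lohi : lo <= 0 <= hi.

(** The vertices are numbered by the exponents 0, 1, ..., hi followed by -1, -2, ..., lo,
    so that each one but the first comes after its neighbour towards 0. *)

Definition len : nat := (absz (hi - lo)%R).+1.
Definition lab (h : nat) : int := if (h <= absz hi)%N then h%:Z else hi - h%:Z.
Definition unlab (n : int) : nat := if 0 <= n then absz n else absz (hi - n)%R.
Definition parent (h : nat) : nat := if h == (absz hi).+1 then 0%N else h.-1.
Definition towards (h : nat) : bool := (h <= absz hi)%N.

Lemma labK h : unlab (lab h) = h.
Proof.
have /andP[l0 h0] := lohi; rewrite /lab; case: ifP => l; rewrite /unlab; [by []|case: ifP => l'; lia].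
Qed.

Lemma unlabK n : lo <= n <= hi -> lab (unlab n) = n /\ (unlab n < len)%N.
Proof.
have /andP[l0 h0] := lohi; case/andP=> ln nh; rewrite /unlab /lab /len.
by case: (lerP 0 n) => n0; case: ifP => l; lia.
Qed.

Lemma lab_range h : (h < len)%N -> lo <= lab h <= hi.
Proof.
by have /andP[l0 h0] := lohi; rewrite /lab /len => l; case: ifP => l'; lia.
Qed.

Lemma lab_inj : injective lab.
Proof. exact: can_inj labK. Qed.

Lemma lab_parent h : (0 < h)%N ->
  if towards h then lab h = lab (parent h) + 1 else lab (parent h) = lab h + 1.
Proof.
move=> h0; have /andP[l0 H0] := lohi; rewrite /towards /lab /parent.
case: ifP => l; have [e|ne] := eqVneq h (absz hi).+1.
- by rewrite e ltnn in l.
- have e1 : (h.-1 <= absz hi)%N by lia.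
  by rewrite e1 l; lia.
- by rewrite leq0n l; lia.
- have e1 : (h.-1 <= absz hi)%N = false by lia.
  by rewrite e1 l; lia.
Qed.

Let V h := orb (lab h).

Lemma V_nu h : (h < len)%N -> nu (V h) != 0%N.
Proof. by move=> l; rewrite nu_orb lab_range. Qed.

Lemma label_nuE a : nu a = (\sum_(h < len) ((V h == a) + ((V h)^-1 == a)))%N.
Proof.
have [a0|an] := eqVneq (nu a) 0%N.
  rewrite a0 big1 // => h _; have := V_nu (ltn_ord h); rewrite -nu_orbV => n1.
  have n2 := V_nu (ltn_ord h).
  case: eqP => [e|_]; first by move: n2; rewrite e a0.
  by case: eqP => [e|_] //; move: n1; rewrite e a0.
have -> : nu a = 1%N by have := nu_mult1 a; move: an; case: (nu a) => [|[|]].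
have [n nr ea] := nu_supp an; have [ln nl] := unlabK nr.
rewrite (bigD1 (Ordinal nl)) //= /V ln big1 => [|h nh].
  have nV : (orb n == (orb n)^-1) = false by apply/eqP/orb_injV.
  by case: ea => ->; rewrite eqxx ?nV // eq_sym nV.
have nlab : lab h != n.
  by apply: contraNneq nh => e; rewrite -val_eqE /= -e labK.
case: ea => ->; rewrite ?(inj_eq invr_inj) (inj_eq orb_inj) (negPf nlab).
  by case: eqP => // /esym/orb_injV.
by case: eqP => // /orb_injV.
Qed.

(** Each of the vertices counts twice in |nu|, with its inverse. *)
Lemma height_len m : mset_height nu = (2 * m)%N -> m = len.
Proof.
have in_supp a : nu a != 0%N -> (\sum_(c <- finsupp nu) (a == c) = 1)%N.
  move=> an; rewrite (bigD1_seq a) ?fset_uniq ?mem_finsupp //= eqxx big1 // => c.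
  by rewrite eq_sym => /negPf->.
rewrite /mset_height; under eq_bigr do rewrite label_nuE.
rewrite exchange_big /= (eq_bigr (fun=> 2%N)) => [|h _].
  by rewrite sum_nat_const card_ord; lia.
by rewrite big_split /= !in_supp ?nu_orbV ?V_nu.
Qed.

(** Multiplication by p^2 moves the exponent by one, or its opposite for the inverses,
    and never leads from a vertex to an inverse. *)
Lemma label_arrow a b : nu a != 0%N -> nu b != 0%N -> a = p ^+ 2 * b ->
  exists2 h, (0 < h < len)%N &
    if towards h then (a = V h /\ b = V (parent h)) \/ (a = (V (parent h))^-1 /\ b = (V h)^-1)
    else (a = V (parent h) /\ b = V h) \/ (a = (V h)^-1 /\ b = (V (parent h))^-1).
Proof.
move=> an bn ab; have p20 : p ^+ 2 != 0 by rewrite expf_neq0.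
have edge n : lo <= n <= hi -> lo <= n + 1 <= hi -> exists2 h, (0 < h < len)%N &
    if towards h then lab h = n + 1 /\ lab (parent h) = n
    else lab h = n /\ lab (parent h) = n + 1.
  move=> nr nr'; have [ln nl] := unlabK nr; have [ln' nl'] := unlabK nr'.
  have [n0|n0] := lerP 0 n.
    have h0 : (0 < unlab (n + 1))%N by rewrite /unlab; case: ifP; lia.
    exists (unlab (n + 1)); first by rewrite h0.
    have := lab_parent h0; rewrite ln'.
    have -> : towards (unlab (n + 1)) by rewrite /towards /unlab; case: ifP; lia.
    by move=> e; split=> //; lia.
  have h0 : (0 < unlab n)%N by rewrite /unlab; case: ifP; lia.
  exists (unlab n); first by rewrite h0.
  have := lab_parent h0; rewrite ln.
  by have -> : towards (unlab n) = false by rewrite /towards /unlab; case: ifP; lia.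
have [n nr ea] := nu_supp an; have [n' nr' eb] := nu_supp bn.
case: ea => ea; case: eb => eb; rewrite ea eb in ab *.
- have e : n = n' + 1 by apply: orb_inj; rewrite orbS.
  rewrite e in nr *; have [h hr hE] := edge _ nr' nr; exists h => //.
  by rewrite /V; case: (towards h) hE => -[-> ->]; left.
- have en := orbS (n' - 1); rewrite subrK in en.
  by case: (@orb_injV n (n' - 1)); rewrite ab en (invfM (p ^+ 2)) mulVKf.
- by case: (@orb_injV (n' + 1) n); rewrite orbS -ab.
have e : n' = n + 1.
  apply: orb_inj; rewrite orbS; apply: invr_inj.
  by apply: (mulfI p20); rewrite -ab (invfM (p ^+ 2)) mulVKf.
rewrite e in nr' *; have [h hr hE] := edge _ nr nr'; exists h => //.
by rewrite /V; case: (towards h) hE => -[-> ->]; right.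
Qed.

Lemma interval_tree m : mset_height nu = (2 * m)%N -> tree_data p q nu m.
Proof.
move/height_len=> em; subst m.
apply: (@TreeData _ _ _ _ _ V parent towards) => //.
- by apply/eqP/p_not_root1.
- by rewrite /V /lab /= /orb mulr0 expr0z mul1r.
- by move=> h _; apply: orb_neq0.
- by move=> h h' _ _ /orb_inj/lab_inj.
- by move=> h h' _ _; apply: orb_injV.
- exact: label_nuE.
- by move=> h /andP[h0 hl]; rewrite /parent; case: eqP; lia.
- move=> h /andP[h0 hl]; have := lab_parent h0; case: (towards h) => e; by rewrite /V e orbS.
- exact: label_arrow.
Qed.

End Interval.

Theorem theorem2p18 (k : fieldType) (p q : k) (m : nat) (nu : {mset k})
  (char_k : 2%N \notin [pchar k])
  (p_neq0 : p != 0) (q_neq0 : q != 0)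
  (p_neq1 : p != 1) (p_neqN1 : p != -1)
  (p_notin_qZ : forall n : int, p <> q ^ n)
  (q_notin_pZ : forall n : int, q <> p ^ n)
  (one_notin_I : ~ in_I p q 1) (mone_notin_I : ~ in_I p q (-1))
  (disjoint_I : forall a : k, ~ (in_Iplus p q a /\ in_Iminus p q a))
  (q_in_I : in_I p q q)
  (p_notin_I : ~ in_I p q p)
  (p_not_root1 : forall n : nat, (0 < n)%N -> p ^+ n <> 1)
  (nu_theta : is_thetaNI p q nu)
  (nu_mult1 : multiplicity_one nu)
  (nu_height : mset_height nu = (2 * m)%N)
  (q_summand : (1 <= nu q)%N)
  (nu_connected : connected_support p q nu)
  (A := path_kalg k two_cycle) (Atilde := path_kalg k two_cycle) :
  morita_equivalent (vv_kalg p q nu m) (tens (tens_pow A m.-1) Atilde).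
Proof.
have [lo [hi [_ conn]]] := nu_connected.
have q0 : q = orb p q 0 by rewrite /orb mulr0 expr0z mul1r.
have lohi : lo <= 0 <= hi.
  rewrite -(nu_orb p_neq0 q_neq0 p_not_root1 conn) -q0 -lt0n //.
have D : tree_data p q nu m := interval_tree p_neq0 q_neq0 disjoint_I p_not_root1
  nu_theta nu_mult1 conn lohi nu_height.
have m_gt0 : (0 < m)%N.
  by rewrite (height_len p_neq0 q_neq0 disjoint_I p_not_root1 nu_theta nu_mult1 conn lohi nu_height).
have [U [f cube]] := two_cycle_tens_cube k m_gt0.
have W_ind (P : vv_kalg p q nu m -> Prop) :
    P 1 -> (forall c a, P a -> P (kscal (vv_kalg p q nu m) c * a)) ->
    (forall a b, P a -> P b -> P (a + b)) ->
    (forall l a, P a -> P (vv_gen p q (GenX l) * a)) ->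
    (forall s a, P a -> P (vv_gen p q (gen_of nu s) * a)) ->
    (forall i a, P a -> P (vv_gen p q (GenE i) * a)) -> forall a, P a.
  move=> P1 PZ PD Px Pg Pe; apply: quo_generates P1 PZ PD _ => -[l|j||i] a Pa.
  - exact: Px.
  - exact: (Pg (Some j)).
  - exact: (Pg None).
  - exact: Pe.
exact: (vv_cube_morita D m_gt0 (vv_gens p q m nu_mult1) W_ind (fun S x g e => @vv_lift _ _ _ _ _ nu_mult1 S x g e) cube).
Qed.
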